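(* There exist universal constants $0<c_0<1$, $0<c<1$ and $C>1$ such that the following holds. Let $n\ge 1$, let $\mathbb F$ be a finite field with $p=|\mathbb F|$ elements, and let $(|\Psi\rangle,\{A_{\mathbf x}^a\})$ be a symmetric projective strategy for the $3$-player multilinearity game in $n$ variables over $\mathbb F$ which passes the consistency test with probability at least $1-\varepsilon$ and the linearity test with probability at least $1-\varepsilon$. Assume $p\ge n^4\varepsilon^{-1/2}$ and $\varepsilon\le n^{-2/c_0}$. Then there exists a sub-measurement $\{V^g\}_{g\in \mathrm{ML}(\mathbb F^n,\mathbb F)}$ (i.e. $V^g\ge 0$, $\sum_g V^g\le I$, acting on one player's space) such that \[ \mathbb E_{\mathbf x\in\mathbb F^n}\sum_{a\in\mathbb F}\mathrm{Tr}\Big(\big(A_{\mathbf x}^a-\sqrt{V_{\mathbf x}^a}\big)^2\rho\Big)\le C\varepsilon^{c}, \] where $V_{\mathbf x}^a:=\sum_{g:\,g(\mathbf x)=a}V^g$.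
   Context: $\mathrm{ML}(\mathbb F^k,\mathbb F)$ is the set of multilinear functions $\mathbb F^k\to\mathbb F$ (affine in each variable separately). The $r$-player multilinearity game in $n$ variables over $\mathbb F$ ($r\ge3$): the referee performs one of two tests with probability $1/2$ each. Consistency test: pick $\mathbf x\in\mathbb F^n$ uniformly, send $\mathbf x$ to all $r$ players, each answers an element of $\mathbb F$; accept iff all answers are equal. Linearity test: pick $i\in\{1,\dots,n\}$, $\mathbf x\in\mathbb F^n$, and distinct $y_i\neq z_i\in\mathbb F\setminus\{x_i\}$ uniformly at random, set $y_j=z_j=x_j$ for $j\ne i$, send $\mathbf x,\mathbf y,\mathbf z$ to three of the players chosen at random, receive $a,b,c$, accept iff $\frac{b-a}{y_i-x_i}=\frac{c-b}{z_i-y_i}=\frac{c-a}{z_i-x_i}$. A symmetric projective strategy consists of a finite-dimensional Hilbert space $\mathcal H$, a state $|\Psi\rangle\in\mathcal H^{\otimes r}$ invariant under every permutation of the $r$ tensor factors, and for each $\mathbf x\in\mathbb F^n$ a projective measurement $\{A_{\mathbf x}^a\}_{a\in\mathbb F}$ on $\mathcal H$; on question $\mathbf x$ a player measures his factor with $\{A^a_{\mathbf x}\}$ and answers the outcome. $\rho$ is the reduced density matrix of $|\Psi\rangle$ on one tensor factor. *)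

(* Defs.v *)
From HB Require Import structures.
From mathcomp Require Import all_boot all_order all_fingroup all_algebra.
Set Implicit Arguments. Unset Strict Implicit. Unset Printing Implicit Defensive.
Import Order.TTheory GRing.Theory Num.Theory.
Local Open Scope ring_scope.

Section Defs.
Variable K : numClosedFieldType.   (* plays the role of the complex numbers *)

Definition adjmx m n (M : 'M[K]_(m, n)) : 'M[K]_(n, m) := map_mx Num.conj (M^T).

Definition psdmx d (M : 'M[K]_d) : Prop :=
  adjmx M = M /\ forall v : 'cV[K]_d, 0 <= (adjmx v *m M *m v) 0 0.

(* x ^ q for a rational exponent q (used for x > 0 real):
   the nonnegative (denq q)-th root of x ^ (numq q). *)
Definition rpow (x : K) (q : rat) : K :=
  (absz (denq q)).-root (x ^ (numq q)).

(* a tripartite state on (C^d)^{\otimes 3}: amplitudes indexed by 3-tuples of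
   basis indices, i.e. t : 'I_3 -> 'I_d gives the index of each tensor factor *)
Definition state3 d := {ffun {ffun 'I_3 -> 'I_d} -> K}.

Definition normalized d (Psi : state3 d) : Prop :=
  \sum_(t : {ffun 'I_3 -> 'I_d}) `|Psi t| ^+ 2 = 1.

Definition perm_symmetric d (Psi : state3 d) : Prop :=
  forall (s : 'S_3) (t : {ffun 'I_3 -> 'I_d}), Psi [ffun k => t (s k)] = Psi t.

Definition expect3 d (Psi : state3 d) (O : 'I_3 -> 'M[K]_d) : K :=
  \sum_(t : {ffun 'I_3 -> 'I_d}) \sum_(t' : {ffun 'I_3 -> 'I_d}) Num.conj (Psi t) * (\prod_k O k (t k) (t' k)) * Psi t'.

(* reduced density matrix on the first tensor factor *)
Definition rho1 d (Psi : state3 d) : 'M[K]_d :=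
  \matrix_(i, i')
    \sum_(t : {ffun 'I_3 -> 'I_d} | t ord0 == i)
      \sum_(t' : {ffun 'I_3 -> 'I_d} | (t' ord0 == i') && [forall k : 'I_3, (k != ord0) ==> (t k == t' k)])
         Psi t * Num.conj (Psi t').

Definition projmeas (T : finType) d (P : T -> 'M[K]_d) : Prop :=
  (forall a, P a *m P a = P a /\ adjmx (P a) = P a) /\ \sum_a P a = 1%:M.

End Defs.

Section Game.
Variables (F : finFieldType) (n : nat).

Definition point := {ffun 'I_n -> F}.

Definition upd (x : point) (i : 'I_n) (u : F) : point :=
  [ffun j => if j == i then u else x j].

Definition multilinear (g : {ffun point -> F}) : bool :=
  [forall i : 'I_n, forall x : point, exists al : F, exists be : F,
     forall t : F, g (upd x i t) == al * t + be].

Definition lin_accept (xi yi zi a b c : F) : bool :=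
  ((b - a) / (yi - xi) == (c - b) / (zi - yi)) &&
  ((c - b) / (zi - yi) == (c - a) / (zi - xi)).

Variable K : numClosedFieldType.
Variable d : nat.

Definition cons_prob (Psi : state3 K d) (A : point -> F -> 'M[K]_d) : K :=
  (#|{: point}|%:R)^-1 * \sum_(x : point) \sum_(a : F) expect3 Psi (fun _ => A x a).

(* probability of passing the linearity test: i, x uniform, (y_i, z_i) uniform
   among ordered pairs of distinct elements of F \ {x_i}; the three questions
   x, y, z are sent to the three players in a uniformly random order *)
Definition lin_prob (Psi : state3 K d) (A : point -> F -> 'M[K]_d) : K :=
  (n%:R * #|{: point}|%:R * ((#|F| - 1)%:R * (#|F| - 2)%:R))^-1 *
  \sum_(i : 'I_n) \sum_(x : point) \sum_(u : F) \sum_(w : F |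
      [&& u != x i, w != x i & u != w])
    \sum_(a : F) \sum_(b : F) \sum_(c : F | lin_accept (x i) u w a b c)
      (#|{: 'S_3}|%:R)^-1 * \sum_(s : 'S_3)
        expect3 Psi (fun k =>
          let q := s k in
          if q == ord0 then A x a
          else if q == 1%R :> 'I_3 then A (upd x i u) b
          else A (upd x i w) c).

End Game.

(* Main.v *)
Require Import Defs.
From HB Require Import structures.
From mathcomp Require Import all_boot all_order all_fingroup all_algebra.
From mathcomp Require Import ring lra.
From Stdlib Require Import Classical_Prop.
Set Implicit Arguments. Unset Strict Implicit. Unset Printing Implicit Defensive.
Import Order.TTheory GRing.Theory Num.Theory.
Local Open Scope ring_scope.

(** Write [A_g = E_x A_x^(g x)].  Freeze the coordinates from the k-th on, let
    [g] range over the functions multilinear in the first k, and choose a POVM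
    [T] that nearly maximises [Tr (sum_g T_g A_g)].  First-order optimality
    makes [Z = (1/2) sum_g (T_g A_g + A_g T_g)] dominate every [A_g].  The
    linearity test and a walk from [x] to [y] along the axes show that, next to
    any measurement of [g] by another player, [A_g] is nearly idempotent; since
    consistency moves each [A_x^a] from one player to another, it follows that
    [H_g = E_x A_x^(g x) T_g A_x^(g x)] is consistent with [A] and with itself,
    that [<H>] is close to [<Z>] and that [<(1 - Z) (x) Z>] is close to 0, all
    with errors that do not depend on k.

    What has to be propagated from k to k + 1 is the completeness [<Z>].  If
    [u, w] are two values of the k-th coordinate, interpolating the outcomes of
    [H_u^g H_w^h H_u^g] gives a function consistent with [A] by the linearity
    test, so [1 - Z] at level k + 1 is nearly orthogonal to [G^2], where
    [G = E_u H_u].  As [1 <= (1 + 1/2n) (1 - G) + O(n) G^2], the loss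
    [1 - <Z>] grows only by a factor [1 + 1/2n] and an additive error, which
    is affordable over n levels. *)

(** All three tensor factors are in use at once: one carries [T g], [H g] or [1 - Z], and the other
    two carry the measurements that are compared. Operators of different players commute, and a
    product inside one factor, such as A T A or H H H, is only ever reached by moving an operator
    there from another player. AM-GM with weight [del] makes such a move cost about
    [eps / del + 2 * del], whence [del = sqrt eps].

    The optimal [T] is chosen afresh at every level and not inherited. Its optimality and the two
    tests alone give consistency and self-consistency, so a single number, the completeness,
    remembers the earlier levels.

    Optimality is also what links two consecutive levels: every function q obtained by interpolation
    satisfies A_q <= Z + eta, with the Z of the upper level. Hence the interpolated sandwiches need
    not form a good measurement; they only witness that this Z is large. *)

(** * The real subfield *)

(** [K] is abstract, so its real elements only form an ordered field, possibly
    without suprema. *)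
Record realpart (K : numClosedFieldType) := RealPart { rval :> K; _ : rval \is Num.real }.

Section RealPart.
Variable K : numClosedFieldType.
Local Notation R := (realpart K).
HB.instance Definition _ := [isSub for @rval K].
HB.instance Definition _ := [Choice of R by <:].
HB.instance Definition _ := [SubChoice_isSubIntegralDomain of R by <:].
HB.instance Definition _ := [SubIntegralDomain_isSubField of R by <:].

Lemma rval_real (x : R) : (rval x) \is Num.real. Proof. by case: x. Qed.

Definition rp_le (x y : R) := rval x <= rval y.
Definition rp_lt (x y : R) := rval x < rval y.
Definition rp_norm (x : R) : R := RealPart (normr_real (rval x)).

Lemma rp_le0D x y : rp_le 0 x -> rp_le 0 y -> rp_le 0 (x + y).
Proof. exact: addr_ge0. Qed.
Lemma rp_le0M x y : rp_le 0 x -> rp_le 0 y -> rp_le 0 (x * y).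
Proof. exact: mulr_ge0. Qed.
Lemma rp_le0_anti x : rp_le 0 x -> rp_le x 0 -> x = 0.
Proof. by move=> h1 h2; apply/val_inj/le_anti/andP; split. Qed.
Lemma rp_sub_ge0 x y : rp_le 0 (y - x) = rp_le x y.
Proof. exact: (subr_ge0 (rval x) (rval y)). Qed.
Lemma rp_le0_total x : rp_le 0 x || rp_le x 0.
Proof. by have := rval_real x; rewrite realE. Qed.
Lemma rp_normN x : rp_norm (- x) = rp_norm x.
Proof. by apply/val_inj; exact: (normrN (rval x)). Qed.
Lemma rp_ge0_norm x : rp_le 0 x -> rp_norm x = x.
Proof. by move=> h; apply/val_inj/ger0_norm. Qed.
Lemma rp_lt_def x y : rp_lt x y = (y != x) && rp_le x y.
Proof. exact: (lt_def (rval x) (rval y)). Qed.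

HB.instance Definition _ := Num.IntegralDomain_isLeReal.Build R
  rp_le0D rp_le0M rp_le0_anti rp_sub_ge0 rp_le0_total rp_normN rp_ge0_norm rp_lt_def.

Definition re (z : K) : R := RealPart (Creal_Re z).

Fact re_is_zmod_morphism : zmod_morphism re.
Proof. by move=> x y; apply/val_inj; exact: raddfB. Qed.
HB.instance Definition _ := GRing.isZmodMorphism.Build K R re re_is_zmod_morphism.

Lemma re_rval (r : R) : re (rval r) = r.
Proof. by apply/val_inj/Creal_ReP/rval_real. Qed.
Lemma re_scale (r : R) z : re (rval r * z) = r * re z.
Proof. by apply/val_inj; rewrite /= ReMl ?rval_real. Qed.
Lemma re_conj z : re (Num.conj z) = re z.
Proof. by apply/val_inj; rewrite /= Re_conj. Qed.
Lemma re_ge0 z : 0 <= z -> 0 <= re z.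
Proof.
by move=> z0; rewrite -[_ <= _]/(0 <= 'Re z); move/ger0_real/Creal_ReP: (z0) ->.
Qed.
Lemma rval_re z : z \is Num.real -> rval (re z) = z.
Proof. by move/Creal_ReP. Qed.
Lemma re_nat n : re n%:R = n%:R.
Proof. by rewrite raddfMn; congr (_ *+ _); apply: (re_rval 1). Qed.
Lemma rval_nat n : rval (n%:R : R) = n%:R.
Proof. by rewrite -re_nat rval_re // realn. Qed.
Lemma rval_le (x y : R) : (rval x <= rval y) = (x <= y). Proof. by []. Qed.
Lemma rval_lt (x y : R) : (rval x < rval y) = (x < y). Proof. by []. Qed.
Lemma rval_inv (x : R) : rval x^-1 = (rval x)^-1.
Proof.
have [->|x0] := eqVneq x 0; first by rewrite !invr0.
have rx0 : rval x != 0 by rewrite (inj_eq val_inj x 0).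
by apply: (mulfI rx0); rewrite mulfV // -[LHS]/(rval (x * x^-1)) mulfV.
Qed.
End RealPart.

(** * Positive semidefinite matrices *)

Section Adjoint.
Variable K : numClosedFieldType.

Lemma adjmxK m n (M : 'M[K]_(m, n)) : adjmx (adjmx M) = M.
Proof. by apply/matrixP=> i j; rewrite !mxE conjCK. Qed.

Fact adjmx_is_zmod_morphism m n : zmod_morphism (@adjmx K m n).
Proof. by move=> M N; apply/matrixP=> i j; rewrite !mxE rmorphB. Qed.
HB.instance Definition _ m n :=
  GRing.isZmodMorphism.Build _ _ (@adjmx K m n) (@adjmx_is_zmod_morphism m n).

Lemma adjmxM m n p (M : 'M[K]_(m, n)) (N : 'M_(n, p)) :
  adjmx (M *m N) = adjmx N *m adjmx M.
Proof. by rewrite /adjmx trmx_mul map_mxM. Qed.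

Lemma adjmxZ m n c (M : 'M[K]_(m, n)) : adjmx (c *: M) = Num.conj c *: adjmx M.
Proof. by apply/matrixP=> i j; rewrite !mxE rmorphM. Qed.

Lemma adjmx1 n : adjmx (1%:M : 'M[K]_n) = 1%:M.
Proof. by rewrite /adjmx trmx1 map_mx1. Qed.

Variable d : nat.
Implicit Types (M N S C : 'M[K]_d).

Lemma adjmx_norm_ge0 n (v : 'cV[K]_n) : 0 <= (adjmx v *m v) 0 0.
Proof. by rewrite mxE sumr_ge0 // => i _; rewrite !mxE mulrC mul_conjC_ge0. Qed.

Lemma psd_adj M : psdmx (M : 'M[K]_d) -> adjmx M = M. Proof. by case. Qed.

Lemma psd_gram M : psdmx (adjmx M *m M).
Proof.
split=> [|v]; first by rewrite adjmxM adjmxK.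
by rewrite mulmxA -adjmxM -mulmxA adjmx_norm_ge0.
Qed.

Lemma psd0 : psdmx (0 : 'M[K]_d).
Proof. by have := psd_gram 0; rewrite mulmx0. Qed.

Lemma psd1 : psdmx (1%:M : 'M[K]_d).
Proof. by have := psd_gram 1%:M; rewrite adjmx1 mul1mx. Qed.

Lemma psdD M N : psdmx M -> psdmx N -> psdmx (M + N).
Proof.
move=> [hM pM] [hN pN]; split=> [|v]; first by rewrite raddfD /= hM hN.
by rewrite mulmxDr mulmxDl mxE addr_ge0.
Qed.

Lemma psd_sum (I : finType) (P : pred I) (M : I -> 'M[K]_d) :
  (forall i, P i -> psdmx (M i)) -> psdmx (\sum_(i | P i) M i).
Proof. by move=> h; elim/big_ind: _ => //; [exact: psd0|exact: psdD]. Qed.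

Lemma psdZ c M : 0 <= c -> psdmx M -> psdmx (c *: M).
Proof.
move=> c0 [hM pM]; split=> [|v]; first by rewrite adjmxZ hM conj_Creal ?ger0_real.
by rewrite -scalemxAr -scalemxAl mxE mulr_ge0.
Qed.

Lemma psd_conj C M : psdmx M -> psdmx (adjmx C *m M *m C).
Proof.
move=> [hM pM]; split=> [|v]; first by rewrite !adjmxM adjmxK hM mulmxA.
by have := pM (C *m v); rewrite adjmxM !mulmxA.
Qed.

Lemma psd_sqrt M : psdmx M -> exists2 S : 'M[K]_d, psdmx S & S *m S = M.
Proof.
move=> [hM pM]; have nM : M \is normalmx.
  by apply/normalmxP; rewrite -/(adjmx M) hM.
pose P := spectralmx M; have uP : P *m adjmx P = 1%:M.
  by apply/unitarymxP/spectral_unitarymx.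
have uP' : adjmx P *m P = 1%:M by apply: mulmx1C.
pose D := spectral_diag M.
have eM : M = adjmx P *m diag_mx D *m P.
  move/orthomx_spectralP: nM => {1}->; rewrite invmx_unitary //.
  exact: spectral_unitarymx.
have D0 i : 0 <= D 0 i.
  pose v : 'cV[K]_d := adjmx P *m delta_mx i 0.
  have := pM v; rewrite eM /v adjmxM adjmxK !mulmxA.
  rewrite -(mulmxA (adjmx _)) uP mulmx1 -!mulmxA (mulmxA P) uP mul1mx.
  have -> : adjmx (delta_mx i 0 : 'cV[K]_d) = delta_mx 0 i.
    by apply/matrixP=> a b; rewrite !mxE rmorph_nat andbC.
  by rewrite -rowE -colE !mxE eqxx mulr1n.
pose E := \row_i sqrtC (D 0 i).
have hE : adjmx (diag_mx E) = diag_mx E.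
  apply/matrixP=> i j; rewrite !mxE eq_sym.
  have [->|_] := eqVneq i j; last by rewrite !mulr0n rmorph0.
  by rewrite !mulr1n conj_Creal // ger0_real // sqrtC_ge0.
have pE : psdmx (diag_mx E).
  pose G := diag_mx (\row_i sqrtC (E 0 i)).
  suff <- : adjmx G *m G = diag_mx E by apply: psd_gram.
  have -> : adjmx G = G.
    apply/matrixP=> i j; rewrite !mxE eq_sym.
    have [->|_] := eqVneq i j; last by rewrite !mulr0n rmorph0.
    by rewrite !mulr1n conj_Creal // ger0_real // !sqrtC_ge0.
  rewrite mulmx_diag; congr diag_mx; apply/rowP=> i.
  by rewrite !mxE -expr2 sqrtCK.
exists (adjmx P *m diag_mx E *m P); first exact: psd_conj.
rewrite -!mulmxA (mulmxA P) uP mul1mx (mulmxA (diag_mx _)) mulmx_diag.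
rewrite eM !mulmxA; congr (_ *m _ *m _); congr diag_mx; apply/rowP=> i.
by rewrite !mxE -expr2 sqrtCK.
Qed.

Definition contr M := psdmx M /\ psdmx (1%:M - M).

Lemma psd_le_trans N M S : psdmx (N - M) -> psdmx (S - N) -> psdmx (S - M).
Proof. by move=> h1 h2; rewrite -(subrKA N) addrC; apply: psdD. Qed.

Lemma contr_sq M : contr M -> psdmx (M - M *m M).
Proof.
move=> [pM p1M]; have [S pS eS] := psd_sqrt pM.
have -> : M - M *m M = adjmx S *m (1%:M - M) *m S.
  by rewrite (psd_adj pS) mulmxBr mulmxBl mulmx1 -eS !mulmxA.
exact: psd_conj.
Qed.

Lemma proj_psd M : M *m M = M -> adjmx M = M -> psdmx M.
Proof. by move=> h1 h2; have := psd_gram M; rewrite h2 h1. Qed.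

Lemma proj_contr M : M *m M = M -> adjmx M = M -> contr M.
Proof.
move=> h1 h2; split; first exact: proj_psd.
apply: proj_psd; first by rewrite mulmxBl !mulmxBr h1 !mul1mx mulmx1 subrr subr0.
by rewrite raddfB /= adjmx1 h2.
Qed.

Lemma contrC M : contr M -> contr (1%:M - M).
Proof. by case=> h1 h2; split=> //; rewrite opprB addrCA subrr addr0. Qed.

Lemma contr_le M N : psdmx M -> psdmx (N - M) -> contr N -> contr M.
Proof. by move=> pM h [pN p1]; split=> //; apply: psd_le_trans h p1. Qed.

Lemma sub_contr (I : finType) (T : I -> 'M[K]_d) (i : I) :
  (forall j, psdmx (T j)) -> contr (\sum_j T j) -> contr (T i).
Proof.
move=> pT; apply: contr_le => //; rewrite (bigD1 i) //= addrAC subrr add0r.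
exact: psd_sum.
Qed.
End Adjoint.

(** * Operators on three tensor factors *)

Section Space.
Variables (K : numClosedFieldType) (d : nat).
Local Notation R := (realpart K).
Local Notation Om := {ffun 'I_3 -> 'I_d}.
Definition vec := {ffun Om -> K^o}.
Implicit Types (v w : vec) (M N T Y C : 'M[K]_d) (t : Om).

Definition upd3 t k j : Om := [ffun l => if l == k then j else t l].
Definition cip v w : K := \sum_t Num.conj (v t) * w t.
(** The real part makes the form symmetric with values in an ordered field, where [lra] applies. For
    squared norms nothing is lost. *)
Definition ip v w : R := re (cip v w).
Definition app k M v : vec := [ffun t : Om => \sum_j M (t k) j * v (upd3 t k j)].

Fact ip_is_zmod_morphism v : zmod_morphism (ip v).
Proof.
move=> w w'; rewrite /ip /cip -raddfB -sumrB; congr re; apply: eq_bigr => t _.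
by rewrite !ffunE mulrBr.
Qed.
HB.instance Definition _ v := GRing.isZmodMorphism.Build vec R (ip v) (ip_is_zmod_morphism v).

Fact app_is_zmod_morphism k M : zmod_morphism (app k M).
Proof.
move=> w w'; apply/ffunP => t; rewrite !ffunE -sumrB; apply: eq_bigr => j _.
by rewrite !ffunE mulrBr.
Qed.
HB.instance Definition _ k M :=
  GRing.isZmodMorphism.Build vec vec (app k M) (app_is_zmod_morphism k M).

(** Exists so that additivity of the action in the operator can be registered as an instance. *)
Definition appl k v M := app k M v.
Fact appl_is_zmod_morphism k v : zmod_morphism (appl k v).
Proof.
move=> M N; apply/ffunP => t; rewrite !ffunE -sumrB; apply: eq_bigr => j _.
by rewrite !mxE mulrBl.
Qed.
HB.instance Definition _ k v :=
  GRing.isZmodMorphism.Build 'M[K]_d vec (appl k v) (appl_is_zmod_morphism k v).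

Lemma ipC v w : ip v w = ip w v.
Proof.
rewrite /ip /cip -re_conj rmorph_sum; congr re; apply: eq_bigr => t _.
by rewrite rmorphM /= conjCK mulrC.
Qed.

Lemma ip_ge0 v : 0 <= ip v v.
Proof. by apply/re_ge0/sumr_ge0 => t _; rewrite mulrC mul_conjC_ge0. Qed.

Lemma ipZ (r : R) v w : ip v (rval r *: w) = r * ip v w.
Proof.
rewrite /ip /cip -re_scale mulr_sumr; congr re; apply: eq_bigr => t _.
by rewrite !ffunE mulrCA.
Qed.

Lemma appZ k M (c : K) v : app k (c *: M) v = c *: app k M v.
Proof.
apply/ffunP => t; rewrite !ffunE scaler_sumr; apply: eq_bigr => j _.
by rewrite !mxE -mulrA.
Qed.

Lemma appZr k M (c : K) v : app k M (c *: v) = c *: app k M v.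
Proof.
apply/ffunP => t; rewrite !ffunE scaler_sumr; apply: eq_bigr => j _.
by rewrite !ffunE; apply: mulrCA.
Qed.

Lemma upd3_upd3 t k i j : upd3 (upd3 t k i) k j = upd3 t k j.
Proof. by apply/ffunP => l; rewrite !ffunE; case: eqP. Qed.

Lemma upd3_id t k : upd3 t k (t k) = t.
Proof. by apply/ffunP => l; rewrite !ffunE; case: eqP => [->|]. Qed.

Lemma upd3C t k l i j : k != l -> upd3 (upd3 t k i) l j = upd3 (upd3 t l j) k i.
Proof.
move=> kl; apply/ffunP => m; rewrite !ffunE; case: eqP => [->|//].
by rewrite eq_sym (negPf kl).
Qed.

Lemma app_mul k M N v : app k (M *m N) v = app k M (app k N v).
Proof.
apply/ffunP => t; rewrite !ffunE.
under eq_bigr => j _ do rewrite mxE mulr_suml.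
rewrite exchange_big /=; apply: eq_bigr => i _; rewrite ffunE mulr_sumr.
by apply: eq_bigr => j _; rewrite ffunE eqxx upd3_upd3 mulrA.
Qed.

Lemma app1 k v : app k 1%:M v = v.
Proof.
apply/ffunP => t; rewrite !ffunE (bigD1 (t k)) //= big1 ?mxE ?eqxx ?upd3_id.
  by rewrite mul1r addr0.
by move=> j /negPf jt; rewrite mxE eq_sym jt mul0r.
Qed.

Lemma appC k l M N v : k != l -> app k M (app l N v) = app l N (app k M v).
Proof.
move=> kl; apply/ffunP => t; rewrite !ffunE.
under eq_bigr => j _ do rewrite ffunE mulr_sumr.
under [RHS]eq_bigr => j _ do rewrite ffunE mulr_sumr.
rewrite exchange_big; apply: eq_bigr => i _; apply: eq_bigr => j _.
by rewrite !ffunE (negPf kl) eq_sym (negPf kl) upd3C // mulrCA.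
Qed.

Lemma app_cadj k M v w : cip (app k M v) w = cip v (app k (adjmx M) w).
Proof.
rewrite /cip.
under eq_bigr => t _ do rewrite ffunE rmorph_sum mulr_suml.
under [RHS]eq_bigr => t _ do rewrite ffunE mulr_sumr.
rewrite !pair_big /=.
(* Exchanging [q.1 k] with [q.2] is an involution on pairs; it swaps the row and the column index of
   [M], which produces the adjoint. *)
rewrite (reindex_onto (fun q : Om * 'I_d => (upd3 q.1 k q.2, q.1 k))
                      (fun q : Om * 'I_d => (upd3 q.1 k q.2, q.1 k))) /=; last first.
  by move=> [t j] _ /=; rewrite upd3_upd3 upd3_id ffunE eqxx.
apply: eq_big => [[t j]|[t j] _] /=; first by rewrite upd3_upd3 upd3_id ffunE !eqxx.
by rewrite upd3_upd3 upd3_id ffunE eqxx !mxE rmorphM /= -mulrA mulrCA.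
Qed.

Lemma app_adj k M v w : ip (app k M v) w = ip v (app k (adjmx M) w).
Proof. by rewrite /ip app_cadj. Qed.

Lemma cip_ge0 v : 0 <= cip v v.
Proof. by apply: sumr_ge0 => t _; rewrite mulrC mul_conjC_ge0. Qed.

Lemma appBl k M N v : app k (M - N) v = app k M v - app k N v.
Proof. exact: (raddfB (appl k v)). Qed.
Lemma app_suml (I : finType) (P : pred I) k (M : I -> 'M[K]_d) v :
  app k (\sum_(i | P i) M i) v = \sum_(i | P i) app k (M i) v.
Proof. exact: (raddf_sum (appl k v)). Qed.

Definition app3 T Y C v := app 0 T (app 1 Y (app 2%:R C v)).
(** For positive semidefinite [T], [Y], [C] this is a semi-inner product ([bf_ge0]). The later
    estimates are Cauchy-Schwarz arguments for it, the weights depending on the outcome that is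
    summed over. *)
Definition bf T Y C v w := ip v (app3 T Y C w).

Fact app3_is_zmod_morphism T Y C : zmod_morphism (app3 T Y C).
Proof. by move=> v w; rewrite /app3 !raddfB. Qed.
HB.instance Definition _ T Y C :=
  GRing.isZmodMorphism.Build vec vec (app3 T Y C) (app3_is_zmod_morphism T Y C).
Fact bf_is_zmod_morphism T Y C v : zmod_morphism (bf T Y C v).
Proof. by move=> w w'; rewrite /bf !raddfB. Qed.
HB.instance Definition _ T Y C v :=
  GRing.isZmodMorphism.Build vec R (bf T Y C v) (bf_is_zmod_morphism T Y C v).

Lemma app3M T Y C T' Y' C' v :
  app3 T Y C (app3 T' Y' C' v) = app3 (T *m T') (Y *m Y') (C *m C') v.
Proof.
rewrite /app3 !app_mul; congr (app 0 _ _).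
rewrite (appC (k := 2%:R) (l := 0)) // (appC (k := 1) (l := 0)) //.
by congr (app 0 _ _); rewrite (appC (k := 2%:R) (l := 1)).
Qed.

Lemma app3_adj T Y C v w :
  ip (app3 T Y C v) w = ip v (app3 (adjmx T) (adjmx Y) (adjmx C) w).
Proof.
rewrite /app3 !app_adj (appC (k := 2%:R) (l := 1)) //.
by rewrite (appC (k := 2%:R) (l := 0)) // (appC (k := 1) (l := 0)).
Qed.

Lemma bf_app3 T Y C a b c a' b' c' v w :
  bf T Y C (app3 a b c v) (app3 a' b' c' w) =
  bf (adjmx a *m T *m a') (adjmx b *m Y *m b') (adjmx c *m C *m c') v w.
Proof. by rewrite /bf app3_adj !app3M ?mulmxA. Qed.

Lemma app3_111 v : app3 1%:M 1%:M 1%:M v = v.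
Proof. by rewrite /app3 !app1. Qed.

Lemma bf_ge0 T Y C v : psdmx T -> psdmx Y -> psdmx C -> 0 <= bf T Y C v v.
Proof.
move=> /psd_sqrt[a pa <-] /psd_sqrt[b pb <-] /psd_sqrt[c pc <-].
have := ip_ge0 (app3 a b c v).
by rewrite app3_adj app3M (psd_adj pa) (psd_adj pb) (psd_adj pc).
Qed.

Lemma bfC T Y C v w : psdmx T -> psdmx Y -> psdmx C -> bf T Y C v w = bf T Y C w v.
Proof.
move=> /psd_adj a /psd_adj b /psd_adj c.
by rewrite /bf ipC app3_adj a b c.
Qed.

Lemma bfBTl T T' Y C v w : bf (T - T') Y C v w = bf T Y C v w - bf T' Y C v w.
Proof. by rewrite /bf /app3 appBl raddfB. Qed.
Lemma bfBYl T Y Y' C v w : bf T (Y - Y') C v w = bf T Y C v w - bf T Y' C v w.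
Proof. by rewrite /bf /app3 appBl !raddfB. Qed.
Lemma bfBCl T Y C C' v w : bf T Y (C - C') v w = bf T Y C v w - bf T Y C' v w.
Proof. by rewrite /bf /app3 appBl !raddfB. Qed.
Lemma bf_sumT (I : finType) (P : pred I) (T : I -> 'M[K]_d) Y C v w :
  bf (\sum_(i | P i) T i) Y C v w = \sum_(i | P i) bf (T i) Y C v w.
Proof. by rewrite /bf /app3 app_suml raddf_sum. Qed.
Lemma bf_sumY (I : finType) (P : pred I) T (Y : I -> 'M[K]_d) C v w :
  bf T (\sum_(i | P i) Y i) C v w = \sum_(i | P i) bf T (Y i) C v w.
Proof. by rewrite /bf /app3 app_suml !raddf_sum. Qed.
Lemma bf_sumC (I : finType) (P : pred I) T Y (C : I -> 'M[K]_d) v w :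
  bf T Y (\sum_(i | P i) C i) v w = \sum_(i | P i) bf T Y (C i) v w.
Proof. by rewrite /bf /app3 app_suml !raddf_sum. Qed.
Lemma bfZT (r : R) T Y C v w : bf (rval r *: T) Y C v w = r * bf T Y C v w.
Proof. by rewrite /bf /app3 appZ ipZ. Qed.
Lemma bfZY (r : R) T Y C v w : bf T (rval r *: Y) C v w = r * bf T Y C v w.
Proof. by rewrite /bf /app3 appZ appZr ipZ. Qed.
Lemma bfZC (r : R) T Y C v w : bf T Y (rval r *: C) v w = r * bf T Y C v w.
Proof. by rewrite /bf /app3 appZ !appZr ipZ. Qed.

Section Psd.
Variables T Y C : 'M[K]_d.
Hypotheses (pT : psdmx T) (pY : psdmx Y) (pC : psdmx C).
Local Notation B := (bf T Y C).

Lemma bf_quadB u w : B (u - w) (u - w) = B u u - 2 * B u w + B w w.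
Proof.
rewrite raddfB /= !(bfC (u - w)) // !raddfB /= (bfC w u) //; ring.
Qed.
Lemma bf_quadD u w : B (u + w) (u + w) = B u u + 2 * B u w + B w w.
Proof.
rewrite raddfD /= !(bfC (u + w)) // !raddfD /= (bfC w u) //; ring.
Qed.

Lemma bf_add_le u w : B (u + w) (u + w) <= 2 * B u u + 2 * B w w.
Proof.
have := bf_ge0 (u - w) pT pY pC; rewrite bf_quadB bf_quadD; lra.
Qed.
Lemma bf_le_sub u w : B u u <= 2 * B (u - w) (u - w) + 2 * B w w.
Proof. by have := bf_add_le (u - w) w; rewrite subrK. Qed.

Lemma bfZr (r : R) u w : B u (rval r *: w) = r * B u w.
Proof. by rewrite /bf /app3 !appZr ipZ. Qed.

Lemma bf_amgm (r : R) u w : 0 < r -> 2 * B u w <= r * B u u + r^-1 * B w w.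
Proof.
move=> r0; have := bf_ge0 (rval r *: u - w) pT pY pC.
rewrite bf_quadB bfZr (bfC (rval r *: u) w) // bfZr (bfC (rval r *: u) u) // bfZr (bfC w u) // => h.
rewrite -subr_ge0.
have -> : r * B u u + r^-1 * B w w - 2 * B u w =
  r^-1 * (r * (r * B u u) - 2 * (r * B u w) + B w w).
  by field; rewrite gt_eqF.
by rewrite mulr_ge0 // invr_ge0 ltW.
Qed.

(** The difference of the two squared norms is [B (u + w) (u - w)]. AM-GM with the free weight [r]
    replaces Cauchy-Schwarz, so that no square root appears. *)
Lemma bf_move (r : R) u w : 0 < r ->
  B u u <= B w w + (2 * r)^-1 * B (u - w) (u - w) + r * (B u u + B w w).
Proof.
move=> r0.
have := bf_amgm (u + w) (u - w) r0.
have -> : (2 * r)^-1 = 2^-1 * r^-1 by field; rewrite gt_eqF.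
have -> : B (u + w) (u - w) = B u u - B w w.
  by rewrite bfC // raddfD /= !(bfC (u - w)) // !raddfB /= (bfC w u) //; ring.
have -> : B (u + w) (u + w) = 2 * B u u + 2 * B w w - B (u - w) (u - w).
  by rewrite bf_quadB bf_quadD; ring.
have := mulr_ge0 (ltW r0) (bf_ge0 (u - w) pT pY pC).
lra.
Qed.
End Psd.
End Space.

(** * Expectations in the given state *)

Section Expectation.
Variables (K : numClosedFieldType) (d : nat).
Local Notation R := (realpart K).
Local Notation Om := {ffun 'I_3 -> 'I_d}.
Implicit Types (T Y C : 'M[K]_d) (t : Om).

Lemma prod3 (f : 'I_3 -> K) : \prod_k f k = f 0 * (f 1 * f 2%:R).
Proof.
rewrite !big_ord_recl big_ord0 mulr1.
by congr (f _ * (f _ * f _)); apply: val_inj.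
Qed.

Definition mk3 (j0 j1 j2 : 'I_d) : Om :=
  [ffun k : 'I_3 => if k == 0 then j0 else if k == 1 then j1 else j2].

Lemma mk3_eta t : mk3 (t 0) (t 1) (t 2%:R) = t.
Proof.
apply/ffunP => k; rewrite ffunE; case: eqP => [->//|k0]; case: eqP => [->//|k1].
congr (t _); apply/val_inj; case: k k0 k1 => [[|[|[|//]]] h] k0 k1 //=.
  by case: k0; apply: val_inj.
by case: k1; apply: val_inj.
Qed.

Lemma upd3_mk3 t j0 j1 j2 : upd3 (upd3 (upd3 t 0 j0) 1 j1) 2%:R j2 = mk3 j0 j1 j2.
Proof. by rewrite -[LHS]mk3_eta !ffunE. Qed.

Lemma app3E T Y C (v : vec K d) t :
  app3 T Y C v t =
  \sum_(t' : Om) T (t 0) (t' 0) * (Y (t 1) (t' 1) * C (t 2%:R) (t' 2%:R)) * v t'.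
Proof.
rewrite (reindex (fun q : 'I_d * ('I_d * 'I_d) => mk3 q.1 q.2.1 q.2.2)) /=; last first.
  exists (fun t => (t 0, (t 1, t 2%:R))) => [[a [b c]] _|t' _] /=; last exact: mk3_eta.
  by rewrite !ffunE.
rewrite -(pair_big predT predT (fun a bc => T (t 0) (mk3 a bc.1 bc.2 0) *
  (Y (t 1) (mk3 a bc.1 bc.2 1) * C (t 2%:R) (mk3 a bc.1 bc.2 2%:R)) *
  v (mk3 a bc.1 bc.2))) /=.
rewrite /app3 [LHS]ffunE; apply: eq_bigr => a _.
rewrite -(pair_big predT predT (fun b c => T (t 0) (mk3 a b c 0) *
  (Y (t 1) (mk3 a b c 1) * C (t 2%:R) (mk3 a b c 2%:R)) *
  v (mk3 a b c))) /=.
rewrite [X in _ * X = _]ffunE mulr_sumr; apply: eq_bigr => b _.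
rewrite [X in _ * (_ * X) = _]ffunE !mulr_sumr; apply: eq_bigr => c _.
by rewrite upd3_mk3 !ffunE /= -!mulrA.
Qed.

Variable Psi : state3 K d.
Definition psi : vec K d := Psi.
(** The expectation of T (x) Y (x) C in the state, one operator per player. *)
Definition tau T Y C : R := bf T Y C psi psi.

Lemma expect3E (O : 'I_3 -> 'M[K]_d) :
  re (expect3 Psi O) = tau (O 0) (O 1) (O 2%:R).
Proof.
rewrite /expect3 /tau /bf /ip /cip; congr re; apply: eq_bigr => t _.
rewrite app3E mulr_sumr; apply: eq_bigr => t' _.
by rewrite prod3 -!mulrA.
Qed.

Lemma tau_vv T Y C a b c a' b' c' :
  bf T Y C (app3 a b c psi) (app3 a' b' c' psi) =
  tau (adjmx a *m T *m a') (adjmx b *m Y *m b') (adjmx c *m C *m c').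
Proof. exact: bf_app3. Qed.

Lemma tau_ge0 T Y C : psdmx T -> psdmx Y -> psdmx C -> 0 <= tau T Y C.
Proof. exact: bf_ge0. Qed.

Lemma tauBT T T' Y C : tau (T - T') Y C = tau T Y C - tau T' Y C.
Proof. exact: bfBTl. Qed.
Lemma tauBY T Y Y' C : tau T (Y - Y') C = tau T Y C - tau T Y' C.
Proof. exact: bfBYl. Qed.
Lemma tauBC T Y C C' : tau T Y (C - C') = tau T Y C - tau T Y C'.
Proof. exact: bfBCl. Qed.
Lemma tauDT T T' Y C : tau (T + T') Y C = tau T Y C + tau T' Y C.
Proof. by rewrite -[in RHS](addrK T' T) tauBT; ring. Qed.
Lemma tauDC T Y C C' : tau T Y (C + C') = tau T Y C + tau T Y C'.
Proof. by rewrite -[in RHS](addrK C' C) tauBC; ring. Qed.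
Lemma tau_monoT T T' Y C : psdmx (T' - T) -> psdmx Y -> psdmx C ->
  tau T Y C <= tau T' Y C.
Proof. by move=> h pY pC; rewrite -subr_ge0 -tauBT tau_ge0. Qed.
Lemma tau_monoY T Y Y' C : psdmx (Y' - Y) -> psdmx T -> psdmx C ->
  tau T Y C <= tau T Y' C.
Proof. by move=> h pY pC; rewrite -subr_ge0 -tauBY tau_ge0. Qed.
Lemma tau_monoC T Y C C' : psdmx (C' - C) -> psdmx T -> psdmx Y ->
  tau T Y C <= tau T Y C'.
Proof. by move=> h pY pC; rewrite -subr_ge0 -tauBC tau_ge0. Qed.

Lemma tr_rho1 T : \tr (T *m rho1 Psi) = cip psi (app 0 T psi).
Proof.
rewrite /cip; under eq_bigr do rewrite [app _ _ _ _]ffunE mulr_sumr.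
rewrite /mxtrace (partition_big (fun t : Om => t 0) predT) //=.
apply: eq_bigr => i _; rewrite mxE exchange_big /=; apply: eq_bigr => j _.
rewrite mxE mulr_sumr.
under [LHS]eq_bigr => t _ do rewrite mulr_sumr.
rewrite (exchange_big_dep (fun t : Om => t 0 == i)) /=; last first.
  by move=> t t' _ /andP[].
(* The tuples in an entry of [rho1] agree outside factor 0, so [t'] and the index [j] leave a single
   [t]. *)
apply: eq_bigr => t' /eqP t'i; rewrite (big_pred1 (upd3 t' 0 j)) => [|t].
  by rewrite t'i [RHS]mulrCA; congr (_ * _); apply: mulrC.
rewrite t'i eqxx /=; apply/andP/eqP => [[/eqP tj /forallP h]|->].
  apply/ffunP => k; rewrite ffunE; case: eqP => [->//|/eqP k0].
  by have := h k; rewrite k0 => /eqP.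
split; first by rewrite ffunE.
by apply/forallP => k; apply/implyP => /negPf k0; rewrite ffunE k0.
Qed.
Lemma tr_sq_ge0 X : adjmx X = X -> 0 <= \tr (X *m X *m rho1 Psi).
Proof. by move=> hX; rewrite tr_rho1 app_mul -{1}hX -app_cadj cip_ge0. Qed.

Lemma re_tr_rho1 T : re (\tr (T *m rho1 Psi)) = tau T 1%:M 1%:M.
Proof. by rewrite tr_rho1 /tau /bf /app3 !app1. Qed.
End Expectation.

(** * Uniform averages and multilinear functions *)

Section Avg.
Variable R : realFieldType.

Definition avg (I : finType) (f : I -> R) : R := (#|I|%:R)^-1 * \sum_i f i.

Lemma eq_avg (I : finType) (f g : I -> R) : f =1 g -> avg f = avg g.
Proof. by move=> fg; congr (_ * _); apply: eq_bigr => i _. Qed.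

Lemma avg_le (I : finType) (f g : I -> R) : (forall i, f i <= g i) -> avg f <= avg g.
Proof. by move=> fg; rewrite ler_wpM2l ?invr_ge0 ?ler0n // ler_sum. Qed.

Lemma avgD (I : finType) (f g : I -> R) : avg (fun i => f i + g i) = avg f + avg g.
Proof. by rewrite /avg big_split mulrDr. Qed.

Lemma avgB (I : finType) (f g : I -> R) : avg (fun i => f i - g i) = avg f - avg g.
Proof. by rewrite /avg sumrB mulrBr. Qed.

Lemma avgZ (I : finType) c (f : I -> R) : avg (fun i => c * f i) = c * avg f.
Proof. by rewrite /avg -mulr_sumr mulrCA. Qed.

Lemma avg_sum (I J : finType) (P : pred J) (f : I -> J -> R) :
  avg (fun i => \sum_(j | P j) f i j) = \sum_(j | P j) avg (fun i => f i j).
Proof. by rewrite /avg exchange_big mulr_sumr. Qed.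

Lemma avg_const (I : finType) c : (0 < #|I|)%N -> avg (fun _ : I => c) = c.
Proof.
by move=> I0; rewrite /avg sumr_const -(mulr_natl c) mulKf // pnatr_eq0 -lt0n.
Qed.

Lemma avg_exchange (I J : finType) (f : I -> J -> R) :
  avg (fun i => avg (f i)) = avg (fun j => avg (f ^~ j)).
Proof. by rewrite /avg -!mulr_sumr exchange_big /= mulrCA. Qed.

Lemma avg_ge0 (I : finType) (f : I -> R) : (forall i, 0 <= f i) -> 0 <= avg f.
Proof. by move=> f0; rewrite mulr_ge0 ?invr_ge0 ?ler0n ?sumr_ge0. Qed.

Lemma avg_pair (I J : finType) (f : I -> J -> R) :
  avg (fun i => avg (f i)) = avg (fun q : I * J => f q.1 q.2).
Proof.
rewrite /avg -mulr_sumr mulrA pair_big -invfM -natrM -card_prod; congr (_ * _).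
Qed.

Lemma avg_bij (I : finType) (h : I -> I) (f : I -> R) : involutive h -> avg (f \o h) = avg f.
Proof. by move=> hK; rewrite /avg [in RHS](reindex_inj (inv_inj hK)). Qed.
End Avg.

Section Points.
Variables (F : finFieldType) (n : nat).
Local Notation pt := (point F n).
Implicit Types (x y s : pt) (i j : 'I_n) (t u w : F) (k : nat).

(** Serves two purposes: for fixed [k] it freezes the coordinates from the [k]-th on at those of
    [s]; for growing [k] it walks from [s] to [x], one axis at a time ([mix0], [mixS], [mixn]). *)
Definition mix k x s : pt := [ffun j : 'I_n => if (j < k)%N then x j else s j].

Lemma upd_same x i : upd x i (x i) = x.
Proof. by apply/ffunP => j; rewrite ffunE; case: eqP => [->|]. Qed.
Lemma updE x i t : upd x i t i = t.
Proof. by rewrite ffunE eqxx. Qed.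
Lemma upd_upd x i t u : upd (upd x i t) i u = upd x i u.
Proof. by apply/ffunP => j; rewrite !ffunE; case: eqP. Qed.
Lemma mix0 x s : mix 0 x s = s.
Proof. by apply/ffunP => j; rewrite ffunE. Qed.
Lemma mixn x s : mix n x s = x.
Proof. by apply/ffunP => j; rewrite ffunE ltn_ord. Qed.
Lemma mixS x s j : mix j.+1 x s = upd (mix j x s) j (x j).
Proof.
apply/ffunP => l; rewrite !ffunE ltnS -val_eqE leq_eqVlt /=.
by case: (eqVneq (l : nat) j) => //= e; congr (x _); apply: val_inj.
Qed.
Lemma mix_updl x s j t : mix j (upd x j t) s = mix j x s.
Proof.
apply/ffunP => l; rewrite !ffunE; case: ifP => // lj.
by case: eqP lj => // ->; rewrite ltnn.
Qed.
Lemma mix_updr k x s j t : (k <= j)%N -> mix k x (upd s j t) = upd (mix k x s) j t.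
Proof.
move=> kj; apply/ffunP => l; rewrite !ffunE; case: eqP => [->|//].
by rewrite ltnNge kj.
Qed.
Lemma mixS_upd x s j t : mix j x (upd s j t) = upd (mix j.+1 x s) j t.
Proof. by rewrite mix_updr // mixS upd_upd. Qed.
Lemma mix_updl' k x s j t : (j < k)%N -> mix k (upd x j t) s = upd (mix k x s) j t.
Proof.
by move=> jk; apply/ffunP => l; rewrite !ffunE; case: eqP => [->|//]; rewrite jk.
Qed.

Lemma card_pt_gt0 : (0 < #|{: pt}|)%N.
Proof. by apply/card_gt0P; exists [ffun=> 0]. Qed.
Lemma card_F_gt0 : (0 < #|F|)%N.
Proof. by apply/card_gt0P; exists 0. Qed.

Section AvgPoint.
Variable R : realFieldType.

(** Exchanging [x j] with [t] is an involution on pairs [(x, t)], hence preserves the uniform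
    distribution. [avg_mix] rests on the same exchange for the first [k] coordinates of two
    points. *)
Lemma avg_upd j (f : pt -> R) : avg (fun x => avg (fun t => f (upd x j t))) = avg f.
Proof.
rewrite avg_pair -[RHS](avg_const _ card_F_gt0) avg_exchange avg_pair.
rewrite -[RHS](avg_bij (h := fun q : pt * F => (upd q.1 j q.2, q.1 j))) //.
by move=> [x t]; rewrite /= upd_upd upd_same updE.
Qed.

Lemma avg_mix k (f : pt -> R) : avg (fun x => avg (fun s => f (mix k x s))) = avg f.
Proof.
rewrite avg_pair -[RHS](avg_const _ card_pt_gt0) avg_exchange avg_pair.
rewrite -[RHS](avg_bij (h := fun q : pt * pt => (mix k q.1 q.2, mix k q.2 q.1))) //.
by move=> [x s]; congr (_, _); apply/ffunP => l; rewrite !ffunE /=; case: (l < k)%N.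
Qed.

Lemma avg_nat_card (P : pred F) : avg (fun t => (P t)%:R : R) = #|P|%:R / #|F|%:R.
Proof.
by rewrite /avg mulrC -natr_sum; congr (_%:R / _); rewrite -sum1_card [RHS]big_mkcond.
Qed.
End AvgPoint.

Definition aff (l : F * F) t := l.1 * t + l.2.

Lemma aff_inj2 l l' t u : t != u -> aff l t = aff l' t -> aff l u = aff l' u -> l = l'.
Proof.
case: l l' => [a b] [a' b']; rewrite /aff /= => tu e1 e2.
have /eqP : (a - a') * (t - u) = 0.
  have -> : (a - a') * (t - u) = (a * t + b) - (a' * t + b') - ((a * u + b) - (a' * u + b')).
    by ring.
  by rewrite e1 e2 !subrr.
rewrite mulf_eq0 !subr_eq0 (negPf tu) orbF => /eqP aa.
by move: e1; rewrite aa => /addrI ->.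
Qed.

Lemma aff_agree_card l l' : l != l' -> (#|[pred t | aff l t == aff l' t]| <= 1)%N.
Proof.
move=> ll; apply/card_le1_eqP => t u; rewrite !inE => /eqP e1 /eqP e2.
by apply: contraNeq ll => tu; apply/eqP/(aff_inj2 tu).
Qed.

Definition through t u a b : F * F := ((b - a) / (u - t), a - (b - a) / (u - t) * t).
Lemma throughE t u a b : t != u ->
  aff (through t u a b) t = a /\ aff (through t u a b) u = b.
Proof.
move=> tu; rewrite /aff /=; split; first by ring.
by field; rewrite subr_eq0 eq_sym.
Qed.

(** The values at two distinct points are coordinates on the affine functions. This turns a sum over
    lines into a sum over two independent answers, each of which can be summed to the identity. *)
Lemma sum_aff_pair (V : nmodType) t u (f : F -> F -> V) : t != u ->
  \sum_l f (aff l t) (aff l u) = \sum_a \sum_b f a b.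
Proof.
move=> tu; rewrite pair_big /=.
rewrite (reindex (fun q : F * F => through t u q.1 q.2)) /=.
  by apply: eq_bigr => -[a b] _ /=; have [-> ->] := throughE a b tu.
exists (fun l => (aff l t, aff l u)) => [[a b] _|l _] /=.
  by have [-> ->] := throughE a b tu.
by have [? ?] := throughE (aff l t) (aff l u) tu; apply: (aff_inj2 tu).
Qed.

Lemma lin_acceptE (x u w a b c : F) : x != u -> w != x -> u != w ->
  lin_accept x u w a b c = (c == aff (through x u a b) w).
Proof.
move=> xu wx uw; rewrite /lin_accept /through /aff /=.
have ux0 : u - x != 0 by rewrite subr_eq0 eq_sym.
have wu0 : w - u != 0 by rewrite subr_eq0 eq_sym.
have wx0 : w - x != 0 by rewrite subr_eq0.
apply/andP/eqP => [[/eqP e1 /eqP e2]|->].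
  by rewrite -[LHS](subrK a) -[c - a](divfK wx0) -e2 -e1; ring.
by split; apply/eqP; field; rewrite ?ux0 ?wu0 ?wx0.
Qed.

(** The accepted triples are those whose third answer lies on the line through the first two, so
    acceptance is a sum over lines. *)
Lemma sum_accept (V : nmodType) (x u w : F) (f : F -> F -> F -> V) :
  x != u -> w != x -> u != w ->
  \sum_a \sum_b \sum_(c | lin_accept x u w a b c) f a b c =
  \sum_l f (aff l x) (aff l u) (aff l w).
Proof.
move=> xu wx uw.
rewrite (eq_bigr (fun l => (fun a b => f a b (aff (through x u a b) w)) (aff l x) (aff l u))); last first.
  move=> l _; congr (f _ _ (aff _ w)).
  by have [? ?] := throughE (aff l x) (aff l u) xu; apply/esym/(aff_inj2 xu).
rewrite (sum_aff_pair (fun a b => f a b (aff (through x u a b) w)) xu).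
apply: eq_bigr => a _; apply: eq_bigr => b _.
by apply: big_pred1 => c; rewrite lin_acceptE.
Qed.

(** The functions of level [k] keep all [n] arguments and are constant in those from the [k]-th on,
    so all levels share one type of points. *)
Definition mlk k (g : {ffun pt -> F}) : bool :=
  multilinear g && [forall i : 'I_n, (k <= i)%N ==> [forall x : pt, forall t : F, g (upd x i t) == g x]].

Lemma mlk_aff k g i x : mlk k g -> exists l, forall t, g (upd x i t) = aff l t.
Proof.
case/andP => /forallP /(_ i) /forallP /(_ x) /existsP[a /existsP[b /forallP h]] _.
by exists (a, b) => t; apply/eqP/h.
Qed.

Lemma mlk_const k g i x t : mlk k g -> (k <= i)%N -> g (upd x i t) = g x.
Proof.
by case/andP => _ /forallP /(_ i) /implyP h /h /forallP /(_ x) /forallP /(_ t) /eqP.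
Qed.

Lemma mlk_mix k g x s : mlk k g -> g (mix k x s) = g x.
Proof.
move=> mg.
have gen m : (k + m <= n)%N -> g (mix (k + m) x s) = g (mix k x s).
  elim: m => [|m IHm]; first by rewrite addn0.
  rewrite addnS => lt; rewrite -IHm ?(ltnW lt) //.
  by rewrite -[(k + m)%N]/(val (Ordinal lt)) mixS (mlk_const _ _ mg) //= leq_addr.
have [kn|nk] := leqP k n; first by rewrite -(gen (n - k)%N) subnKC // mixn.
congr (g _); apply/ffunP => j; rewrite ffunE.
by rewrite (ltn_trans (ltn_ord j)).
Qed.

Lemma mlk_n g : mlk n g = multilinear g.
Proof.
by rewrite /mlk andb_idr // => _; apply/forallP => i; rewrite leqNgt ltn_ord.
Qed.

Lemma mlk_intro k (g : {ffun pt -> F}) :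
  (forall i x, exists l, forall t, g (upd x i t) = aff l t) ->
  (forall i x t, (k <= i)%N -> g (upd x i t) = g x) -> mlk k g.
Proof.
move=> h1 h2; apply/andP; split.
  apply/forallP => i; apply/forallP => x; have [[a b] h] := h1 i x.
  by apply/existsP; exists a; apply/existsP; exists b; apply/forallP => t; apply/eqP/h.
apply/forallP => i; apply/implyP => ki; apply/forallP => x; apply/forallP => t.
by rewrite h2.
Qed.

Lemma mlk_cst k a : mlk k [ffun=> a].
Proof.
by apply: mlk_intro => *; [exists (0, a) => t|]; rewrite !ffunE // /aff mul0r add0r.
Qed.

Definition interp (k : 'I_n) u w (g h : {ffun pt -> F}) : {ffun pt -> F} :=
  [ffun x => aff (through u w (g x) (h x)) (x k)].

Lemma mlk_interp (k : 'I_n) u w g h : u != w -> mlk k g -> mlk k h ->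
  mlk k.+1 (interp k u w g h).
Proof.
move=> uw mg mh; have wu0 : w - u != 0 by rewrite subr_eq0 eq_sym.
apply: mlk_intro => [i x|i x t ki]; last first.
  rewrite !ffunE (mlk_const _ _ mg) ?(mlk_const _ _ mh) ?(ltnW ki) //.
  by rewrite -val_eqE /= ltn_eqF.
have [->|ik] := eqVneq i k.
  exists (through u w (g x) (h x)) => t.
  by rewrite !ffunE eqxx (mlk_const _ _ mg) ?(mlk_const _ _ mh).
have [[a b] hg] := mlk_aff i x mg; have [[a' b'] hh] := mlk_aff i x mh.
exists (a + (a' - a) / (w - u) * (x k - u), b + (b' - b) / (w - u) * (x k - u)) => t.
rewrite !ffunE eq_sym (negPf ik) hg hh /aff /through /=; field.
by rewrite wu0.
Qed.

(** Start at a point [x0] where [g] and [h] differ and replace its first [k] coordinates by those of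
    [x] one by one. If they still differ before a replacement, then along that axis they are
    distinct affine functions and agree at no more than one value, so each coordinate adds at most
    [1 / #|F|]. *)
Lemma schwartz_zippel (R : realFieldType) k g h : mlk k g -> mlk k h -> g != h -> (k <= n)%N ->
  avg (fun x : pt => (g x == h x)%:R : R) <= k%:R / #|F|%:R.
Proof.
move=> mg mh gh kn.
have [x0 gh0] : exists x0, g x0 != h x0.
  by apply/existsP; apply: contraNT gh => /existsPn e; apply/eqP/ffunP => x;
    apply/eqP/negPn/e.
have F0 : (0 : R) < #|F|%:R by rewrite ltr0n card_F_gt0.
suff gen m : (m <= n)%N ->
    avg (fun x : pt => (g (mix m x x0) == h (mix m x x0))%:R : R) <= m%:R / #|F|%:R.
  apply: le_trans (gen k kn); apply: avg_le => x.
  by rewrite (mlk_mix _ _ mg) (mlk_mix _ _ mh).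
elim: m => [_|m IHm lt].
  rewrite mul0r -[leRHS](avg_const (I := pt) _ card_pt_gt0); apply: avg_le => x.
  by rewrite mix0 (negPf gh0).
pose j := Ordinal lt.
apply: le_trans (_ : avg (fun x : pt => (g (mix m x x0) == h (mix m x x0))%:R + #|F|%:R^-1) <= _).
  rewrite -(avg_upd j); apply: avg_le => x.
  rewrite (eq_avg (g := fun t => (g (upd (mix m x x0) j t) == h (upd (mix m x x0) j t))%:R)).
    2: by move=> t; rewrite -[m]/(val j) mixS mix_updl updE.
  set B := mix m x x0.
  have [e|ne] := boolP (g B == h B).
    apply: le_trans (_ : 1 <= _); last by rewrite lerDl invr_ge0 ltW.
    rewrite -[leRHS](avg_const (I := F) _ card_F_gt0); apply: avg_le => t.
    by rewrite lern1 leq_b1.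
  have [l hl] := mlk_aff j B mg; have [l' hl'] := mlk_aff j B mh.
  have ll : l != l'.
    by apply: contraNneq ne => ll; rewrite -(upd_same B j) hl hl' ll.
  rewrite (eq_avg (g := fun t => (aff l t == aff l' t)%:R)) => [|t]; last by rewrite hl hl'.
  rewrite avg_nat_card add0r -[leRHS]mul1r ler_pM2r ?invr_gt0 // lern1.
  exact: aff_agree_card.
rewrite avgD avg_const ?card_pt_gt0 // -natr1 mulrDl mul1r lerD2r.
exact/IHm/ltnW.
Qed.
End Points.

(** * The linearity test on one line *)

Section Symmetric.
Variables (K : numClosedFieldType) (d : nat) (Psi : state3 K d).
Local Notation R := (realpart K).
Local Notation tau := (tau Psi).
Local Notation psi := (psi Psi).
Hypotheses (hnorm : normalized Psi) (hsym : perm_symmetric Psi).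
Implicit Types (T Y C M : 'M[K]_d).

Lemma expect3_perm (s : 'S_3) (O : 'I_3 -> 'M[K]_d) :
  expect3 Psi (fun k => O (s k)) = expect3 Psi O.
Proof.
pose c (t : {ffun 'I_3 -> 'I_d}) : {ffun 'I_3 -> 'I_d} := [ffun k => t (s k)].
have cI : injective c.
  move=> t t' /ffunP e; apply/ffunP => k.
  by have := e (s^-1 k)%g; rewrite !ffunE permKV.
rewrite /expect3 (reindex_inj cI) /=; apply: eq_bigr => t _.
rewrite (reindex_inj cI) /=; apply: eq_bigr => t' _.
rewrite !hsym; congr (_ * _ * _).
rewrite [RHS](reindex_inj (@perm_inj _ s)); apply: eq_bigr => k _.
by rewrite !ffunE.
Qed.

Definition ops T Y C (k : 'I_3) := if k == 0 then T else if k == 1 then Y else C.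
Lemma tau_perm (s : 'S_3) T Y C :
  tau T Y C = tau (ops T Y C (s 0)) (ops T Y C (s 1)) (ops T Y C (s 2%:R)).
Proof.
have := expect3_perm s (ops T Y C).
by move/(congr1 (@re K)); rewrite !expect3E /= => <-.
Qed.
Lemma tau01 T Y C : tau T Y C = tau Y T C.
Proof. by rewrite (tau_perm (tperm 0 1)) tpermL tpermR tpermD. Qed.
Lemma tau12 T Y C : tau T Y C = tau T C Y.
Proof. by rewrite (tau_perm (tperm 1 2%:R)) tpermL tpermR tpermD. Qed.
Lemma tau02 T Y C : tau T Y C = tau C Y T.
Proof. by rewrite tau01 tau12 tau01. Qed.

Lemma tau111 : tau 1%:M 1%:M 1%:M = 1.
Proof.
rewrite /tau /bf app3_111 /ip /cip -[RHS](re_rval 1) -[rval 1]/(1 : K) -hnorm; congr re.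
by apply: eq_bigr => t _; rewrite normCKC.
Qed.

Lemma tau_le1 T Y C : contr T -> contr Y -> contr C -> tau T Y C <= 1.
Proof.
move=> [pT p1T] [pY p1Y] [pC p1C]; rewrite -tau111.
apply: le_trans (tau_monoT _ p1T pY pC) _.
apply: le_trans (tau_monoY _ p1Y (psd1 _ _) pC) _.
exact: tau_monoC p1C (psd1 _ _) (psd1 _ _).
Qed.

Lemma tau_sumT (I : finType) (P : pred I) (T : I -> 'M[K]_d) Y C :
  tau (\sum_(i | P i) T i) Y C = \sum_(i | P i) tau (T i) Y C.
Proof. exact: bf_sumT. Qed.
Lemma tau_sumY (I : finType) (P : pred I) T (Y : I -> 'M[K]_d) C :
  tau T (\sum_(i | P i) Y i) C = \sum_(i | P i) tau T (Y i) C.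
Proof. exact: bf_sumY. Qed.
Lemma tau_sumC (I : finType) (P : pred I) T Y (C : I -> 'M[K]_d) :
  tau T Y (\sum_(i | P i) C i) = \sum_(i | P i) tau T Y (C i).
Proof. exact: bf_sumC. Qed.

Section Line.
Variables (F : finFieldType) (B : F -> F -> 'M[K]_d).
Hypothesis projB : forall t, projmeas (B t).

Lemma projM t a : B t a *m B t a = B t a. Proof. by have [/(_ a)[]] := projB t. Qed.
Lemma projadj t a : adjmx (B t a) = B t a. Proof. by have [/(_ a)[]] := projB t. Qed.
Lemma projsum t : \sum_a B t a = 1%:M. Proof. by have [] := projB t. Qed.
Lemma proj_contrB t a : contr (B t a).
Proof. by apply: proj_contr; [apply: projM|apply: projadj]. Qed.
Lemma projpsd t a : psdmx (B t a). Proof. by case: (proj_contrB t a). Qed.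

(** The chance that two players disagree at [t]. Ignoring the third player can only lower the defect
    of the consistency test. *)
Definition cons_defect t : R := 1 - \sum_a tau (B t a) (B t a) 1%:M.
Definition lin_defect t1 t2 t3 : R :=
  1 - \sum_(l : F * F) tau (B t1 (aff l t1)) (B t2 (aff l t2)) (B t3 (aff l t3)).

Lemma cons_defect_ge0 t : 0 <= cons_defect t.
Proof.
rewrite subr_ge0 -tau111 -{2}(projsum t) tau_sumT; apply: ler_sum => a _.
by apply: tau_monoY; [case: (proj_contrB t a)|apply: projpsd|apply: psd1].
Qed.

Lemma lin_defect_ge0 t1 t2 t3 : t1 != t2 -> 0 <= lin_defect t1 t2 t3.
Proof.
move=> t12; rewrite subr_ge0.
apply: le_trans (_ : \sum_(l : F * F) tau (B t1 (aff l t1)) (B t2 (aff l t2)) 1%:M <= _).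
  apply: ler_sum => l _.
  by apply: tau_monoC; [case: (proj_contrB t3 (aff l t3))|apply: projpsd|apply: projpsd].
rewrite (sum_aff_pair (fun a b => tau (B t1 a) (B t2 b) 1%:M) t12).
under eq_bigr do rewrite -tau_sumY projsum.
by rewrite -tau_sumT projsum tau111.
Qed.

Let bfq (T : 'M[K]_d) v := bf T 1%:M 1%:M v v.

Section Distinct.
Variables t1 t2 t3 : F.
Hypotheses (t12 : t1 != t2) (t31 : t3 != t1) (t32 : t3 != t2).
Let b1 (l : F * F) := B t1 (aff l t1).
Let b2 (l : F * F) := B t2 (aff l t2).
Let b3 (l : F * F) := B t3 (aff l t3).
Let L l := app3 1%:M (b1 l) (b2 l) psi.
Let L' l := app3 1%:M (b3 l) (b2 l) psi.

(** On the way from [L] to [L'] the linearity test first inserts [B t3] at player 0 and then removes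
    [B t1] from player 1; finally consistency moves [B t3] from player 0 to player 1. The squared
    distances are one, one and two defects, weighted 2, 4 and 4 by the triangle inequality. *)
Lemma line_swap : \sum_l bfq 1%:M (L l - L' l) <= 6 * lin_defect t3 t1 t2 + 8 * cons_defect t3.
Proof.
pose M1 l := app3 (b3 l) (b1 l) (b2 l) psi.
pose M2 l := app3 (b3 l) 1%:M (b2 l) psi.
have e1 l : bfq 1%:M (L l - M1 l) = tau 1%:M (b1 l) (b2 l) - tau (b3 l) (b1 l) (b2 l).
  rewrite /bfq bf_quadB ?tau_vv; try exact: psd1.
  rewrite !(adjmx1, projadj, mul1mx, mulmx1, projM); ring.
have e2 l : bfq 1%:M (M1 l - M2 l) = tau (b3 l) 1%:M (b2 l) - tau (b3 l) (b1 l) (b2 l).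
  rewrite /bfq bf_quadB ?tau_vv; try exact: psd1.
  rewrite !(adjmx1, projadj, mul1mx, mulmx1, projM); ring.
have e3 l : bfq 1%:M (M2 l - L' l) =
    tau (b3 l) 1%:M (b2 l) - 2 * tau (b3 l) (b3 l) (b2 l) + tau 1%:M (b3 l) (b2 l).
  rewrite /bfq bf_quadB ?tau_vv; try exact: psd1.
  by rewrite !(adjmx1, projadj, mul1mx, mulmx1, projM).
have t23 : t2 != t3 by rewrite eq_sym.
have s1 : \sum_l bfq 1%:M (L l - M1 l) = lin_defect t3 t1 t2.
  under eq_bigr do rewrite e1.
  rewrite sumrB /lin_defect; congr (_ - _).
  rewrite (sum_aff_pair (fun a b => tau 1%:M (B t1 a) (B t2 b)) t12).
  under eq_bigr do rewrite -tau_sumC projsum.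
  by rewrite -tau_sumY projsum tau111.
have s2 : \sum_l bfq 1%:M (M1 l - M2 l) = lin_defect t3 t1 t2.
  under eq_bigr do rewrite e2.
  rewrite sumrB /lin_defect; congr (_ - _).
  rewrite (sum_aff_pair (fun a b => tau (B t3 a) 1%:M (B t2 b)) t32).
  under eq_bigr do rewrite -tau_sumC projsum.
  by rewrite -tau_sumT projsum tau111.
have s3 : \sum_l bfq 1%:M (M2 l - L' l) = 2 * cons_defect t3.
  under eq_bigr do rewrite e3.
  rewrite (sum_aff_pair (fun a b => tau (B t3 a) 1%:M (B t2 b) -
    2 * tau (B t3 a) (B t3 a) (B t2 b) + tau 1%:M (B t3 a) (B t2 b)) t32).
  under eq_bigr do rewrite big_split sumrB -mulr_sumr /= -!tau_sumC projsum.
  rewrite big_split sumrB /= -mulr_sumr -tau_sumT -tau_sumY projsum tau111 /cons_defect; ring.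
apply: le_trans (_ : \sum_l (2 * bfq 1%:M (L l - M1 l) + (4 * bfq 1%:M (M1 l - M2 l)
   + 4 * bfq 1%:M (M2 l - L' l))) <= _).
  apply: ler_sum => l _; have -> : L l - L' l = (L l - M1 l) + ((M1 l - M2 l) + (M2 l - L' l)).
    by rewrite !subrKA.
  have := bf_add_le (psd1 _ _) (psd1 _ _) (psd1 _ _) (L l - M1 l) ((M1 l - M2 l) + (M2 l - L' l)).
  have := bf_add_le (psd1 _ _) (psd1 _ _) (psd1 _ _) (M1 l - M2 l) (M2 l - L' l).
  rewrite /bfq; lra.
rewrite !big_split /= -!mulr_sumr s1 s2 s3; lra.
Qed.

Variables (G : finType) (T : G -> 'M[K]_d) (lg : G -> F * F).
Hypotheses (pT : forall g, psdmx (T g)) (p1T : psdmx (1%:M - \sum_g T g)).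

(** If the answer agrees with [lg g] at [t1] but not at [t2], the two answers span a line [l] other
    than [lg g] that meets it at [t1]. Trading [t1] for [t3] by [line_swap] leaves operators that no
    longer involve [t1]; it survives only in the incidence condition, which is rare for random
    [t1]. *)
Lemma line_pt :
  \sum_g tau (T g) (B t1 (aff (lg g) t1)) (1%:M - B t2 (aff (lg g) t2)) <=
  12 * lin_defect t3 t1 t2 + 16 * cons_defect t3 +
  2 * \sum_g \sum_(l | (l != lg g) && (aff l t1 == aff (lg g) t1))
    tau (T g) (B t3 (aff l t3)) (B t2 (aff l t2)).
Proof.
have stepA g : tau (T g) (B t1 (aff (lg g) t1)) (1%:M - B t2 (aff (lg g) t2)) =
   \sum_(l | (l != lg g) && (aff l t1 == aff (lg g) t1)) bfq (T g) (L l).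
  rewrite big_mkcond.
  transitivity (\sum_l (fun a b => if (a == aff (lg g) t1) && (b != aff (lg g) t2)
     then tau (T g) (B t1 a) (B t2 b) else 0) (aff l t1) (aff l t2)).
    rewrite (sum_aff_pair (fun a b => if (a == aff (lg g) t1) && (b != aff (lg g) t2)
     then tau (T g) (B t1 a) (B t2 b) else 0) t12).
    rewrite (bigD1 (aff (lg g) t1)) //= [X in _ = _ + X]big1 ?addr0 => [|a /negPf na]; last first.
      by apply: big1 => b _; rewrite na.
    rewrite eqxx /= -big_mkcond /= -tau_sumC; congr tau.
    by rewrite -(projsum t2) (bigD1 (aff (lg g) t2)) //= addrAC subrr add0r.
  apply: eq_bigr => l _.
  have -> : (l != lg g) && (aff l t1 == aff (lg g) t1) =
            (aff l t1 == aff (lg g) t1) && (aff l t2 != aff (lg g) t2).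
    rewrite andbC; case: eqP => //= e; congr negb; apply/eqP/eqP => [->//|e2].
    exact: (aff_inj2 t12).
  case: ifP => // _; rewrite /bfq tau_vv.
  by rewrite !(adjmx1, projadj, mul1mx, mulmx1, projM).
under eq_bigr do rewrite stepA.
apply: le_trans (_ : \sum_g (2 * \sum_l bfq (T g) (L l - L' l) +
  2 * \sum_(l | (l != lg g) && (aff l t1 == aff (lg g) t1)) bfq (T g) (L' l)) <= _).
  apply: ler_sum => g _.
  apply: le_trans (_ : \sum_(l | (l != lg g) && (aff l t1 == aff (lg g) t1))
     (2 * bfq (T g) (L l - L' l) + 2 * bfq (T g) (L' l)) <= _).
    by apply: ler_sum => l _; apply: bf_le_sub; try apply: psd1.
  rewrite big_split /= -!mulr_sumr lerD2r ler_pM2l ?ltr0n //.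
  rewrite [leRHS](bigID (fun l => (l != lg g) && (aff l t1 == aff (lg g) t1))) /= lerDl.
  by apply: sumr_ge0 => l _; apply: bf_ge0; try apply: psd1.
rewrite big_split /= -!mulr_sumr; apply: lerD.
  rewrite exchange_big /=.
  apply: le_trans (_ : 2 * \sum_l bfq 1%:M (L l - L' l) <= _); last by have := line_swap; lra.
  rewrite ler_pM2l ?ltr0n //; apply: ler_sum => l _.
  rewrite /bfq -bf_sumT -subr_ge0 -bfBTl.
  by apply: bf_ge0; try apply: psd1.
rewrite ler_pM2l ?ltr0n //; apply: ler_sum => g _; apply: ler_sum => l _.
by rewrite /bfq tau_vv !(adjmx1, projadj, mul1mx, mulmx1, projM).
Qed.
End Distinct.
End Line.
End Symmetric.

Section LineAvg.
Variables (K : numClosedFieldType) (d : nat) (Psi : state3 K d).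
Local Notation R := (realpart K).
Local Notation tau := (tau Psi).
Hypotheses (hnorm : normalized Psi) (hsym : perm_symmetric Psi).
Variables (F : finFieldType) (B : F -> F -> 'M[K]_d).
Hypothesis projB : forall t, projmeas (B t).
Local Notation cons_defect := (cons_defect Psi B).
Local Notation lin_defect := (lin_defect Psi B).

Definition dist3 (t1 t2 t3 : F) := [&& t1 != t2, t1 != t3 & t2 != t3].
(** Triples with a repetition contribute 0 here; [avg_not_dist3] accounts for them separately. *)
Definition line_defect : R := avg (fun q : F * F * F =>
  if dist3 q.1.1 q.1.2 q.2 then lin_defect q.1.1 q.1.2 q.2 else 0).

Variables (G : finType) (T : G -> 'M[K]_d) (lg : G -> F * F).
Hypotheses (pT : forall g, psdmx (T g)) (p1T : psdmx (1%:M - \sum_g T g)).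

Lemma avg_eqc (c : F) : avg (fun t => (c == t)%:R : R) = #|F|%:R^-1.
Proof.
rewrite avg_nat_card (eq_card (B := pred1 c)) ?card1 ?mul1r // => t.
by rewrite !inE eq_sym.
Qed.

Lemma avg_not_dist3 : avg (fun q : F * F * F => (~~ dist3 q.1.1 q.1.2 q.2)%:R : R)
  <= 3 / #|F|%:R.
Proof.
apply: le_trans (_ : avg (fun q : F * F * F => ((q.1.1 == q.1.2)%:R +
   (q.1.1 == q.2)%:R + (q.1.2 == q.2)%:R : R)) <= _).
  apply: avg_le => -[[a b] c] /=; rewrite /dist3.
  by case: eqP; case: eqP; case: eqP => //= _ _ _; rewrite ?mulr0n; lra.
rewrite !avgD.
rewrite -(avg_pair (fun (q : F * F) (c : F) => (q.1 == c)%:R)).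
rewrite -(avg_pair (fun (q : F * F) (c : F) => (q.2 == c)%:R)).
rewrite -(avg_pair (fun (q : F * F) (c : F) => (q.1 == q.2)%:R)).
rewrite (eq_avg (fun q : F * F => avg_const (q.1 == q.2)%:R (card_F_gt0 F))).
rewrite -(avg_pair (fun (a b : F) => (a == b)%:R)).
rewrite (eq_avg avg_eqc) (eq_avg (fun q : F * F => avg_eqc q.1)).
rewrite (eq_avg (fun q : F * F => avg_eqc q.2)).
rewrite !avg_const ?card_prod ?muln_gt0 ?card_F_gt0 //.
lra.
Qed.

(** Two distinct lines meet in at most one point, so averaging over [t1] bounds the remaining sum of
    [line_pt] by [1 / #|F|]. It enters twice, and the degenerate triples add [3 / #|F|]. *)
Lemma line_avg :
  avg (fun t1 => avg (fun t2 => \sum_g tau (T g) (B t1 (aff (lg g) t1))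
    (1%:M - B t2 (aff (lg g) t2)))) <= 12 * line_defect + 16 * avg cons_defect + 5 / #|F|%:R.
Proof.
pose e t1 t2 := \sum_g tau (T g) (B t1 (aff (lg g) t1)) (1%:M - B t2 (aff (lg g) t2)).
pose S t1 t2 t3 := \sum_g \sum_(l | (l != lg g) && (aff l t1 == aff (lg g) t1))
    tau (T g) (B t3 (aff l t3)) (B t2 (aff l t2)).
have F0 : (0 : R) < #|F|%:R by rewrite ltr0n card_F_gt0.
have pp := projpsd projB; have p1p t a := proj2 (proj_contrB projB t a).
have e1 t1 t2 : e t1 t2 <= 1.
  rewrite -(tau111 hnorm); apply: le_trans (_ : \sum_g tau (T g) 1%:M 1%:M <= _).
    apply: ler_sum => g _; apply: le_trans (_ : tau (T g) 1%:M (1%:M - B t2 (aff (lg g) t2)) <= _).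
      exact: tau_monoY.
    by apply: tau_monoC; [rewrite opprB addrCA subrr addr0| | apply: psd1].
  by rewrite -tau_sumT; apply: tau_monoT => //; apply: psd1.
have S0 t1 t2 t3 : 0 <= S t1 t2 t3.
  by do 2![apply: sumr_ge0 => ? _]; apply: tau_ge0.
have Savg t2 t3 : t3 != t2 -> avg (fun t1 => S t1 t2 t3) <= #|F|%:R^-1.
  move=> t32; rewrite -[leRHS]mulr1 /avg ler_pM2l ?invr_gt0 // exchange_big /=.
  apply: le_trans (_ : \sum_g \sum_l tau (T g) (B t3 (aff l t3)) (B t2 (aff l t2)) <= _).
    apply: ler_sum => g _.
    under eq_bigr do rewrite big_mkcond.
    rewrite exchange_big; apply: ler_sum => l _; rewrite -big_mkcond /=.
    have [->|ll] := eqVneq l (lg g); first by rewrite big1 ?tau_ge0.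
    rewrite sumr_const /= -mulr_natl; apply: ler_piMl; first by apply: tau_ge0.
    by rewrite lern1; apply: aff_agree_card.
  under eq_bigr => g _ do rewrite (sum_aff_pair (fun a b => tau (T g) (B t3 a) (B t2 b)) t32).
  under eq_bigr => g _ do under eq_bigr => a _ do rewrite -tau_sumC (projsum projB).
  under eq_bigr => g _ do rewrite -tau_sumY (projsum projB).
  rewrite -(tau111 hnorm) -tau_sumT; apply: tau_monoT => //; apply: psd1.
pose S' (t3 t1 t2 : F) := if t3 != t2 then S t1 t2 t3 else 0.
(* The components of [q] are the auxiliary point [t3], then [t1], then [t2]. On degenerate triples
   the trivial bound [e <= 1] is used. *)
have pt q : e q.1.2 q.2 <= 12 * (if dist3 q.1.1 q.1.2 q.2 then lin_defect q.1.1 q.1.2 q.2 else 0) +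
   16 * cons_defect q.1.1 + 2 * S' q.1.1 q.1.2 q.2 + (~~ dist3 q.1.1 q.1.2 q.2)%:R.
  case: q => [[t3 t1] t2] /=; have c0 := cons_defect_ge0 hnorm projB t3.
  have S'0 : 0 <= S' t3 t1 t2 by rewrite /S'; case: ifP.
  have [/and3P[n31 n32 n12]|_] := boolP (dist3 t3 t1 t2); last first.
    by have := e1 t1 t2; rewrite mulr1n; lra.
  rewrite /S' n32 mulr0n addr0.
  exact: (line_pt hnorm projB).
rewrite avg_pair; apply: le_trans (_ : avg (fun q : F * F * F => e q.1.2 q.2) <= _).
  rewrite -(avg_pair (fun (r : F * F) (t2 : F) => e r.2 t2)).
  rewrite -(avg_pair (fun (t3 t1 : F) => avg (e t1))) avg_const ?card_F_gt0 //.
  by rewrite avg_pair.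
apply: le_trans (avg_le pt) _.
rewrite 3!avgD 3!avgZ -/line_defect.
have -> : avg (fun q : F * F * F => cons_defect q.1.1) = avg cons_defect.
  rewrite -(avg_pair (fun (r : F * F) (t2 : F) => cons_defect r.1)).
  rewrite (eq_avg (fun r : F * F => avg_const (cons_defect r.1) (card_F_gt0 F))).
  rewrite -(avg_pair (fun (t3 t1 : F) => cons_defect t3)).
  by rewrite (eq_avg (fun t : F => avg_const (cons_defect t) (card_F_gt0 F))).
have S'avg : avg (fun q : F * F * F => S' q.1.1 q.1.2 q.2) <= #|F|%:R^-1.
  rewrite -(avg_pair (fun (r : F * F) (t2 : F) => S' r.1 r.2 t2)).
  rewrite -(avg_pair (fun (t3 t1 : F) => avg (S' t3 t1))).
  rewrite -[leRHS](avg_const (I := F) _ (card_F_gt0 F)); apply: avg_le => t3.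
  rewrite avg_exchange -[leRHS](avg_const (I := F) _ (card_F_gt0 F)); apply: avg_le => t2.
  rewrite /S'; case: eqP => /= [_|/eqP]; last exact: Savg.
  by rewrite avg_const ?card_F_gt0 // invr_ge0 ltW.
apply: le_trans (_ : 12 * line_defect + 16 * avg cons_defect + 2 * #|F|%:R^-1 + 3 / #|F|%:R <= _); last by lra.
apply: lerD; last exact: avg_not_dist3.
by rewrite lerD2l ler_pM2l ?ltr0n.
Qed.
End LineAvg.

(** * Paths along the coordinate axes *)

(** Cauchy-Schwarz for a sum of [k] vectors, by induction; the cross term with the next vector is
    split with AM-GM weight [1 / k]. *)
Lemma bf_sum_le (K : numClosedFieldType) d (T Y C : 'M[K]_d) k (x : nat -> vec K d) :
  psdmx T -> psdmx Y -> psdmx C ->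
  bf T Y C (\sum_(j < k) x j) (\sum_(j < k) x j) <= k%:R * \sum_(j < k) bf T Y C (x j) (x j).
Proof.
move=> pT pY pC; elim: k => [|k IHk].
  by rewrite !big_ord0 raddf0 mulr0.
case: k IHk => [|k] IHk; first by rewrite !big_ord_recr !big_ord0 /= !add0r mul1r.
rewrite 2![\sum_(j < k.+2) _]big_ord_recr /=.
move: IHk; set S := \sum_(i < k.+1) x i; set Q := \sum_(i < k.+1) _ => IHk.
rewrite bf_quadD //.
have k0 : (0 : realpart K) < k.+1%:R^-1 by rewrite invr_gt0 ltr0n.
have := bf_amgm pT pY pC S (x k.+1) k0; rewrite invrK.
have : k.+1%:R^-1 * bf T Y C S S <= Q.
  by rewrite mulrC ler_pdivrMr ?ltr0n // mulrC.
rewrite -[k.+2%:R]natr1; move: IHk.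
suff arith (a b c r m e : realpart K) : a <= m * e -> r * a <= e -> 2 * b <= r * a + m * c ->
    a + 2 * b + c <= (m + 1) * (e + c) by apply: arith.
lra.
Qed.

Section Gap.
Variables (K : numClosedFieldType) (d : nat) (Psi : state3 K d).
Local Notation R := (realpart K).
Local Notation tau := (tau Psi).
Local Notation psi := (psi Psi).
Hypotheses (hnorm : normalized Psi) (hsym : perm_symmetric Psi).
Variables (F : finFieldType) (n : nat).
Local Notation pt := (point F n).
Variable A : pt -> F -> 'M[K]_d.
Hypothesis projA : forall x, projmeas (A x).

Definition point_defect z : R := 1 - \sum_a tau (A z a) (A z a) 1%:M.
Definition axis_defect (j : 'I_n) z : R := line_defect Psi (fun t => A (upd z j t)).
Definition ML k := {g : {ffun pt -> F} | mlk k g}.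
Definition Aval k z (g : ML k) := A z (val g z).

Lemma Aidem z a : A z a *m A z a = A z a. Proof. by have [/(_ a)[]] := projA z. Qed.
Lemma Aadj z a : adjmx (A z a) = A z a. Proof. by have [/(_ a)[]] := projA z. Qed.
Lemma Asum z : \sum_a A z a = 1%:M. Proof. by have [] := projA z. Qed.
Lemma Acontr z a : contr (A z a).
Proof. by apply: proj_contr; [apply: Aidem|apply: Aadj]. Qed.
Lemma Apsd z a : psdmx (A z a). Proof. by case: (Acontr z a). Qed.
Lemma A1psd z a : psdmx (1%:M - A z a). Proof. by case: (Acontr z a). Qed.

Section Fixed.
Variables (k : nat) (T : ML k -> 'M[K]_d).
Hypotheses (pT : forall g, psdmx (T g)) (p1T : psdmx (1%:M - \sum_g T g)).
Let v z (g : ML k) := app3 1%:M (Aval z g) 1%:M psi.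
Let w z (g : ML k) := app3 1%:M 1%:M (Aval z g) psi.
Let q (g : ML k) u := bf (T g) 1%:M 1%:M u u.

(** The vector depends on [g] only through [f g]. Letting the outcome run freely decouples it from
    the weights [T' g], which then sum to at most 1. *)
Lemma sum_bf_group (G I : finType) (T' : G -> 'M[K]_d) (f : G -> I) (u : I -> vec K d) :
  (forall g, psdmx (T' g)) -> psdmx (1%:M - \sum_g T' g) ->
  \sum_g bf (T' g) 1%:M 1%:M (u (f g)) (u (f g)) <= \sum_a bf 1%:M 1%:M 1%:M (u a) (u a).
Proof.
move=> pT' p1T'.
apply: le_trans (_ : \sum_g \sum_a bf (T' g) 1%:M 1%:M (u a) (u a) <= _).
  apply: ler_sum => g _; rewrite (bigD1 (f g)) //= lerDl.
  by apply: sumr_ge0 => a _; apply: bf_ge0 => //; apply: psd1.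
rewrite exchange_big /=; apply: ler_sum => a _.
by rewrite -bf_sumT -subr_ge0 -bfBTl; apply: bf_ge0 => //; apply: psd1.
Qed.

Lemma point_defect_sq z : \sum_a bf 1%:M 1%:M 1%:M
    (app3 1%:M (A z a) 1%:M psi - app3 1%:M 1%:M (A z a) psi)
    (app3 1%:M (A z a) 1%:M psi - app3 1%:M 1%:M (A z a) psi) = 2 * point_defect z.
Proof.
have e a : bf 1%:M 1%:M 1%:M
    (app3 1%:M (A z a) 1%:M psi - app3 1%:M 1%:M (A z a) psi)
    (app3 1%:M (A z a) 1%:M psi - app3 1%:M 1%:M (A z a) psi) =
  tau 1%:M (A z a) 1%:M - 2 * tau (A z a) (A z a) 1%:M + tau 1%:M 1%:M (A z a).
  rewrite bf_quadB ?tau_vv; try exact: psd1.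
  by rewrite !(adjmx1, Aadj, mul1mx, mulmx1, Aidem) (tau02 hsym (A z a)).
under eq_bigr do rewrite e.
rewrite big_split sumrB /= -mulr_sumr -tau_sumY -tau_sumC Asum (tau111 hnorm) /point_defect; ring.
Qed.

Lemma step_same z : \sum_g q g (v z g - w z g) <= 2 * point_defect z.
Proof. by rewrite -point_defect_sq; apply: sum_bf_group. Qed.

Lemma step_cross z z' g : q g (v z g - w z' g) =
  tau (T g) (Aval z g) (1%:M - Aval z' g) + tau (T g) (Aval z' g) (1%:M - Aval z g).
Proof.
rewrite /q bf_quadB ?tau_vv //; try exact: psd1.
rewrite !(adjmx1, Aadj, mul1mx, mulmx1, Aidem) !tauBC -(tau12 hsym _ (Aval z g) (Aval z' g)).
rewrite (tau12 hsym _ 1%:M); ring.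
Qed.

(** The line estimate compares measurements made by different players only, as in [step_cross]. So
    each step from [v (z j)] to [v (z j.+1)] passes through [w (z j.+1)], the other player measuring
    the endpoint, and returns by consistency. The factor [m] comes from Cauchy-Schwarz over the
    telescoping sum. *)
Lemma gap_path (z : nat -> pt) m :
  \sum_g tau (T g) (Aval (z 0%N) g) (1%:M - Aval (z m) g) <=
  2 * m%:R * \sum_(j < m) (2 * \sum_g (tau (T g) (Aval (z j) g) (1%:M - Aval (z j.+1) g)
      + tau (T g) (Aval (z j.+1) g) (1%:M - Aval (z j) g)) + 4 * point_defect (z j.+1))
  + 4 * point_defect (z m).
Proof.
apply: le_trans (_ : \sum_g q g (v (z 0%N) g - w (z m) g) <= _).
  apply: ler_sum => g _; rewrite step_cross lerDl.
  by apply: tau_ge0; [|apply: Apsd|apply: A1psd].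
apply: le_trans (_ : \sum_g (2 * m%:R * \sum_(j < m) (2 * q g (v (z j) g - w (z j.+1) g)
    + 2 * q g (v (z j.+1) g - w (z j.+1) g)) + 2 * q g (v (z m) g - w (z m) g)) <= _).
  apply: ler_sum => g _.
  have -> : v (z 0%N) g - w (z m) g =
     \sum_(j < m) (v (z j) g - v (z j.+1) g) + (v (z m) g - w (z m) g).
    have -> : \sum_(j < m) (v (z j) g - v (z j.+1) g) =
        - \sum_(0 <= j < m) (v (z j.+1) g - v (z j) g).
      by rewrite big_mkord -sumrN; apply: eq_bigr => j _; rewrite opprB.
    by rewrite (telescope_sumr (fun j => v (z j) g)) // opprB subrKA.
  have p1 := psd1 K d.
  apply: le_trans (bf_add_le (pT g) p1 p1 _ _) _.
  rewrite lerD2r -mulrA ler_pM2l ?ltr0n //.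
  apply: le_trans (bf_sum_le m (fun j => v (z j) g - v (z j.+1) g) (pT g) p1 p1) _.
  apply: ler_wpM2l; first exact: ler0n.
  apply: ler_sum => j _.
  have := bf_add_le (pT g) p1 p1 (v (z j) g - w (z j.+1) g) (w (z j.+1) g - v (z j.+1) g).
  rewrite subrKA; congr (_ <= _ + 2 * _).
  by rewrite /q -[w _ _ - v _ _]opprB raddfN /= bfC // raddfN opprK.
rewrite big_split /= -mulr_sumr; apply: lerD; last first.
  rewrite -mulr_sumr; have := step_same (z m); lra.
apply: ler_wpM2l; first by rewrite mulr_ge0 ?ler0n.
rewrite exchange_big /=; apply: ler_sum => j _.
rewrite big_split /= -!mulr_sumr; apply: lerD.
  by rewrite ler_pM2l ?ltr0n //; apply: ler_sum => g _; rewrite -step_cross.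
have := step_same (z j.+1); lra.
Qed.
End Fixed.

Definition gap k s (T : ML k -> 'M[K]_d) : R :=
  avg (fun x => avg (fun y => \sum_g tau (T g) (Aval (mix k x s) g) (1%:M - Aval (mix k y s) g))).

Variables (L c : R).
Hypotheses (hL : forall j, avg (axis_defect j) <= L) (hc : avg point_defect <= c).
Let E := 12 * L + 16 * c + 5 / #|F|%:R.

(** Every vertex of the random path is uniformly distributed. *)
Lemma avg_mix3 k j (h : pt -> R) :
  avg (fun s => avg (fun x => avg (fun y => h (mix k (mix j y x) s)))) = avg h.
Proof.
have e s : avg (fun x => avg (fun y => h (mix k (mix j y x) s))) = avg (fun x => h (mix k x s)).
  by rewrite avg_exchange (avg_mix j (fun x => h (mix k x s))).
by rewrite (eq_avg e) avg_exchange avg_mix.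
Qed.

Lemma edge_avg k (j : 'I_n) (T : ML k -> 'M[K]_d) z :
  (forall g, psdmx (T g)) -> psdmx (1%:M - \sum_g T g) ->
  avg (fun t1 => avg (fun t2 =>
    \sum_g tau (T g) (Aval (upd z j t1) g) (1%:M - Aval (upd z j t2) g))) <=
  12 * axis_defect j z + 16 * avg (fun t => point_defect (upd z j t)) + 5 / #|F|%:R.
Proof.
move=> pT p1T.
have /fin_all_exists[lg hlg] (g : ML k) : exists l, forall t, val g (upd z j t) = aff l t.
  exact: mlk_aff (valP g).
have := line_avg hnorm (fun t => projA (upd z j t)) lg pT p1T.
rewrite (eq_avg (g := fun t1 => avg (fun t2 =>
    \sum_g tau (T g) (Aval (upd z j t1) g) (1%:M - Aval (upd z j t2) g)))) //.
move=> t1; apply: eq_avg => t2; apply: eq_bigr => g _.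
by rewrite /Aval !hlg.
Qed.

(** Consecutive vertices differ in coordinate [j] only, and their two values there are independent
    and uniform: this is the situation of [line_avg] on a random axis-parallel line. *)
Lemma path_avg k (j : 'I_n) (f : pt -> pt -> pt -> R) : (j < k)%N ->
  avg (fun s => avg (fun x => avg (fun y =>
    f s (mix k (mix j y x) s) (mix k (mix j.+1 y x) s)))) =
  avg (fun s => avg (fun x => avg (fun y => avg (fun t1 => avg (fun t2 =>
    f s (upd (mix k (mix j y x) s) j t1) (upd (mix k (mix j y x) s) j t2)))))).
Proof.
move=> jk; apply: eq_avg => s; rewrite -(avg_upd j); apply: eq_avg => x.
rewrite [RHS]avg_exchange; apply: eq_avg => t1.
rewrite -(avg_upd j); apply: eq_avg => y; apply: eq_avg => t2.
by rewrite mixS mix_updl mix_updr // upd_upd updE !mix_updl'.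
Qed.

Definition avg3 (f : pt -> pt -> pt -> R) : R :=
  avg (fun s => avg (fun x => avg (fun y => f s x y))).
Lemma avg3_le f g : (forall s x y, f s x y <= g s x y) -> avg3 f <= avg3 g.
Proof. by move=> fg; do 3![apply: avg_le => ?]. Qed.
Lemma avg3D f g : avg3 (fun s x y => f s x y + g s x y) = avg3 f + avg3 g.
Proof.
rewrite /avg3 -avgD; apply: eq_avg => s; rewrite -avgD; apply: eq_avg => x.
by rewrite -avgD.
Qed.
Lemma avg3Z b f : avg3 (fun s x y => b * f s x y) = b * avg3 f.
Proof.
rewrite /avg3 -avgZ; apply: eq_avg => s; rewrite -avgZ; apply: eq_avg => x.
by rewrite -avgZ.
Qed.
Lemma avg3_sum m (f : 'I_m -> pt -> pt -> pt -> R) :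
  avg3 (fun s x y => \sum_(j < m) f j s x y) = \sum_(j < m) avg3 (f j).
Proof.
rewrite /avg3 -avg_sum; apply: eq_avg => s; rewrite -avg_sum; apply: eq_avg => x.
by rewrite -avg_sum.
Qed.

Lemma mix_mix k y x s : mix k (mix k y x) s = mix k y s :> pt.
Proof. by apply/ffunP => j; rewrite !ffunE; case: (j < k)%N. Qed.

(** One factor [k] counts the edges of the path, the other is the Cauchy-Schwarz loss of [gap_path];
    each edge is estimated in both directions. *)
Lemma gap_le k (T : pt -> ML k -> 'M[K]_d) : (k <= n)%N ->
  (forall s g, psdmx (T s g)) -> (forall s, psdmx (1%:M - \sum_g T s g)) ->
  avg (fun s => gap s (T s)) <= 2 * k%:R * (k%:R * (4 * E + 4 * c)) + 4 * c.
Proof.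
move=> kn pT p1T.
pose z (s x y : pt) m : pt := mix k (mix m y x) s.
pose e s a b := \sum_g tau (T s g) (Aval a g) (1%:M - Aval b g).
pose h j y := 12 * axis_defect j y + 16 * avg (fun t => point_defect (upd y j t)) + 5 / #|F|%:R.
have havg j : avg (h j) <= E.
  rewrite 2!avgD 2!avgZ avg_const ?card_pt_gt0 // (avg_upd j point_defect) /E.
  have := hL j; move: hc; lra.
have edge1 (j : 'I_n) : (j < k)%N -> avg3 (fun s x y => e s (z s x y j) (z s x y j.+1)) <= E.
  move=> jk; apply: le_trans (havg j); rewrite -(avg_mix3 k j) /avg3 (path_avg e jk).
  by do 3![apply: avg_le => ?]; apply: edge_avg.
have edge2 (j : 'I_n) : (j < k)%N -> avg3 (fun s x y => e s (z s x y j.+1) (z s x y j)) <= E.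
  move=> jk; apply: le_trans (havg j); rewrite -(avg_mix3 k j) /avg3.
  rewrite (path_avg (fun s a b => e s b a) jk).
  by do 3![apply: avg_le => ?]; rewrite avg_exchange; apply: edge_avg.
have edgec m : avg3 (fun s x y => point_defect (z s x y m)) <= c by rewrite /avg3 avg_mix3.
apply: le_trans (_ : avg3 (fun s x y => 2 * k%:R * (\sum_(j < k)
     (2 * (e s (z s x y j) (z s x y j.+1) + e s (z s x y j.+1) (z s x y j))
      + 4 * point_defect (z s x y j.+1))) + 4 * point_defect (z s x y k)) <= _).
  apply: avg3_le => s x y.
  have := gap_path (pT s) (p1T s) (z s x y) k.
  rewrite /z mix0 mix_mix; congr (_ <= _ * _ + _); apply: eq_bigr => j _.
  by rewrite big_split.
rewrite avg3D 2!avg3Z avg3_sum; apply: lerD; last by rewrite ler_pM2l ?ltr0n.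
apply: ler_wpM2l; first by rewrite mulr_ge0 ?ler0n.
apply: le_trans (_ : \sum_(j < k) (4 * E + 4 * c) <= _); last first.
  by rewrite sumr_const card_ord -(mulr_natl (4 * E + 4 * c)).
apply: ler_sum => j _; pose i := widen_ord kn j.
rewrite avg3D 2!avg3Z avg3D.
have := edge1 i (ltn_ord j); have := edge2 i (ltn_ord j); have := edgec j.+1.
rewrite /=.
move: (avg3 _) (avg3 _) (avg3 _) => a1 a2 a3; lra.
Qed.
End Gap.

(** * Nearly optimal measurements *)

Section TracePsd.
Variables (K : numClosedFieldType) (d : nat).
Local Notation R := (realpart K).
Implicit Types (X Y P : 'M[K]_d).

Definition rtr X : R := re (\tr X).
Fact rtr_is_zmod_morphism : zmod_morphism rtr.
Proof. by move=> X Y; rewrite /rtr !raddfB. Qed.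
HB.instance Definition _ := GRing.isZmodMorphism.Build 'M[K]_d R rtr rtr_is_zmod_morphism.

Lemma rtrZ (r : R) X : rtr (rval r *: X) = r * rtr X.
Proof. by rewrite /rtr mxtraceZ re_scale. Qed.
Lemma rtrC X Y : rtr (X *m Y) = rtr (Y *m X).
Proof. by rewrite /rtr mxtrace_mulC. Qed.

Lemma rtr_ge0 X : psdmx X -> 0 <= rtr X.
Proof.
move=> [_ pX]; apply/re_ge0/sumr_ge0 => i _.
have := pX (delta_mx i 0).
have -> : adjmx (delta_mx i 0 : 'cV[K]_d) = delta_mx 0 i.
  by apply/matrixP=> a b; rewrite !mxE rmorph_nat andbC.
by rewrite -rowE -colE !mxE.
Qed.

Lemma rtr_mul_ge0 X Y : psdmx X -> psdmx Y -> 0 <= rtr (X *m Y).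
Proof.
move=> /psd_sqrt[S pS <-] pY; rewrite -mulmxA rtrC -mulmxA.
by apply: rtr_ge0; have := psd_conj S pY; rewrite (psd_adj pS) -mulmxA.
Qed.

Lemma psd_of_re X : adjmx X = X ->
  (forall v : 'cV[K]_d, 0 <= re ((adjmx v *m X *m v) 0 0)) -> psdmx X.
Proof.
move=> hX pX; split=> // v.
suff r : (adjmx v *m X *m v) 0 0 \is Num.real.
  by have := pX v; rewrite -rval_le rval_re.
have : adjmx (adjmx v *m X *m v) = adjmx v *m X *m v.
  by rewrite !adjmxM adjmxK hX mulmxA.
move: (adjmx v *m X *m v) => W hW; apply/CrealP.
by rewrite -[in RHS]hW !mxE.
Qed.

Definition povm (G : finType) (T : G -> 'M[K]_d) :=
  (forall g, psdmx (T g)) /\ \sum_g T g = 1%:M.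

Variables (G : finType) (g0 : G) (A : G -> 'M[K]_d).
Hypothesis hA : forall g, contr (A g).

Definition objective (T : G -> 'M[K]_d) := \sum_g rtr (T g *m A g).

Lemma objective_le T : povm T -> objective T <= d%:R.
Proof.
move=> [pT sT]; have -> : d%:R = rtr 1%:M by rewrite /rtr mxtrace1 re_nat.
rewrite -sT raddf_sum; apply: ler_sum => g _.
rewrite -subr_ge0 -raddfB -{1}[T g]mulmx1 -mulmxBr.
by apply: rtr_mul_ge0 => //; case: (hA g).
Qed.

Lemma objective_ge0 T : povm T -> 0 <= objective T.
Proof. by move=> [pT _]; apply: sumr_ge0 => g _; apply: rtr_mul_ge0; case: (hA g). Qed.

(** Compactness is not available over [K]; instead [objective_le] bounds the
    number of successive improvements by more than [1 / M]. *)
Lemma near_max (M : nat) : (0 < M)%N ->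
  exists2 T, povm T & forall T', povm T' -> objective T' <= objective T + M%:R^-1.
Proof.
move=> M0; have eta0 : (0 : R) < M%:R^-1 by rewrite invr_gt0 ltr0n.
have gen m T : povm T -> d%:R - m%:R * M%:R^-1 <= objective T ->
    exists2 T, povm T & forall T', povm T' -> objective T' <= objective T + M%:R^-1.
  elim: m T => [|m IHm] T pT hT.
    by exists T => // T' /objective_le; rewrite mul0r subr0 in hT; lra.
  have [[T' pT' hT']|none] :=
      classic (exists2 T', povm T' & objective T + M%:R^-1 < objective T').
    apply: (IHm T' pT'); move: hT hT'; rewrite -natr1; lra.
  by exists T => // T' pT'; rewrite leNgt; apply/negP => lt; apply: none; exists T'.
pose T0 g : 'M[K]_d := if g == g0 then 1%:M else 0.
have pT0 : povm T0.
  split=> [g|]; first by rewrite /T0; case: eqP => _; [apply: psd1|apply: psd0].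
  by rewrite /T0 -big_mkcond big_pred1_eq.
apply: (gen (d * M)%N T0 pT0); rewrite natrM mulfK ?pnatr_eq0 -?lt0n // subrr.
exact: objective_ge0.
Qed.

(** The dual certificate of the maximisation. At an exact maximum the sum of the T_g A_g is
    self-adjoint by itself; near one it has to be symmetrised. *)
Definition Zmx (T : G -> 'M[K]_d) := 2^-1 *: \sum_g (T g *m A g + A g *m T g).

Lemma Zmx_adj T : (forall g, psdmx (T g)) -> adjmx (Zmx T) = Zmx T.
Proof.
move=> pT; rewrite /Zmx adjmxZ conj_Creal ?realV ?realn // raddf_sum.
congr (_ *: _); apply: eq_bigr => g _; rewrite raddfD /= !adjmxM.
by rewrite (psd_adj (pT g)) (psd_adj (hA g).1) addrC.
Qed.

Lemma rtr_Zmx T P : 2 * rtr (P *m Zmx T) = \sum_g (rtr (P *m T g *m A g) + rtr (P *m A g *m T g)).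
Proof.
have h : (2^-1 : K) = rval (2%:R^-1 : R) by rewrite rval_inv rval_nat.
rewrite /Zmx h -scalemxAr rtrZ mulrA mulfV ?pnatr_eq0 // mul1r.
rewrite mulmx_sumr raddf_sum; apply: eq_bigr => g _.
by rewrite mulmxDr raddfD /= !mulmxA.
Qed.

(** With [Q = 1 - s P] one has [Q Q = 1 - (2 s - s^2) P], so conjugating all of [T] by [Q] frees
    exactly [(2 s - s^2) P], which is given to the outcome [h]. The second-order term of the
    conjugation is nonnegative and is dropped. *)
Lemma perturb T h P (s : R) : povm T -> P *m P = P -> adjmx P = P -> 0 <= s <= 1 ->
  exists2 T', povm T' &
   objective T - 2 * s * rtr (P *m Zmx T) + (2 * s - s ^+ 2) * rtr (P *m A h) <= objective T'.
Proof.
move=> [pT sT] PP hP /andP[s0 s1].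
pose Q : 'M[K]_d := 1%:M - rval s *: P.
have hQ : adjmx Q = Q.
  by rewrite /Q raddfB /= adjmx1 adjmxZ hP conj_Creal // rval_real.
have r0 : 0 <= 2 * s - s ^+ 2 by nra.
pose c := rval s + rval s - rval s * rval s.
have hc : c = rval (2 * s - s ^+ 2).
  by rewrite /c -[LHS]/(rval (s + s - s * s)); congr rval; ring.
pose T' g := Q *m T g *m Q + (if g == h then c *: P else 0).
have pP := proj_psd PP hP.
exists T'.
  split=> [g|].
    apply: psdD; first by have := psd_conj Q (pT g); rewrite hQ.
    by case: eqP => _; [rewrite hc; apply: psdZ|apply: psd0].
  rewrite big_split /= -big_mkcond big_pred1_eq -mulmx_suml -mulmx_sumr sT mulmx1.
  rewrite /Q mulmxBl !mulmxBr !mul1mx !mulmx1 -scalemxAl -scalemxAr PP scalerA.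
  rewrite /c scalerBl scalerDl; move: (rval s *: P) ((rval s * rval s) *: P) => x y.
  by rewrite -(addrA x x) addrACA addNr addr0 subrK.
have e g : rtr (T' g *m A g) = rtr (T g *m A g) - s * (rtr (P *m T g *m A g) + rtr (P *m A g *m T g))
   + s ^+ 2 * rtr (P *m T g *m P *m A g) + (if g == h then (2 * s - s ^+ 2) * rtr (P *m A g) else 0).
  rewrite /T' mulmxDl raddfD /=; congr (_ + _); last first.
    by case: eqP => _; [rewrite hc -scalemxAl rtrZ|rewrite mul0mx raddf0].
  have -> : Q *m T g *m Q *m A g = T g *m A g - rval s *: (P *m T g *m A g) -
      (rval s *: (T g *m P *m A g) - rval s *: (rval s *: (P *m T g *m P *m A g))).
    by rewrite /Q !(mulmxBl, mulmxBr, mul1mx, mulmx1) -!scalemxAl -!scalemxAr -!scalemxAl.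
  rewrite !raddfB /= !rtrZ -[T g *m P *m A g]mulmxA (rtrC (T g) (P *m A g)); ring.
rewrite /objective; under [leRHS]eq_bigr do rewrite e.
rewrite !big_split /= sumrN -big_mkcond big_pred1_eq -!mulr_sumr -rtr_Zmx.
have : 0 <= s ^+ 2 * \sum_g rtr (P *m T g *m P *m A g).
  rewrite mulr_ge0 ?sqr_ge0 //; apply: sumr_ge0 => g _.
  apply: rtr_mul_ge0; last by case: (hA g).
  by have := psd_conj P (pT g); rewrite hP.
suff arith (a b z e' : R) : 0 <= s ^+ 2 * b -> a - 2 * s * z + (2 * s - s ^+ 2) * e' <=
  a - s * (2 * z) + s ^+ 2 * b + (2 * s - s ^+ 2) * e' by apply: arith.
move=> hb; lra.
Qed.

Lemma near_optimal_povm (N : nat) : (0 < N)%N ->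
  exists2 T, povm T &
    forall h, psdmx (Zmx T + rval (N%:R^-1 : R) *: 1%:M - A h).
Proof.
move=> N0; have NN0 : (0 < N * N)%N by rewrite muln_gt0 N0.
(* Precision [1 / N^2] matches a perturbation of size [s = 1 / N] along the projector onto [v]: the
   second-order terms then have the size of the precision, and dividing by [2 s] leaves [1 / N]. *)
have [T pT hT] := near_max NN0; exists T => // h.
have Npos : (0 : R) < N%:R by rewrite ltr0n.
have [r rE] : exists r : R, r = N%:R^-1 by exists N%:R^-1.
have rpos : 0 < r by rewrite rE invr_gt0.
have r1 : r <= 1 by rewrite rE invf_le1 // ler1n.
rewrite -rE; apply: psd_of_re => [|v].
  rewrite raddfB raddfD /= (Zmx_adj pT.1) adjmxZ adjmx1 conj_Creal ?rval_real //.
  by rewrite (psd_adj (hA h).1).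
pose q X := (adjmx v *m X *m v) 0 0.
pose nu : R := re (q 1%:M).
have nuE : rval nu = (adjmx v *m v) 0 0.
  by rewrite /nu /q mulmx1 rval_re // ger0_real // adjmx_norm_ge0.
have nu0 : 0 <= nu by rewrite -rval_le nuE adjmx_norm_ge0.
have qD X Y : q (X + Y) = q X + q Y by rewrite /q mulmxDr mulmxDl mxE.
have qN X : q (- X) = - q X by rewrite /q mulmxN mulNmx mxE.
have qZ (t : R) X : re (q (rval t *: X)) = t * re (q X).
  by rewrite /q -scalemxAr -scalemxAl mxE re_scale.
rewrite -/(q _) qD qN qD !raddfD raddfN /= qZ -/nu.
have [nu_eq0|nu_neq0] := eqVneq nu 0.
  have v0 : v = 0.
    move: nuE; rewrite nu_eq0 mxE => /esym/eqP; rewrite -[rval 0]/(0 : K).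
    rewrite psumr_eq0 => [/allP h0|i _]; last by rewrite !mxE mulrC mul_conjC_ge0.
    apply/matrixP => i j; rewrite ord1 !mxE.
    have := h0 i (mem_index_enum _); rewrite !mxE mulrC mul_conjC_eq0 => /eqP //.
  by rewrite nu_eq0 mulr0 addr0 /q v0 !mulmx0 subrr.
have nupos : 0 < nu by rewrite lt_def nu_neq0.
pose P : 'M[K]_d := rval nu^-1 *: (v *m adjmx v).
have trP X : rtr (P *m X) = nu^-1 * re (q X).
  rewrite /P -scalemxAl rtrZ; congr (_ * _).
  by rewrite rtrC mulmxA /rtr mxtrace_mulC mulmxA /q trace_mx11.
have vv : adjmx v *m v = rval nu *: 1%:M.
  by apply/matrixP => i j; rewrite !ord1 nuE !mxE eqxx mulr1.
have PP : P *m P = P.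
  rewrite /P -scalemxAl -scalemxAr -mulmxA (mulmxA (adjmx v)) vv.
  rewrite -scalemxAl mul1mx -scalemxAr !scalerA; congr (_ *: _).
  by rewrite -[LHS]/(rval (nu^-1 * (nu^-1 * nu))) mulVf // mulr1.
have hP : adjmx P = P.
  by rewrite /P adjmxZ adjmxM adjmxK conj_Creal // rval_real.
have [|T' pT' hT'] := perturb h pT PP hP (s := r); first by rewrite ltW.
move/le_trans/(_ (hT _ pT')): hT'; rewrite natrM invfM -rE.
have pv : 0 <= rtr (P *m (1%:M - A h)).
  by apply: rtr_mul_ge0 (proj_psd PP hP) _; case: (hA h).
have tr1 : rtr P = 1 by rewrite -[P]mulmx1 trP -/nu mulVf.
move: pv; rewrite mulmxBr mulmx1 raddfB /= tr1 !trP => pv.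
set a := nu^-1 * re (q (Zmx T)); set b := nu^-1 * re (q (A h)) in pv *.
move=> hab.
have : b - a <= r by rewrite -(ler_pM2l rpos); move: hab pv; rewrite -/a -/b; move: (objective T) => o; clear -rpos; nra.
rewrite /a /b -mulrBr mulrC ler_pdivrMr //; lra.
Qed.
End TracePsd.

(** * Self-improvement *)

Section MxAvg.
Variables (K : numClosedFieldType) (d : nat) (X : finType).
Hypothesis X0 : (0 < #|X|)%N.
Local Notation R := (realpart K).

Definition mxavg (M : X -> 'M[K]_d) : 'M[K]_d := rval (#|X|%:R^-1 : R) *: \sum_x M x.

Lemma rval_cardV_ge0 : 0 <= rval (#|X|%:R^-1 : R).
Proof. by rewrite -[0]/(rval 0) rval_le invr_ge0 ler0n. Qed.

Lemma mxavg_psd M : (forall x, psdmx (M x)) -> psdmx (mxavg M).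
Proof. by move=> pM; apply/psdZ/psd_sum => //; apply: rval_cardV_ge0. Qed.

Lemma mxavg_const M : mxavg (fun=> M) = M.
Proof.
rewrite /mxavg sumr_const -scaler_nat scalerA -rval_nat -[_ * _]/(rval (_ * _)).
by rewrite mulVf ?pnatr_eq0 -?lt0n // -[rval 1]/(1 : K) scale1r.
Qed.

Lemma mxavgB M N : mxavg (fun x => M x - N x) = mxavg M - mxavg N.
Proof. by rewrite /mxavg sumrB scalerBr. Qed.

Lemma mxavg_sum (I : finType) (M : I -> X -> 'M[K]_d) :
  mxavg (fun x => \sum_i M i x) = \sum_i mxavg (M i).
Proof. by rewrite /mxavg exchange_big scaler_sumr. Qed.

Lemma mxavg_contr M : (forall x, contr (M x)) -> contr (mxavg M).
Proof.
move=> cM; split; first by apply: mxavg_psd => x; case: (cM x).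
by rewrite -(mxavg_const 1%:M) -mxavgB; apply: mxavg_psd => x; case: (cM x).
Qed.

Variable Psi : state3 K d.
Local Notation tau := (tau Psi).
Lemma tau_avgT M Y C : tau (mxavg M) Y C = avg (fun x => tau (M x) Y C).
Proof. by rewrite /tau bfZT bf_sumT. Qed.
Lemma tau_avgY T M C : tau T (mxavg M) C = avg (fun x => tau T (M x) C).
Proof. by rewrite /tau bfZY bf_sumY. Qed.
Lemma tau_avgC T Y M : tau T Y (mxavg M) = avg (fun x => tau T Y (M x)).
Proof. by rewrite /tau bfZC bf_sumC. Qed.
End MxAvg.

Section SelfImprove.
Variables (K : numClosedFieldType) (d : nat) (Psi : state3 K d).
Local Notation R := (realpart K).
Local Notation tau := (tau Psi).
Local Notation psi := (psi Psi).
Hypotheses (hnorm : normalized Psi) (hsym : perm_symmetric Psi).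
Variables (X I G : finType) (Q : X -> I -> 'M[K]_d) (f : X -> G -> I).
Hypotheses (X0 : (0 < #|X|)%N) (projQ : forall x, projmeas (Q x)).
Variable T : G -> 'M[K]_d.
Hypothesis povmT : povm T.

Let P x g := Q x (f x g).
Let pT g : psdmx (T g). Proof. exact: povmT.1. Qed.
Let sT : \sum_g T g = 1%:M. Proof. exact: povmT.2. Qed.
Let p1 : psdmx (1%:M : 'M[K]_d). Proof. exact: psd1. Qed.
Let p0 : psdmx (1%:M - \sum_g T g : 'M[K]_d). Proof. by rewrite sT subrr; apply: psd0. Qed.
Let QM x a : Q x a *m Q x a = Q x a. Proof. by have [/(_ a)[]] := projQ x. Qed.
Let Qadj x a : adjmx (Q x a) = Q x a. Proof. by have [/(_ a)[]] := projQ x. Qed.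
Let Qsum x : \sum_a Q x a = 1%:M. Proof. by have [] := projQ x. Qed.
Let Qcontr x a : contr (Q x a).
Proof. by apply: proj_contr; [apply: QM|apply: Qadj]. Qed.

Definition pvm_defect x : R := 1 - \sum_a tau (Q x a) (Q x a) 1%:M.
Definition expectation_mx g := mxavg (fun x => P x g).
Definition improved g := mxavg (fun x => P x g *m T g *m P x g).
(** By [pvm_gapE] this is the sum of the <T_g (x) A_g (x) (1 - A_g)>, that is, the failure of [A_g]
    to be idempotent as seen beside an outcome [g]. *)
Definition pvm_gap : R :=
  avg (fun x => avg (fun y => \sum_g tau (T g) (P x g) (1%:M - P y g))).
Local Notation Am := expectation_mx.
Local Notation H := improved.
Local Notation Hs := (\sum_g H g).

Lemma expectation_mx_contr g : contr (Am g). Proof. by apply: mxavg_contr => // x; apply: Qcontr. Qed.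

Lemma improved_psd g : psdmx (H g).
Proof. by apply: mxavg_psd => x; have := psd_conj (P x g) (pT g); rewrite Qadj. Qed.

(** Those [g] with the same value at [x] share a projector, so their [T g] add up to at most 1
    before that projector is applied on both sides. *)
Lemma pinch_le x : psdmx (1%:M - \sum_g P x g *m T g *m P x g).
Proof.
have -> : 1%:M - \sum_g P x g *m T g *m P x g =
    \sum_a Q x a *m (1%:M - \sum_(g | f x g == a) T g) *m Q x a.
  under [RHS]eq_bigr do rewrite mulmxBr mulmxBl mulmx1 QM.
  rewrite sumrB Qsum; congr (_ - _).
  rewrite (partition_big (f x) predT) //=; apply: eq_bigr => a _.
  rewrite mulmx_sumr mulmx_suml; apply: eq_bigr => g /eqP <- //.
apply: psd_sum => a _.
suff h : psdmx (1%:M - \sum_(g | f x g == a) T g).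
  by have := psd_conj (Q x a) h; rewrite Qadj.
rewrite -sT (bigID (fun g => f x g == a)) /= addrAC subrr add0r.
exact: psd_sum.
Qed.

Lemma improved_contr : contr Hs.
Proof.
split; first by apply: psd_sum => g _; apply: improved_psd.
rewrite -mxavg_sum -(mxavg_const X0 1%:M) -mxavgB; apply: mxavg_psd => x.
exact: pinch_le.
Qed.

Let Z := Zmx Am T.

(** An anticommutator of positive operators need not be positive, so there is no termwise bound.
    Expanding (1 - P) T (1 - P) writes [1 - Z] as half the sum of two positive terms, the second
    being that of [pinch_le]. *)
Lemma Zmx_le1 : psdmx (1%:M - Z).
Proof.
have -> : 1%:M - Z = mxavg (fun x => rval (2^-1 : R) *:
   (\sum_g (1%:M - P x g) *m T g *m (1%:M - P x g) +
    (1%:M - \sum_g P x g *m T g *m P x g))).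
  rewrite -{1}(mxavg_const X0 1%:M).
  have -> : Z = mxavg (fun x => rval (2^-1 : R) *: \sum_g (T g *m P x g + P x g *m T g)).
    rewrite /Z /Zmx /mxavg -scaler_sumr scalerA mulrC -scalerA.
    rewrite rval_inv rval_nat; congr (_ *: _).
    rewrite exchange_big scaler_sumr; apply: eq_bigr => g _.
    by rewrite /Am /mxavg -scalemxAr -scalemxAl -scalerDr mulmx_sumr mulmx_suml big_split.
  rewrite -mxavgB; congr (_ *: _); apply: eq_bigr => x _.
  have -> : \sum_g (1%:M - P x g) *m T g *m (1%:M - P x g) =
     1%:M - \sum_g (T g *m P x g + P x g *m T g) + \sum_g P x g *m T g *m P x g.
    rewrite -[X in _ = X - _ + _]sT -sumrB -big_split /=; apply: eq_bigr => g _.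
    rewrite mulmxBl mul1mx mulmxBr mulmx1 mulmxBl opprB opprD !addrA.
    by rewrite addrAC (addrAC (T g)).
  rewrite [in RHS]addrACA subrr addr0 [in RHS]addrAC scalerBr; congr (_ - _).
  rewrite -[1%:M + 1%:M]mulr2n -scaler_nat scalerA rval_inv rval_nat mulVf ?pnatr_eq0 //.
  by rewrite scale1r.
apply: mxavg_psd => x; apply: psdZ.
  by rewrite -[0]/(rval 0) rval_le invr_ge0 ler0n.
apply: psdD (pinch_le x); apply: psd_sum => g _.
by have := psd_conj (1%:M - P x g) (pT g); rewrite (psd_adj (Qcontr x (f x g)).2).
Qed.

Variables (del eta : R).
Hypotheses (del0 : 0 < del) (eta0 : 0 <= eta) (eta1 : eta <= 1).
Hypothesis Zdom : forall g, psdmx (Z + rval eta *: 1%:M - Am g).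
(** The price of moving a projector to another player, from AM-GM with weight [del]. *)
Let m := avg pvm_defect / del + 2 * del.
Let Zh := Z + rval eta *: 1%:M.

Lemma sum_weighted_le1 (Y C : G -> 'M[K]_d) :
  (forall g, contr (Y g)) -> (forall g, contr (C g)) ->
  \sum_g tau (T g) (Y g) (C g) <= 1.
Proof.
move=> cY cC; rewrite -(tau111 hnorm) -{1}sT tau_sumT; apply: ler_sum => g _.
apply: le_trans (_ : tau (T g) 1%:M (C g) <= _).
  by apply: tau_monoY; [exact: (cY g).2| |exact: (cC g).1].
by apply: tau_monoC; [exact: (cC g).2| |].
Qed.

Lemma sum_pinch_le1 x (Y : G -> 'M[K]_d) : (forall g, contr (Y g)) ->
  \sum_g tau (P x g *m T g *m P x g) (Y g) 1%:M <= 1.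
Proof.
move=> cY.
apply: le_trans (_ : \sum_g tau (P x g *m T g *m P x g) 1%:M 1%:M <= _).
  apply: ler_sum => g _; apply: tau_monoY; [exact: (cY g).2| |] => //.
  by have := psd_conj (P x g) (pT g); rewrite Qadj.
by rewrite -(tau111 hnorm) -tau_sumT; apply: tau_monoT (pinch_le x) _ _.
Qed.

Let u x g := app3 (P x g) 1%:M 1%:M psi.
Let w x g := app3 1%:M 1%:M (P x g) psi.

Lemma pvm_defect_sq x (Y : G -> 'M[K]_d) : (forall g, contr (Y g)) ->
  \sum_g bf (T g) (Y g) 1%:M (u x g - w x g) (u x g - w x g) <= 2 * pvm_defect x.
Proof.
move=> cY.
apply: le_trans (_ : \sum_g bf (T g) 1%:M 1%:M (u x g - w x g) (u x g - w x g) <= _).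
  apply: ler_sum => g _; rewrite -subr_ge0 -bfBYl; apply: bf_ge0 => //.
  exact: (cY g).2.
pose D a := app3 (Q x a) 1%:M 1%:M psi - app3 1%:M 1%:M (Q x a) psi.
apply: le_trans (sum_bf_group (f x) D pT p0) _.
have e a : bf 1%:M 1%:M 1%:M (D a) (D a) =
  tau (Q x a) 1%:M 1%:M - 2 * tau (Q x a) (Q x a) 1%:M + tau 1%:M 1%:M (Q x a).
  rewrite bf_quadB // !tau_vv.
  by rewrite !(adjmx1, Qadj, mul1mx, mulmx1, QM) (tau12 hsym (Q x a) (Q x a)).
under eq_bigr do rewrite e.
rewrite big_split sumrB /= -mulr_sumr -tau_sumT -tau_sumC Qsum (tau111 hnorm) /pvm_defect; lra.
Qed.

Lemma improved_move (Y : G -> 'M[K]_d) : (forall g, contr (Y g)) ->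
  let a : R := \sum_g tau (H g) (Y g) 1%:M in
  let b : R := \sum_g avg (fun x => tau (T g) (Y g) (P x g)) in
  a <= b + m /\ b <= a + m.
Proof.
move=> cY a b.
pose ax x : R := \sum_g tau (P x g *m T g *m P x g) (Y g) 1%:M.
pose bx x : R := \sum_g tau (T g) (Y g) (P x g).
have aE : a = avg ax.
  by rewrite /a /ax avg_sum; apply: eq_bigr => g _; rewrite tau_avgT.
have bE : b = avg bx by rewrite /b /bx avg_sum.
have mE : m = avg (fun x => pvm_defect x / del + 2 * del).
  rewrite avgD avg_const // /m; congr (_ + _).
  by rewrite mulrC -avgZ; apply: eq_avg => x; rewrite mulrC.
have buu x g : bf (T g) (Y g) 1%:M (u x g) (u x g) = tau (P x g *m T g *m P x g) (Y g) 1%:M.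
  by rewrite tau_vv !(adjmx1, Qadj, mul1mx, mulmx1, QM).
have bww x g : bf (T g) (Y g) 1%:M (w x g) (w x g) = tau (T g) (Y g) (P x g).
  by rewrite tau_vv !(adjmx1, Qadj, mul1mx, mulmx1, QM).
have dc : (2 * del)^-1 * 2 = del^-1 by field; rewrite gt_eqF.
have di : 0 <= (2 * del)^-1 by rewrite invr_ge0 mulr_ge0 ?ler0n ?ltW.
have bnd x : ax x <= 1 /\ bx x <= 1.
  split; first exact: sum_pinch_le1.
  by apply: sum_weighted_le1 => // g; apply: Qcontr.
have key x : ax x <= bx x + (pvm_defect x / del + 2 * del) /\ bx x <= ax x + (pvm_defect x / del + 2 * del).
  have sq := pvm_defect_sq x cY.
  have [a1 b1] := bnd x.
  have {sq} sq := ler_wpM2l di sq; rewrite mulrA dc in sq.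
  have ab : del * (ax x + bx x) <= 2 * del.
    by rewrite [leRHS]mulrC ler_pM2l //; exact: (lerD a1 b1).
  split.
    apply: le_trans (_ : bx x + ((2 * del)^-1 * \sum_g bf (T g) (Y g) 1%:M (u x g - w x g) (u x g - w x g)
      + del * (ax x + bx x)) <= _); last by move: sq ab; rewrite [_ / del]mulrC; lra.
    rewrite /ax /bx -big_split mulr_sumr mulr_sumr -!big_split /=.
    apply: ler_sum => g _; rewrite addrA -buu -bww.
    by apply: bf_move => //; case: (cY g).
  apply: le_trans (_ : ax x + ((2 * del)^-1 * \sum_g bf (T g) (Y g) 1%:M (u x g - w x g) (u x g - w x g)
      + del * (bx x + ax x)) <= _); last by move: sq ab; rewrite [_ / del]mulrC; lra.
  rewrite /ax /bx -big_split mulr_sumr mulr_sumr -!big_split /=.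
  apply: ler_sum => g _; rewrite addrA -buu -bww.
  have -> : bf (T g) (Y g) 1%:M (u x g - w x g) (u x g - w x g) =
            bf (T g) (Y g) 1%:M (w x g - u x g) (w x g - u x g).
    by rewrite -[w x g - _]opprB raddfN /= bfC ?raddfN ?opprK //; case: (cY g).
  by apply: bf_move => //; case: (cY g).
by rewrite aE bE mE -!avgD; split; apply: avg_le => x; case: (key x).
Qed.

(** As for [improved_move], but in [Z] the projector acts on one side of [T g] only. The difference
    is therefore linear in [u x g - w x g], and is estimated by AM-GM against [psi]. *)
Lemma Zmx_move Y : contr Y ->
  let b : R := \sum_g avg (fun x => tau (T g) Y (P x g)) in
  tau Z Y 1%:M <= b + m /\ b <= tau Z Y 1%:M + m.
Proof.
move=> cY b; have pY := cY.1.
pose zx x : R := \sum_g bf (T g) Y 1%:M psi (u x g).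
pose bx x : R := \sum_g bf (T g) Y 1%:M psi (w x g).
have psiE : psi = app3 1%:M 1%:M 1%:M psi by rewrite app3_111.
have bE : b = avg bx.
  rewrite /b /bx avg_sum; apply: eq_bigr => g _; apply: eq_avg => x.
  by rewrite [X in bf _ _ _ X]psiE tau_vv !(adjmx1, mul1mx, mulmx1).
have zE : tau Z Y 1%:M = avg zx.
  have h : (2^-1 : K) = rval (2%:R^-1 : R) by rewrite rval_inv rval_nat.
  rewrite /Z /Zmx h {1}/tau bfZT bf_sumT /zx avg_sum mulr_sumr; apply: eq_bigr => g _.
  have -> : avg (fun x => bf (T g) Y 1%:M psi (u x g)) = tau (T g *m Am g) Y 1%:M.
    rewrite /expectation_mx /mxavg -scalemxAr mulmx_sumr -/(mxavg (fun x => T g *m P x g)) tau_avgT.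
    apply: eq_avg => x.
    by rewrite [X in bf _ _ _ X]psiE tau_vv !(adjmx1, mul1mx, mulmx1).
  have -> : bf (T g *m Am g + Am g *m T g) Y 1%:M psi psi =
     tau (T g *m Am g) Y 1%:M + tau (Am g *m T g) Y 1%:M by rewrite -tauDT.
  (* The two orders are adjoint to each other, hence have the same real part. *)
  have -> : tau (Am g *m T g) Y 1%:M = tau (T g *m Am g) Y 1%:M.
    rewrite /tau /bf ipC app3_adj adjmxM (psd_adj (pT g)) (psd_adj (expectation_mx_contr g).1).
    by rewrite (psd_adj pY) adjmx1.
  by rewrite mulrDr -mulrDl -mulr2n -[_ *+ 2]mulr_natl mulfV ?pnatr_eq0 // mul1r.
have mE : m = avg (fun x => pvm_defect x / del + 2 * del).
  rewrite avgD avg_const // /m; congr (_ + _).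
  by rewrite mulrC -avgZ; apply: eq_avg => x; rewrite mulrC.
have key x : zx x <= bx x + (pvm_defect x / del + 2 * del) /\ bx x <= zx x + (pvm_defect x / del + 2 * del).
  have sq := pvm_defect_sq x (fun=> cY).
  have s1 : \sum_g bf (T g) Y 1%:M psi psi <= 1.
    by apply: (sum_weighted_le1 (fun=> cY) (C := fun=> 1%:M)) => g; split; rewrite // subrr; apply: psd0.
  have c0 : 0 <= pvm_defect x.
    rewrite -(pmulr_rge0 _ (_ : 0 < 2)) ?ltr0n //; apply: le_trans sq.
    by apply: sumr_ge0 => g _; apply: bf_ge0.
  have di : 0 <= del^-1 by rewrite invr_ge0 ltW.
  have {sq} sq := ler_wpM2l di sq.
  have ds : del * \sum_g bf (T g) Y 1%:M psi psi <= del by rewrite ler_piMr // ltW.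
  have cd : 0 <= pvm_defect x / del by rewrite divr_ge0 // ltW.
  have amgm (v1 v2 : G -> vec K d) : (\sum_g bf (T g) Y 1%:M (v1 g - v2 g) (v1 g - v2 g) =
      \sum_g bf (T g) Y 1%:M (u x g - w x g) (u x g - w x g)) ->
      2 * \sum_g bf (T g) Y 1%:M psi (v1 g - v2 g) <= 2 * (pvm_defect x / del + 2 * del).
    move=> e; apply: le_trans (_ : del * (\sum_g bf (T g) Y 1%:M psi psi) + del^-1 *
        (\sum_g bf (T g) Y 1%:M (v1 g - v2 g) (v1 g - v2 g)) <= _).
      rewrite !mulr_sumr -big_split /=; apply: ler_sum => g _.
      exact: bf_amgm.
    by rewrite e; move: sq ds cd del0; rewrite [_ / del]mulrC; lra.
  have h1 := amgm (u x) (w x) erefl.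
  have h2 := amgm (w x) (u x).
  have e1 : \sum_g bf (T g) Y 1%:M psi (u x g - w x g) = zx x - bx x.
    by rewrite /zx /bx -sumrB; apply: eq_bigr => g _; rewrite raddfB.
  have e2 : \sum_g bf (T g) Y 1%:M psi (w x g - u x g) = bx x - zx x.
    by rewrite /zx /bx -sumrB; apply: eq_bigr => g _; rewrite raddfB.
  rewrite e1 in h1; rewrite e2 in h2; split; first by lra.
  suff : 2 * (bx x - zx x) <= 2 * (pvm_defect x / del + 2 * del) by lra.
  apply: h2; apply: eq_bigr => g _.
  by rewrite -[w x g - _]opprB raddfN /= bfC ?raddfN ?opprK.
by rewrite zE bE mE -!avgD; split; apply: avg_le => x; case: (key x).
Qed.
End SelfImprove.

Section Improved.
Variables (K : numClosedFieldType) (d : nat) (Psi : state3 K d).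
Local Notation R := (realpart K).
Local Notation tau := (tau Psi).
Hypotheses (hnorm : normalized Psi) (hsym : perm_symmetric Psi).
Variables (X I G : finType) (Q : X -> I -> 'M[K]_d) (f : X -> G -> I) (g0 : G).
Hypotheses (X0 : (0 < #|X|)%N) (projQ : forall x, projmeas (Q x)).
Variable T : G -> 'M[K]_d.
Hypothesis povmT : povm T.
Local Notation Am := (expectation_mx Q f).
Local Notation H := (improved Q f T).
Local Notation Hs := (\sum_g H g).
Local Notation Z := (Zmx Am T).
Local Notation gp := (pvm_gap Psi Q f T).
Variables (del eta : R).
Hypotheses (del0 : 0 < del) (eta0 : 0 <= eta) (eta1 : eta <= 1).
Hypothesis Zdom : forall g, psdmx (Z + rval eta *: 1%:M - Am g).
Local Notation m := (avg (pvm_defect Psi Q) / del + 2 * del).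
Local Notation Zh := (Z + rval eta *: 1%:M).
Let p1 : psdmx (1%:M : 'M[K]_d). Proof. exact: psd1. Qed.
Let c1 : contr (1%:M : 'M[K]_d). Proof. by split; rewrite ?subrr //; apply: psd0. Qed.
Let cA g : contr (Am g). Proof. exact: expectation_mx_contr. Qed.
Let cHs : contr Hs. Proof. exact: improved_contr. Qed.
Let pT g : psdmx (T g). Proof. exact: povmT.1. Qed.

Lemma tau_sum_povm (Y C : 'M[K]_d) : \sum_g tau (T g) Y C = tau 1%:M Y C.
Proof. by rewrite -tau_sumT povmT.2. Qed.

Lemma one_sub_expectation_mx g : 1%:M - Am g = mxavg (fun x => 1%:M - Q x (f x g)).
Proof. by rewrite mxavgB mxavg_const. Qed.

Lemma pvm_gapE : gp = \sum_g tau (T g) (Am g) (1%:M - Am g).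
Proof.
rewrite /pvm_gap.
under eq_avg => x do rewrite avg_sum.
rewrite avg_sum; apply: eq_bigr => g _.
by rewrite one_sub_expectation_mx tau_avgY; apply: eq_avg => x; rewrite tau_avgC.
Qed.

Lemma sum_avgC (Y : G -> 'M[K]_d) :
  \sum_g avg (fun x => tau (T g) (Y g) (Q x (f x g))) = \sum_g tau (T g) (Y g) (Am g).
Proof. by apply: eq_bigr => g _; rewrite tau_avgC. Qed.

(** Moving the projectors out of [H g] turns the left side into the sum of <T_g (x) (1 - A_g) (x)
    A_g>, which is the gap. *)
Lemma improved_consistent : \sum_g tau (H g) (1%:M - Am g) 1%:M <= gp + m.
Proof.
have [h _] := improved_move hnorm hsym f X0 projQ povmT del0 (fun g => contrC (cA g)).
apply: le_trans h _; rewrite sum_avgC pvm_gapE lerD2r; apply: ler_sum => g _.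
by rewrite (tau12 hsym).
Qed.

Let t1 : R := \sum_g tau (T g) 1%:M (Am g).
Let t2 : R := \sum_g tau (T g) (Am g) (Am g).

Lemma gap_diff : gp = t1 - t2.
Proof.
rewrite pvm_gapE /t1 /t2 -sumrB; apply: eq_bigr => g _.
by rewrite tauBC (tau12 hsym _ (Am g) 1%:M).
Qed.

Lemma move_Z1 : tau Z 1%:M 1%:M <= t1 + m /\ t1 <= tau Z 1%:M 1%:M + m.
Proof.
have := Zmx_move hnorm hsym f X0 projQ povmT del0 c1.
by rewrite (sum_avgC (fun=> 1%:M)).
Qed.

Lemma move_H1 : tau Hs 1%:M 1%:M <= t1 + m /\ t1 <= tau Hs 1%:M 1%:M + m.
Proof.
have := improved_move hnorm hsym f X0 projQ povmT del0 (fun=> c1).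
by rewrite (sum_avgC (fun=> 1%:M)) -tau_sumT.
Qed.

Lemma Zmx_sub_improved : tau Z 1%:M 1%:M - tau Hs 1%:M 1%:M <= 2 * m.
Proof. by have := move_Z1; have := move_H1; lra. Qed.

Lemma Zmx_shift_psd : psdmx Zh.
Proof. by rewrite -[Zh](subrK (Am g0)); apply: psdD (Zdom g0) (cA g0).1. Qed.

(** The moving lemmas want a contraction, while [Z + eta] is only known to be at most 2. *)
Let Yh := rval (2^-1 : R) *: Zh.
Let cYh : contr Yh.
Proof.
have h0 : 0 <= rval (2^-1 : R) by rewrite -[0]/(rval 0) rval_le invr_ge0 ler0n.
split; first by apply: psdZ h0 Zmx_shift_psd.
have -> : 1%:M - Yh = rval (2^-1 : R) *: ((1%:M - Z) + rval (1 - eta) *: 1%:M).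
  rewrite -[rval (1 - eta)]/(1 - rval eta) scalerBl scale1r addrACA -opprD scalerBr.
  congr (_ - _); rewrite -[1%:M + 1%:M]mulr2n -scaler_nat scalerA rval_inv rval_nat.
  by rewrite mulVf ?pnatr_eq0 // scale1r.
apply: psdZ h0 (psdD _ (psdZ _ p1)); first exact: (Zmx_le1 f X0 projQ povmT).
by rewrite -[0]/(rval 0) rval_le subr_ge0.
Qed.

Let half Y C : 2 * tau Y Yh C = tau Y Zh C.
Proof. by rewrite /tau (bfZY _ Y Zh C) mulrA mulfV ?pnatr_eq0 // mul1r. Qed.

Let tYh : t2 <= 2 * \sum_g tau (T g) Yh (Am g).
Proof.
rewrite mulr_sumr; apply: ler_sum => g _.
rewrite half; by apply: tau_monoY => //; exact: (cA g).1.
Qed.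

Let tZh : tau 1%:M Zh 1%:M = tau Z 1%:M 1%:M + eta.
Proof. by rewrite (tau01 hsym) tauDT {2}/tau bfZT -/(tau _ _ _) (tau111 hnorm) mulr1. Qed.

(** Moving turns <H (x) Zh> into the sum of <T_g (x) Zh (x) A_g>, which is at least [t2] because
    [Zh] dominates each [A_g]. As <Z> is about [t1], what remains is [t1 - t2], the gap. The move is
    paid twice since it is done with [Zh / 2]. *)
Lemma improved_bounded : tau (1%:M - Hs) Zh 1%:M <= eta + 3 * m + gp.
Proof.
have [_] := improved_move hnorm hsym f X0 projQ povmT del0 (fun=> cYh).
rewrite (sum_avgC (fun=> Yh)) -tau_sumT => h.
rewrite tauBT tZh; have := half Hs 1%:M; have := tYh; have := gap_diff; have := move_Z1.
move: h; lra.
Qed.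

Lemma Zmx_bounded : tau (1%:M - Z) Zh 1%:M <= eta + 3 * m + gp.
Proof.
have [_] := Zmx_move hnorm hsym f X0 projQ povmT del0 cYh.
rewrite (sum_avgC (fun=> Yh)) => h.
rewrite tauBT tZh; have := half Z 1%:M; have := tYh; have := gap_diff; have := move_Z1.
move: h; lra.
Qed.

(** After the move, [A_g] is replaced by the larger [Zh]; then [T g] sums to 1 and
    [improved_bounded] applies. *)
Lemma improved_almost_proj : tau Hs (1%:M - Hs) 1%:M <= eta + 4 * m + gp.
Proof.
have [h _] := improved_move hnorm hsym f X0 projQ povmT del0 (fun=> contrC cHs).
move: h; rewrite (sum_avgC (fun=> _)) -tau_sumT => h.
have : \sum_g tau (T g) (1%:M - Hs) (Am g) <= tau (1%:M - Hs) Zh 1%:M.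
  rewrite [leRHS](tau12 hsym) (tau01 hsym) -tau_sum_povm; apply: ler_sum => g _.
  by apply: tau_monoC => //; exact: (contrC cHs).1.
have := improved_bounded; move: h; lra.
Qed.

Variable sig : R.
Hypothesis sep : forall g h, g != h -> avg (fun x => (f x g == f x h)%:R : R) <= sig.
Hypothesis sig0 : 0 <= sig.

Let pH g : psdmx (H g). Proof. exact: improved_psd. Qed.

(** Let the third player measure at a random [x]. Unless [f x g = f x h], one outcome cannot match
    both [g] and [h], so 1 is at most the sum of the two mismatch operators, and these are small by
    consistency. Coincidences have probability at most [sig]. *)
Lemma improved_offdiag :
  tau Hs Hs 1%:M - \sum_g tau (H g) (H g) 1%:M <= 2 * (gp + m) + sig.
Proof.
have -> : tau Hs Hs 1%:M - \sum_g tau (H g) (H g) 1%:M =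
    \sum_g \sum_(h | h != g) tau (H g) (H h) 1%:M.
  rewrite tau_sumT -sumrB; apply: eq_bigr => g _.
  by rewrite tau_sumY (bigD1 g) //= addrAC subrr add0r.
have cH h : contr (H h) by apply: (@sub_contr K d G H).
pose e x g := 1%:M - Q x (f x g).
have Qc x a : contr (Q x a).
  by have [hQ _] := projQ x; apply: proj_contr; case: (hQ a).
have pe x g : psdmx (e x g) by case: (Qc x (f x g)).
have pt x g h : tau (H g) (H h) 1%:M <= (f x g == f x h)%:R * tau (H g) (H h) 1%:M +
    (tau (H g) (H h) (e x g) + tau (H g) (H h) (e x h)).
  have n1 := tau_ge0 Psi (pH g) (pH h) (pe x g); have n2 := tau_ge0 Psi (pH g) (pH h) (pe x h).
  have [eq|neq] := eqVneq (f x g) (f x h); first by rewrite mul1r lerDl addr_ge0.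
  rewrite mul0r add0r -tauDC; apply: tau_monoC => //.
  rewrite /e addrACA -opprD addrAC addrK.
  have [_ <-] := projQ x.
  rewrite (bigD1 (f x g)) //= (bigD1 (f x h)) 1?eq_sym //= addrA addrAC subrr add0r.
  by apply: psd_sum => a _; case: (Qc x a).
have r1 x : \sum_g \sum_h tau (H g) (H h) (e x g) <= \sum_g tau (H g) (e x g) 1%:M.
  apply: ler_sum => g _; rewrite -tau_sumY (tau12 hsym _ (e x g)).
  by apply: tau_monoY => //; exact: cHs.2.
have r2 x : \sum_g \sum_h tau (H g) (H h) (e x h) <= \sum_g tau (H g) (e x g) 1%:M.
  rewrite exchange_big; apply: ler_sum => h _; rewrite -tau_sumT (tau01 hsym) (tau12 hsym _ (e x h)).
  by apply: tau_monoY => //; exact: cHs.2.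
have r3 : avg (fun x => \sum_g tau (H g) (e x g) 1%:M) <= gp + m.
  apply: le_trans improved_consistent; rewrite avg_sum; apply: ler_sum => g _.
  by rewrite one_sub_expectation_mx tau_avgY.
have p2 g h : 0 <= tau (H g) (H h) 1%:M by apply: tau_ge0.
apply: le_trans (_ : avg (fun x => \sum_g \sum_(h | h != g) (f x g == f x h)%:R * tau (H g) (H h) 1%:M
   + 2 * \sum_g tau (H g) (e x g) 1%:M) <= _).
  rewrite -[leLHS](avg_const _ X0); apply: avg_le => x.
  apply: le_trans (_ : \sum_g \sum_(h | h != g) ((f x g == f x h)%:R * tau (H g) (H h) 1%:M +
    (tau (H g) (H h) (e x g) + tau (H g) (H h) (e x h))) <= _).
    by apply: ler_sum => g _; apply: ler_sum => h _; apply: pt.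
  under [leLHS]eq_bigr => g _ do rewrite big_split.
  rewrite big_split /= lerD2l.
  apply: le_trans (_ : \sum_g \sum_h (tau (H g) (H h) (e x g) + tau (H g) (H h) (e x h)) <= _).
    apply: ler_sum => g _; rewrite [leRHS](bigID (fun h => h != g)) /= lerDl.
    by apply: sumr_ge0 => h _; apply: addr_ge0; apply: tau_ge0.
  under [leLHS]eq_bigr => g _ do rewrite big_split.
  by rewrite big_split /=; have := r1 x; have := r2 x; lra.
rewrite avgD avgZ addrC; apply: lerD; first by have := r3; lra.
rewrite avg_sum; under eq_bigr do rewrite avg_sum.
apply: le_trans (_ : \sum_g \sum_h sig * tau (H g) (H h) 1%:M <= _).
  apply: ler_sum => g _; rewrite [leRHS](bigID (fun h => h != g)) /=.
  rewrite -[leLHS]addr0; apply: lerD; last by apply: sumr_ge0 => h _; apply: mulr_ge0.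
  apply: ler_sum => h hg.
  rewrite (eq_avg (fun x => mulrC _ _)) avgZ mulrC; apply: ler_wpM2r => //.
  by apply: sep; rewrite eq_sym.
under eq_bigr do rewrite -mulr_sumr -tau_sumY.
by rewrite -mulr_sumr -tau_sumT ler_piMr // (tau_le1 hnorm).
Qed.

Lemma improved_selfconsistent :
  tau Hs 1%:M 1%:M - \sum_g tau (H g) (H g) 1%:M <= eta + 6 * m + 3 * gp + sig.
Proof.
have := improved_offdiag; have := improved_almost_proj; rewrite tauBY; lra.
Qed.
End Improved.

(** * Pasting two restrictions *)

Section Paste.
Variables (K : numClosedFieldType) (d : nat) (Psi : state3 K d).
Local Notation R := (realpart K).
Local Notation tau := (tau Psi).
Local Notation psi := (psi Psi).
Hypotheses (hnorm : normalized Psi) (hsym : perm_symmetric Psi).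
Let p1 : psdmx (1%:M : 'M[K]_d). Proof. exact: psd1. Qed.
Let c1 : contr (1%:M : 'M[K]_d). Proof. by split; rewrite ?subrr //; apply: psd0. Qed.

Definition subpovm (G : finType) (T : G -> 'M[K]_d) :=
  (forall g, psdmx (T g)) /\ psdmx (1%:M - \sum_g T g).

Lemma subpovm_contr (G : finType) (T : G -> 'M[K]_d) : subpovm T -> contr (\sum_g T g).
Proof. by case=> pT p1T; split=> //; apply: psd_sum. Qed.

Lemma subpovm_contr1 (G : finType) (T : G -> 'M[K]_d) g : subpovm T -> contr (T g).
Proof. by move=> sT; apply: sub_contr; [exact: sT.1|exact: subpovm_contr]. Qed.

Lemma projmeas_subpovm (I : finType) (B : I -> 'M[K]_d) : projmeas B -> subpovm B.
Proof.
move=> [hB sB]; split=> [a|]; last by rewrite sB subrr; apply: psd0.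
by have [h1 h2] := hB a; apply: proj_psd.
Qed.

Definition selfcons_defect (G : finType) (T : G -> 'M[K]_d) : R :=
  tau (\sum_g T g) 1%:M 1%:M - \sum_g tau (T g) (T g) 1%:M.

Section Swap.
Variable M : 'M[K]_d.
Hypothesis cM : contr M.
Let m0 := app3 M 1%:M 1%:M psi.
Let m1 := app3 1%:M M 1%:M psi.
Let m2 := app3 1%:M 1%:M M psi.
(** For a contraction the right side is at most twice the self-consistency defect of [M]: a
    self-consistent operator, projective or not, can be moved between players. *)
Lemma swap01 : bf 1%:M 1%:M 1%:M (m1 - m0) (m1 - m0) = 2 * (tau (M *m M) 1%:M 1%:M - tau M M 1%:M).
Proof.
rewrite bf_quadB // !tau_vv !(adjmx1, mul1mx, mulmx1, psd_adj cM.1).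
by rewrite (tau01 hsym 1%:M (M *m M)); ring.
Qed.
Lemma swap12 : bf 1%:M 1%:M 1%:M (m2 - m1) (m2 - m1) = 2 * (tau (M *m M) 1%:M 1%:M - tau M M 1%:M).
Proof.
rewrite bf_quadB // !tau_vv !(adjmx1, mul1mx, mulmx1, psd_adj cM.1).
rewrite (tau01 hsym 1%:M (M *m M)) (tau02 hsym 1%:M 1%:M (M *m M)) (tau02 hsym 1%:M M M); ring.
Qed.
Lemma sq_le : tau (M *m M) 1%:M 1%:M <= tau M 1%:M 1%:M.
Proof. by apply: tau_monoT => //; apply: contr_sq. Qed.
Lemma sq_ge : tau M M 1%:M <= tau (M *m M) 1%:M 1%:M.
Proof.
have := bf_ge0 (m1 - m0) p1 p1 p1; rewrite swap01; lra.
Qed.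
End Swap.

Lemma selfcons_defect_swap (G : finType) (T : G -> 'M[K]_d) : subpovm T ->
  \sum_g 2 * (tau (T g *m T g) 1%:M 1%:M - tau (T g) (T g) 1%:M) <= 2 * selfcons_defect T.
Proof.
move=> sT; rewrite -mulr_sumr ler_pM2l ?ltr0n // /selfcons_defect tau_sumT -sumrB.
by apply: ler_sum => g _; rewrite lerD2r; apply/sq_le/subpovm_contr1.
Qed.

Lemma selfcons_defect_sum (G : finType) (T : G -> 'M[K]_d) : subpovm T ->
  tau (\sum_g T g) 1%:M 1%:M - tau (\sum_g T g) (\sum_g T g) 1%:M <= selfcons_defect T.
Proof.
move=> sT; rewrite /selfcons_defect lerD2l lerN2 tau_sumT; apply: ler_sum => g _.
rewrite tau_sumY (bigD1 g) //= lerDl; apply: sumr_ge0 => h _.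
by apply: tau_ge0 => //; exact: sT.1.
Qed.

(** Splits the state by [B (f g)] and its complement at player 0. In the first part all [H g] with
    the same value are pinched below [B a]. In the second the complement is moved to player 1, where
    it meets [H g] as an inconsistency. This brings statements about functions back to the
    measurements that the tests control. *)
Lemma replace_by_proj (G J I : finType) (H : G -> 'M[K]_d) (f : G -> I)
    (B : I -> 'M[K]_d) (Y : J -> 'M[K]_d) (D : I -> J -> 'M[K]_d) :
  subpovm H -> projmeas B -> subpovm Y -> (forall a j, contr (D a j)) ->
  \sum_g \sum_j tau (H g) (Y j) (D (f g) j) <=
  2 * \sum_a \sum_j tau (B a) (Y j) (D a j) +
  8 * (1 - \sum_a tau (B a) (B a) 1%:M) + 4 * \sum_g tau (H g) (1%:M - B (f g)) 1%:M.
Proof.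
move=> sH pB sY cD; have [hB sB] := pB.
have BM a : B a *m B a = B a by case: (hB a).
have Badj a : adjmx (B a) = B a by case: (hB a).
have cB a : contr (B a) by apply: proj_contr.
have B1M a : (1%:M - B a) *m (1%:M - B a) = 1%:M - B a.
  by rewrite mulmxBl !mulmxBr BM !mul1mx mulmx1 subrr subr0.
have B1adj a : adjmx (1%:M - B a) = 1%:M - B a := psd_adj (cB a).2.
have pH := sH.1; have pY := sY.1.
pose v0 a := app3 (B a) 1%:M 1%:M psi.
pose w0 a := app3 (1%:M - B a) 1%:M 1%:M psi.
pose w1 a := app3 1%:M (1%:M - B a) 1%:M psi.
have psiE a : psi = v0 a + w0 a.
  by rewrite /v0 /w0 /app3 appBl addrC subrK !app1.
apply: le_trans (_ : \sum_g (2 * \sum_j tau (B (f g) *m H g *m B (f g)) (Y j) (D (f g) j)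
   + 2 * bf (H g) 1%:M 1%:M (w0 (f g)) (w0 (f g))) <= _).
  apply: ler_sum => g _.
  apply: le_trans (_ : \sum_j (2 * tau (B (f g) *m H g *m B (f g)) (Y j) (D (f g) j) +
      2 * bf (H g) (Y j) 1%:M (w0 (f g)) (w0 (f g))) <= _).
    apply: ler_sum => j _.
    have := bf_add_le (pH g) (pY j) (cD (f g) j).1 (v0 (f g)) (w0 (f g)).
    rewrite -psiE {1}/v0 tau_vv !(adjmx1, mul1mx, mulmx1, Badj) => h; apply: le_trans h _.
    rewrite lerD2l ler_pM2l ?ltr0n // -subr_ge0 -bfBCl.
    by apply: bf_ge0 => //; exact: (cD (f g) j).2.
  rewrite big_split /= -!mulr_sumr lerD2l ler_pM2l ?ltr0n // -bf_sumY -subr_ge0 -bfBYl.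
  by apply: bf_ge0 => //; exact: sY.2.
rewrite big_split /= -!mulr_sumr -addrA; apply: lerD.
  rewrite ler_pM2l ?ltr0n // (partition_big f predT) //=; apply: ler_sum => a _.
  rewrite exchange_big /=; apply: ler_sum => j _.
  rewrite (eq_bigr (fun g => tau (B a *m H g *m B a) (Y j) (D a j))); last first.
    by move=> g /eqP ->.
  rewrite -tau_sumT -mulmx_suml -mulmx_sumr; apply: tau_monoT => //; last exact: (cD a j).1.
  have -> : B a - B a *m (\sum_(g | f g == a) H g) *m B a =
            adjmx (B a) *m (1%:M - \sum_(g | f g == a) H g) *m B a.
    by rewrite Badj mulmxBr mulmxBl mulmx1 BM.
  apply: psd_conj; apply: psd_le_trans sH.2.
  rewrite [X in psdmx (X - _)](bigID (fun g => f g == a)) /= addrAC subrr add0r.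
  exact: psd_sum.
apply: le_trans (_ : 2 * (2 * \sum_g bf (H g) 1%:M 1%:M (w0 (f g) - w1 (f g)) (w0 (f g) - w1 (f g))
   + 2 * \sum_g tau (H g) (1%:M - B (f g)) 1%:M) <= _).
  rewrite ler_pM2l ?ltr0n // !mulr_sumr -big_split /=; apply: ler_sum => g _.
  apply: le_trans (bf_le_sub (pH g) p1 p1 _ (w1 (f g))) _.
  by rewrite lerD2l /w1 tau_vv !(adjmx1, mul1mx, mulmx1, B1adj, B1M).
have := sum_bf_group f (fun a => w0 a - w1 a) pH sH.2.
have e a : bf 1%:M 1%:M 1%:M (w0 a - w1 a) (w0 a - w1 a) =
    tau (B a) 1%:M 1%:M - 2 * tau (B a) (B a) 1%:M + tau 1%:M (B a) 1%:M.
  rewrite bf_quadB // !tau_vv !(adjmx1, mul1mx, mulmx1, B1adj, B1M).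
  rewrite !(tauBT, tauBY) (tau111 hnorm); ring.
under [X in _ <= X]eq_bigr do rewrite e.
rewrite big_split sumrB /= -mulr_sumr -tau_sumT -tau_sumY sB (tau111 hnorm).
move: (\sum_g _) (\sum_g _) (\sum_a _) => x y z.
suff arith (a b c : R) : a <= 1 - 2 * c + 1 -> 2 * (2 * a + 2 * b) <= 8 * (1 - c) + 4 * b.
  by apply: arith.
lra.
Qed.

Section Sandwich.
Variables (G G' : finType) (H1 H2 : G -> 'M[K]_d) (E : G' -> 'M[K]_d) (q : G -> G -> G').
Variables (C Zh : 'M[K]_d).
Hypotheses (sH1 : subpovm H1) (sH2 : subpovm H2) (cE : forall g, contr (E g)).
Hypotheses (pC : psdmx C) (C2 : psdmx (rval (2%:R : R) *: 1%:M - C)).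
Hypotheses (pZ : psdmx Zh) (domZ : forall g, psdmx (Zh - E g)).
Let W g h := H1 g *m H2 h *m H1 g.
Let pH1 := sH1.1.
Let pH2 := sH2.1.
Let pE1 g : psdmx (1%:M - E g). Proof. exact: (cE g).2. Qed.
Let pE g : psdmx (E g). Proof. exact: (cE g).1. Qed.
Local Notation S1 := (\sum_g H1 g).
Local Notation S2 := (\sum_g H2 g).
Let err := \sum_g \sum_h tau (H1 g) (H2 h) (1%:M - E (q g h)).

Let pW g h : psdmx (W g h).
Proof. by have := psd_conj (H1 g) (pH2 h); rewrite (psd_adj (pH1 g)). Qed.

Let W_le1 : psdmx (1%:M - \sum_g \sum_h W g h).
Proof.
apply: (psd_le_trans (N := \sum_g H1 g)); last exact: sH1.2.
rewrite -sumrB; apply: psd_sum => g _.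
apply: (psd_le_trans (N := H1 g *m H1 g)); last exact/contr_sq/subpovm_contr1.
rewrite -mulmx_suml -mulmx_sumr.
by have := psd_conj (H1 g) sH2.2; rewrite (psd_adj (pH1 g)) mulmxBr mulmxBl mulmx1.
Qed.

Lemma tauC2 Y X : psdmx Y -> psdmx X -> tau C Y X <= 2 * tau 1%:M Y X.
Proof.
move=> pY pX; have := tau_ge0 Psi C2 pY pX; rewrite tauBT {1}/tau bfZT.
by rewrite subr_ge0.
Qed.

Lemma sandwich_agree : \sum_g \sum_h tau C (W g h) (E (q g h)) <= tau C 1%:M Zh.
Proof.
apply: le_trans (_ : \sum_g \sum_h tau C (W g h) Zh <= _).
  by do 2![apply: ler_sum => ? _]; apply: tau_monoC.
under eq_bigr do rewrite -tau_sumY.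
by rewrite -tau_sumY; apply: tau_monoY.
Qed.

(** Moving the outer factors [H1 g] of the sandwich from player 1 to player 0 turns them into the
    square of [H1 g], which is at most [H1 g]; the remaining sum is [err]. *)
Lemma sandwich_disagree :
  \sum_g \sum_h tau 1%:M (W g h) (1%:M - E (q g h)) <= 4 * selfcons_defect H1 + 2 * err.
Proof.
pose u g := app3 1%:M (H1 g) 1%:M psi; pose v g := app3 (H1 g) 1%:M 1%:M psi.
apply: le_trans (_ : \sum_g (2 * bf 1%:M 1%:M 1%:M (u g - v g) (u g - v g) +
    2 * \sum_h tau (H1 g) (H2 h) (1%:M - E (q g h))) <= _).
  apply: ler_sum => g _.
  apply: le_trans (_ : \sum_h (2 * bf 1%:M (H2 h) 1%:M (u g - v g) (u g - v g) +
     2 * tau (H1 g) (H2 h) (1%:M - E (q g h))) <= _).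
    apply: ler_sum => h _.
    have -> : tau 1%:M (W g h) (1%:M - E (q g h)) = bf 1%:M (H2 h) (1%:M - E (q g h)) (u g) (u g).
      by rewrite tau_vv !(adjmx1, mul1mx, mulmx1, psd_adj (pH1 g)).
    apply: le_trans (bf_le_sub p1 (pH2 h) (pE1 _) _ (v g)) _; apply: lerD.
      rewrite ler_pM2l ?ltr0n // -subr_ge0 -bfBCl; apply: bf_ge0 => //.
      by rewrite subKr.
    rewrite ler_pM2l ?ltr0n // tau_vv !(adjmx1, mul1mx, mulmx1, psd_adj (pH1 g)).
    by apply: tau_monoT => //; apply/contr_sq/subpovm_contr1.
  rewrite big_split /= -!mulr_sumr lerD2r ler_pM2l ?ltr0n // -bf_sumY -subr_ge0 -bfBYl.
  by apply: bf_ge0 => //; exact: sH2.2.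
rewrite big_split /= -!mulr_sumr lerD2r.
have -> : \sum_g bf 1%:M 1%:M 1%:M (u g - v g) (u g - v g) =
    \sum_g 2 * (tau (H1 g *m H1 g) 1%:M 1%:M - tau (H1 g) (H1 g) 1%:M).
  by apply: eq_bigr => g _; apply/swap01/subpovm_contr1.
by have := selfcons_defect_swap sH1; lra.
Qed.

(** Beside [C] and [S2], replace [H1 g] by its square ([rest]) and move both factors from player 2
    to player 1, where they enclose [H2 h] ([sq]). The total weight of the sandwiches is split by
    whether the third player agrees with [q g h] ([W1]); agreement is dominated by [Zh]. The
    coefficient 26 is 16 + 8 + 2 from [W1], [sq] and [rest]. *)
Lemma sandwich_completeness :
  tau C S2 S1 <= 2 * tau C 1%:M Zh + 26 * selfcons_defect H1 + 8 * err.
Proof.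
pose y g := app3 1%:M (H1 g) 1%:M psi; pose z g := app3 1%:M 1%:M (H1 g) psi.
have pS2 : psdmx S2 by apply: psd_sum.
have W1 : \sum_g \sum_h tau C (W g h) 1%:M <= tau C 1%:M Zh + 2 * (4 * selfcons_defect H1 + 2 * err).
  apply: le_trans (_ : \sum_g \sum_h (tau C (W g h) (E (q g h)) +
      2 * tau 1%:M (W g h) (1%:M - E (q g h))) <= _).
    apply: ler_sum => i _; apply: ler_sum => j _; have := tauC2 (pW i j) (pE1 (q i j)).
    by rewrite tauBC; lra.
  under eq_bigr do rewrite big_split -mulr_sumr.
  rewrite big_split /= -mulr_sumr; apply: lerD; first exact: sandwich_agree.
  by rewrite ler_pM2l ?ltr0n //; apply: sandwich_disagree.
have sq g : tau C S2 (H1 g *m H1 g) <= 2 * \sum_h tau C (W g h) 1%:M +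
     4 * bf 1%:M 1%:M 1%:M (z g - y g) (z g - y g).
  have -> : tau C S2 (H1 g *m H1 g) = bf C S2 1%:M (z g) (z g).
    by rewrite tau_vv !(adjmx1, mul1mx, mulmx1, psd_adj (pH1 g)).
  apply: le_trans (bf_le_sub pC pS2 p1 _ (y g)) _; rewrite addrC; apply: lerD.
    rewrite ler_pM2l ?ltr0n // tau_vv !(adjmx1, mul1mx, mulmx1, psd_adj (pH1 g)).
    by rewrite -tau_sumY -mulmx_suml -mulmx_sumr.
  have -> : (4 : R) = 2 * 2 by ring.
  rewrite -mulrA ler_pM2l ?ltr0n //.
  apply: le_trans (_ : 2 * bf 1%:M S2 1%:M (z g - y g) (z g - y g) <= _).
    have := bf_ge0 (z g - y g) C2 pS2 p1; rewrite bfBTl bfZT; lra.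
  rewrite ler_pM2l ?ltr0n // -subr_ge0 -bfBYl; apply: bf_ge0 => //; exact: sH2.2.
have rest g : tau C S2 (H1 g) <= tau C S2 (H1 g *m H1 g) +
    2 * (tau (H1 g) 1%:M 1%:M - tau (H1 g) (H1 g) 1%:M).
  have cg : contr (H1 g) by apply: subpovm_contr1.
  have pg := contr_sq cg.
  have h1 := tauC2 pS2 pg.
  have h2 : tau 1%:M S2 (H1 g - H1 g *m H1 g) <= tau 1%:M 1%:M (H1 g - H1 g *m H1 g).
    by apply: tau_monoY => //; exact: sH2.2.
  have h3 := sq_ge cg.
  move: h1 h2 h3; rewrite !tauBC (tau02 hsym 1%:M 1%:M (H1 g)) (tau02 hsym 1%:M 1%:M (_ *m _)).
  lra.
rewrite tau_sumC.
apply: le_trans (_ : \sum_g (2 * \sum_h tau C (W g h) 1%:M +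
     4 * bf 1%:M 1%:M 1%:M (z g - y g) (z g - y g) +
     2 * (tau (H1 g) 1%:M 1%:M - tau (H1 g) (H1 g) 1%:M)) <= _).
  by apply: ler_sum => g _; have := sq g; have := rest g; lra.
rewrite !big_split /= -!mulr_sumr sumrB -tau_sumT -/(selfcons_defect H1).
have -> : \sum_g bf 1%:M 1%:M 1%:M (z g - y g) (z g - y g) =
    \sum_g 2 * (tau (H1 g *m H1 g) 1%:M 1%:M - tau (H1 g) (H1 g) 1%:M).
  by apply: eq_bigr => g _; apply/swap12/subpovm_contr1.
have := selfcons_defect_swap sH1; move: W1.
suff arith (a b c e f : R) : a <= f + 2 * (4 * c + 2 * e) -> b <= 2 * c ->
   2 * a + 4 * b + 2 * c <= 2 * f + 26 * c + 8 * e by apply: arith.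
lra.
Qed.
End Sandwich.
End Paste.

(** * Completeness of an average of restrictions *)

Lemma bf_bigsum_le (K : numClosedFieldType) d (T Y C : 'M[K]_d) (I : finType) (v : I -> vec K d) :
  psdmx T -> psdmx Y -> psdmx C ->
  bf T Y C (\sum_i v i) (\sum_i v i) <= #|I|%:R * \sum_i bf T Y C (v i) (v i).
Proof.
move=> pT pY pC; pose q i := bf T Y C (v i) (v i).
have -> : bf T Y C (\sum_i v i) (\sum_i v i) = \sum_i \sum_j bf T Y C (v i) (v j).
  rewrite raddf_sum exchange_big; apply: eq_bigr => j _.
  by rewrite /= bfC // raddf_sum; apply: eq_bigr => i _; rewrite /= bfC.
apply: le_trans (_ : \sum_i \sum_j (2^-1 * q i + 2^-1 * q j) <= _).
  apply: ler_sum => i _; apply: ler_sum => j _; rewrite /q.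
  have := bf_amgm pT pY pC (v i) (v j) ltr01; rewrite invr1 !mul1r; lra.
under eq_bigr do rewrite big_split sumr_const /= -mulr_sumr -[_ *+ _]mulr_natl.
rewrite big_split /= sumr_const -!mulr_sumr -/q -[X in _ + X]mulr_natl.
rewrite -[X in _ <= _ * X]/(\sum_i q i).
move: (\sum_i q i) (#|I|%:R) => a b.
suff arith (x y : realpart K) : y * (2^-1 * x) + y * (2^-1 * x) <= y * x by apply: arith.
lra.
Qed.

Section Completeness.
Variables (K : numClosedFieldType) (d : nat) (Psi : state3 K d).
Local Notation R := (realpart K).
Local Notation tau := (tau Psi).
Local Notation psi := (psi Psi).
Hypotheses (hnorm : normalized Psi) (hsym : perm_symmetric Psi).
Let p1 : psdmx (1%:M : 'M[K]_d). Proof. exact: psd1. Qed.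

Variables (X : finType) (H : X -> 'M[K]_d) (C : 'M[K]_d) (sc : X -> R).
Hypotheses (X0 : (0 < #|X|)%N) (cH : forall x, contr (H x)).
Hypotheses (pC : psdmx C) (C2 : psdmx (rval (2%:R : R) *: 1%:M - C)).
Hypothesis hsc : forall x, tau (H x) 1%:M 1%:M - tau (H x) (H x) 1%:M <= sc x.
Local Notation G := (mxavg H).

(** [p] and [q] both have squared norm <C (x) G^2 (x) 1>, and their inner product is <C (x) G (x)
    G>. So the difference of the two expectations is half a squared distance, which convexity bounds
    by the cost of moving the individual [H x]. *)
Lemma avg_square : tau C (G *m G) 1%:M <= tau C G G + 2 * avg sc.
Proof.
have cG : contr G by apply: mxavg_contr.
pose p := app3 1%:M G 1%:M psi; pose q := app3 1%:M 1%:M G psi.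
pose v x := app3 1%:M 1%:M (H x) psi - app3 1%:M (H x) 1%:M psi.
have hp : bf C 1%:M 1%:M p p = tau C (G *m G) 1%:M.
  by rewrite tau_vv !(adjmx1, mul1mx, mulmx1, psd_adj cG.1).
have hq : bf C 1%:M 1%:M q q = tau C (G *m G) 1%:M.
  by rewrite tau_vv !(adjmx1, mul1mx, mulmx1, psd_adj cG.1) (tau12 hsym).
have hpq : bf C 1%:M 1%:M q p = tau C G G.
  by rewrite tau_vv !(adjmx1, mul1mx, mulmx1, psd_adj cG.1).
have hd : bf C 1%:M 1%:M (q - p) (q - p) <= 4 * avg sc.
  apply: le_trans (_ : 2 * bf 1%:M 1%:M 1%:M (q - p) (q - p) <= _).
    have := bf_ge0 (q - p) C2 p1 p1; rewrite bfBTl bfZT; lra.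
  have -> : q - p = rval (#|X|%:R^-1 : R) *: \sum_x v x.
    rewrite sumrB scalerBr !scaler_sumr; congr (_ - _).
      by rewrite /q /app3 !app1 appZ app_suml scaler_sumr; apply: eq_bigr => x _; rewrite !app1.
    by rewrite /p /app3 !app1 appZ app_suml scaler_sumr; apply: eq_bigr => x _; rewrite !app1.
  rewrite bfZr bfC // bfZr.
  have -> : (4 : R) = 2 * 2 by ring.
  rewrite -mulrA ler_pM2l ?ltr0n //.
  have n0 : (0 : R) < #|X|%:R by rewrite ltr0n.
  have i0 : (0 : R) <= #|X|%:R^-1 by rewrite invr_ge0 ltW.
  apply: le_trans (ler_wpM2l i0 (ler_wpM2l i0 (bf_bigsum_le v p1 p1 p1))) _.
  rewrite [_^-1 * (#|X|%:R * _)]mulKf ?gt_eqF // -/(avg _) -avgZ; apply: avg_le => x.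
  rewrite /v (swap12 hsym (cH x)) ler_pM2l ?ltr0n //.
  by have := hsc x; have := sq_le Psi (cH x); lra.
move: hd; rewrite bf_quadB // hp hq hpq; lra.
Qed.

(** With [s = 2 n + 1] the difference of the two sides is half the expectation of [(2 - s G)^2]
    beside [C]. This [s] gives the growth factor [2 s / (4 n) = 1 + 1 / (2 n)]. *)
Lemma completeness_step (n : nat) : (0 < n)%N ->
  4 * n%:R * tau C 1%:M 1%:M <= (2 * n%:R + 1) *
    (2 * tau C (1%:M - G) 1%:M + 2^-1 * (2 * n%:R + 1) * tau C (G *m G) 1%:M).
Proof.
move=> n0; have cG : contr G by apply: mxavg_contr.
have psiE : psi = app3 1%:M 1%:M 1%:M psi by rewrite app3_111.
pose p := app3 1%:M G 1%:M psi.
have hp : bf C 1%:M 1%:M p p = tau C (G *m G) 1%:M.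
  by rewrite tau_vv !(adjmx1, mul1mx, mulmx1, psd_adj cG.1).
have hx : bf C 1%:M 1%:M psi p = tau C G 1%:M.
  by rewrite [X in bf _ _ _ X]psiE tau_vv !(adjmx1, mul1mx, mulmx1).
have N0 : (0 : R) < 2 * n%:R + 1 by rewrite ltr_wpDl // mulr_ge0.
have r0 : (0 : R) < 2 / (2 * n%:R + 1) by rewrite divr_gt0.
have := bf_amgm pC p1 p1 psi p r0; rewrite hp hx invf_div -/(tau _ _ _) => h.
suff arith (a b c s : R) : 0 < s -> 2 * b <= 2 / s * a + s / 2 * c ->
    2 * (s - 1) * a <= s * (2 * (a - b) + 2^-1 * s * c).
  have -> : 4 * n%:R = 2 * (2 * n%:R + 1 - 1) :> R by ring.
  by rewrite tauBY; apply: arith N0 h.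
move=> s0 /(ler_wpM2l (ltW s0)).
have -> : s * (2 / s * a + s / 2 * c) = 2 * a + 2^-1 * s * s * c by field; rewrite gt_eqF.
lra.
Qed.
End Completeness.

Section ErrLine.
Variables (K : numClosedFieldType) (d : nat) (Psi : state3 K d).
Local Notation R := (realpart K).
Local Notation tau := (tau Psi).
Hypotheses (hnorm : normalized Psi) (hsym : perm_symmetric Psi).
Variables (G I : finType) (H1 H2 : G -> 'M[K]_d) (fa fb : G -> I).
Variables (B1 B2 B3 : I -> 'M[K]_d) (l : I -> I -> I).
Hypotheses (sH1 : subpovm H1) (sH2 : subpovm H2).
Hypotheses (pB1 : projmeas B1) (pB2 : projmeas B2) (pB3 : projmeas B3).

(** Two uses of [replace_by_proj], first for [H1] and then for [H2], leave a question about
    projective measurements at three points of a line. *)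
Lemma err_line :
  \sum_g \sum_h tau (H1 g) (H2 h) (1%:M - B3 (l (fa g) (fb h))) <=
  4 * \sum_a \sum_b tau (B1 a) (B2 b) (1%:M - B3 (l a b)) +
  16 * (1 - \sum_b tau (B2 b) (B2 b) 1%:M) + 8 * \sum_h tau (H2 h) (1%:M - B2 (fb h)) 1%:M +
  8 * (1 - \sum_a tau (B1 a) (B1 a) 1%:M) + 4 * \sum_g tau (H1 g) (1%:M - B1 (fa g)) 1%:M.
Proof.
have cB3 a : contr (1%:M - B3 a).
  by apply/contrC/subpovm_contr1/projmeas_subpovm.
have h1 := replace_by_proj hnorm fa (D := fun a h => 1%:M - B3 (l a (fb h)))
  sH1 pB1 sH2 (fun a h => cB3 _).
have h2 := replace_by_proj hnorm fb (D := fun b a => 1%:M - B3 (l a b))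
  sH2 pB2 (projmeas_subpovm pB1) (fun a h => cB3 _).
apply: le_trans h1 _.
have e1 : \sum_a \sum_j tau (B1 a) (H2 j) (1%:M - B3 (l a (fb j))) =
   \sum_j \sum_a tau (H2 j) (B1 a) (1%:M - B3 (l a (fb j))).
  by rewrite exchange_big; do 2![apply: eq_bigr => ? _]; rewrite (tau01 hsym).
have e2 : \sum_a \sum_b tau (B1 a) (B2 b) (1%:M - B3 (l a b)) =
   \sum_b \sum_a tau (B2 b) (B1 a) (1%:M - B3 (l a b)).
  by rewrite exchange_big; do 2![apply: eq_bigr => ? _]; rewrite (tau01 hsym).
rewrite e1 e2; move: h2; lra.
Qed.
End ErrLine.

(** * Induction on the number of free coordinates *)

Section Levels.
Variables (K : numClosedFieldType) (d : nat) (Psi : state3 K d).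
Local Notation R := (realpart K).
Local Notation tau := (tau Psi).
Hypotheses (hnorm : normalized Psi) (hsym : perm_symmetric Psi).
Variables (F : finFieldType) (n : nat).
Local Notation pt := (point F n).
Local Notation ML := (@ML F n).
Variable A : pt -> F -> 'M[K]_d.
Hypothesis projA : forall x, projmeas (A x).
Local Notation point_defect := (point_defect Psi A).
Local Notation axis_defect := (axis_defect Psi A).
Let p1 : psdmx (1%:M : 'M[K]_d). Proof. exact: psd1. Qed.
Let X0 : (0 < #|{: pt}|)%N. Proof. exact: card_pt_gt0. Qed.
Let F0 : (0 < #|F|)%N. Proof. exact: card_F_gt0. Qed.

(** Level [k] with tail [s] as an instance of the self-improvement setting. The index [x] runs over
    all points, so that the index type is the same at every level. *)
Definition lv_meas k (s : pt) x := A (mix k x s).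
Definition lv_value k (s : pt) x (g : ML k) := val g (mix k x s).
Definition lv_score k s := expectation_mx (lv_meas k s) (@lv_value k s).
Definition lv_improved k (T : pt -> ML k -> 'M[K]_d) s := improved (lv_meas k s) (@lv_value k s) (T s).
Definition lv_bound k (T : pt -> ML k -> 'M[K]_d) s := Zmx (@lv_score k s) (T s).
Definition constML k a : ML k := exist _ [ffun=> a] (mlk_cst n k a).

(** The slack allowed in the optimality of [T]. Errors of size [1 / #|F|] occur anyway, from
    degenerate triples and Schwartz-Zippel. *)
Let eta : R := #|F|%:R^-1.
Let eta0 : 0 <= eta. Proof. by rewrite invr_ge0 ler0n. Qed.
Let eta1 : eta <= 1. Proof. by rewrite invf_le1 ?ltr0n // ler1n. Qed.

Definition good k (T : pt -> ML k -> 'M[K]_d) := forall s,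
  povm (T s) /\ forall g, psdmx (lv_bound T s + rval eta *: 1%:M - @lv_score k s g).

Lemma good_exists k : exists T : pt -> ML k -> 'M[K]_d, good T.
Proof.
suff /fin_all_exists[T hT] (s : pt) : exists T : ML k -> 'M[K]_d, povm T /\
    forall g, psdmx (Zmx (@lv_score k s) T + rval eta *: 1%:M - @lv_score k s g) by exists T.
have cA g : contr (@lv_score k s g) by apply: expectation_mx_contr => // x; apply: projA.
by have [T pT hT] := near_optimal_povm (constML k 0) cA F0; exists T.
Qed.

Variables (del L c : R).
Hypotheses (del0 : 0 < del) (hL : forall j, avg (axis_defect j) <= L) (hc : avg point_defect <= c).
Hypothesis n0 : (0 < n)%N.

Definition edge_err : R := 12 * L + 16 * c + 5 * eta.
Definition gap_err : R := 2 * n%:R * (n%:R * (4 * edge_err + 4 * c)) + 4 * c.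
Definition move_err : R := c / del + 2 * del.
Definition cons_err : R := gap_err + move_err.
Definition self_err : R := eta + 6 * move_err + 3 * gap_err + n%:R * eta.
Definition bound_err : R := eta + 3 * move_err + gap_err.

Lemma point_defect_ge0 z : 0 <= point_defect z.
Proof.
have := cons_defect_ge0 hnorm (fun t => projA (upd z (Ordinal n0) t)) (z (Ordinal n0)).
by rewrite /cons_defect upd_same.
Qed.

Lemma c_ge0 : 0 <= c.
Proof. by apply: le_trans hc; apply: avg_ge0; apply: point_defect_ge0. Qed.

Lemma axis_defect_ge0 j z : 0 <= axis_defect j z.
Proof.
apply: avg_ge0 => q; case: ifP => // /and3P[h _ _].
exact: (lin_defect_ge0 hnorm (fun t => projA (upd z j t))).
Qed.

Lemma L_ge0 : 0 <= L.
Proof. by apply: le_trans (hL (Ordinal n0)); apply: avg_ge0 => z; apply: axis_defect_ge0. Qed.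

Lemma edge_err_ge0 : 0 <= edge_err.
Proof. by rewrite /edge_err !addr_ge0 ?mulr_ge0 ?L_ge0 ?c_ge0. Qed.

Section Level.
Variables (k : nat) (T : pt -> ML k -> 'M[K]_d).
Hypotheses (kn : (k <= n)%N) (gT : good T).
Local Notation H := (lv_improved T).
Local Notation Z := (lv_bound T).

Lemma lv_projmeas s x : projmeas (lv_meas k s x). Proof. exact: projA. Qed.
Lemma lv_improved_psd s g : psdmx (H s g).
Proof. exact: (improved_psd _ (lv_projmeas s) (gT s).1). Qed.
Lemma lv_improved_contr s : contr (\sum_g H s g).
Proof. exact: (improved_contr _ X0 (lv_projmeas s) (gT s).1). Qed.
Lemma lv_improved_subpovm s : subpovm (H s).
Proof. by split=> [g|]; [apply: lv_improved_psd|exact: (lv_improved_contr s).2]. Qed.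
Lemma lv_bound_le1 s : psdmx (1%:M - Z s).
Proof. exact: (Zmx_le1 _ X0 (lv_projmeas s) (gT s).1). Qed.
Lemma lv_bound_shift_psd s : psdmx (Z s + rval eta *: 1%:M).
Proof. exact: (Zmx_shift_psd (constML k 0) X0 (lv_projmeas s) (gT s).2). Qed.

Let ms s : R := avg (pvm_defect Psi (lv_meas k s)) / del + 2 * del.
Let gs s : R := pvm_gap Psi (lv_meas k s) (@lv_value k s) (T s).

Lemma avg_ms : avg ms <= move_err.
Proof.
rewrite /ms /move_err avgD avg_const // lerD2r.
rewrite (eq_avg (fun s => mulrC _ _)) avgZ mulrC ler_pM2r ?invr_gt0 //.
by rewrite avg_exchange (avg_mix k point_defect).
Qed.

Lemma avg_gs : avg gs <= gap_err.
Proof.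
have h := gap_le hnorm hsym projA hL hc kn (fun s => (gT s).1.1).
have pT s : psdmx (1%:M - \sum_g T s g) by rewrite (gT s).1.2 subrr; apply: psd0.
apply: le_trans (h pT) _; rewrite /gap_err lerD2r -/edge_err.
have kn' : (k%:R : R) <= n%:R by rewrite ler_nat.
have k0 : (0 : R) <= k%:R by [].
have e0 : 0 <= 4 * edge_err + 4 * c.
  by rewrite addr_ge0 // mulr_ge0 // ?edge_err_ge0 ?c_ge0.
rewrite /edge_err in e0 *.
apply: ler_pM; rewrite ?mulr_ge0 // ?ler_pM2l ?ltr0n //.
by apply: ler_wpM2r.
Qed.

Lemma avg_consistent :
  avg (fun s => \sum_g tau (H s g) (1%:M - @lv_score k s g) 1%:M) <= cons_err.
Proof.
apply: le_trans (_ : avg (fun s => gs s + ms s) <= _).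
  apply: avg_le => s.
  exact: (improved_consistent hnorm hsym _ X0 (lv_projmeas s) (gT s).1 del0).
by rewrite avgD lerD ?avg_gs ?avg_ms.
Qed.

Lemma avg_scdef : avg (fun s => selfcons_defect Psi (H s)) <= self_err.
Proof.
apply: le_trans (_ : avg (fun s => eta + 6 * ms s + 3 * gs s + n%:R * eta) <= _).
  apply: avg_le => s.
  have h := improved_selfconsistent hnorm hsym (constML k 0) X0 (lv_projmeas s) (gT s).1 del0
    eta1 (gT s).2 (sig := n%:R * eta).
  apply: h.
    move=> g h gh; apply: le_trans (_ : k%:R / #|F|%:R <= _).
      rewrite (eq_avg (g := fun x => (val g x == val h x)%:R)).
        by apply: schwartz_zippel kn; [exact: valP|exact: valP|].
      by move=> x; rewrite /lv_value (mlk_mix _ _ (valP g)) (mlk_mix _ _ (valP h)).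
    by rewrite ler_wpM2r // ler_nat.
  by rewrite mulr_ge0.
rewrite 3!avgD 2!avgZ !avg_const //.
by have := avg_ms; have := avg_gs; rewrite /self_err; lra.
Qed.

Lemma avg_Zbound :
  avg (fun s => tau (1%:M - Z s) (Z s + rval eta *: 1%:M) 1%:M) <= bound_err.
Proof.
apply: le_trans (_ : avg (fun s => eta + 3 * ms s + gs s) <= _).
  apply: avg_le => s.
  exact: (Zmx_bounded hnorm hsym (constML k 0) X0 (lv_projmeas s) (gT s).1 del0 eta1 (gT s).2).
rewrite 2!avgD avgZ !avg_const //.
by have := avg_ms; have := avg_gs; rewrite /bound_err; lra.
Qed.

Lemma avg_ZH : avg (fun s => tau (Z s) 1%:M 1%:M - tau (\sum_g H s g) 1%:M 1%:M) <= 2 * move_err.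
Proof.
apply: le_trans (_ : avg (fun s => 2 * ms s) <= _).
  apply: avg_le => s.
  exact: (Zmx_sub_improved hnorm hsym _ X0 (lv_projmeas s) (gT s).1 del0).
by rewrite avgZ ler_pM2l ?ltr0n ?avg_ms.
Qed.

Definition kappa : R := avg (fun s => 1 - tau (Z s) 1%:M 1%:M).

Lemma avg_incomplete : avg (fun s => 1 - tau (\sum_g H s g) 1%:M 1%:M) <= kappa + 2 * move_err.
Proof.
apply: le_trans (_ : kappa + avg (fun s => tau (Z s) 1%:M 1%:M - tau (\sum_g H s g) 1%:M 1%:M) <= _).
  by rewrite /kappa -avgD; apply: avg_le => s; rewrite subrKA.
by rewrite lerD2l avg_ZH.
Qed.
End Level.

(** At level 0 the constant functions already give back the operators [A s a], each below [Z + eta].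
    Hence the completeness of [Z] is at least the probability that two players agree at [s], up to
    [eta]. *)
Lemma kappa0 (T : pt -> ML 0 -> 'M[K]_d) : good T -> kappa T <= c + eta.
Proof.
move=> gT; apply: le_trans (_ : avg (fun s => point_defect s + eta) <= _); last first.
  by rewrite avgD avg_const // lerD2r.
apply: avg_le => s.
have e a : @lv_score 0 s (constML 0 a) = A s a.
  rewrite /lv_score /expectation_mx -[RHS](mxavg_const X0); congr (_ *: _).
  by apply: eq_bigr => x _; rewrite /lv_meas /lv_value mix0 ffunE.
have : \sum_a tau (A s a) (A s a) 1%:M <= tau 1%:M (lv_bound T s + rval eta *: 1%:M) 1%:M.
  rewrite -{2}(Asum projA s) tau_sumT; apply: ler_sum => a _.
  by apply: tau_monoY => //; [rewrite -e; exact: (gT s).2|exact: Apsd].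
rewrite (tau01 hsym) tauDT {3}/tau bfZT -/(tau _ _ _) (tau111 hnorm) mulr1 /point_defect; lra.
Qed.
End Levels.

Lemma pair_arith (R : realFieldType) (a1 a2 a3 a4 a5 b1 b2 b3 b4 b5 : R) :
  a5 <= b5 -> a4 <= b4 -> a2 <= b2 -> a1 <= b1 -> a3 <= b3 ->
  2 * a1 + 26 * a2 + 8 * (4 * a5 + 16 * a3 + 8 * a4 + 8 * a3 + 4 * a4) <=
  2 * b1 + 26 * b2 + 8 * (4 * b5 + 16 * b3 + 8 * b4 + 8 * b3 + 4 * b4).
Proof. lra. Qed.

Section Step.
Variables (K : numClosedFieldType) (d : nat) (Psi : state3 K d).
Local Notation R := (realpart K).
Local Notation tau := (tau Psi).
Hypotheses (hnorm : normalized Psi) (hsym : perm_symmetric Psi).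
Variables (F : finFieldType) (n : nat).
Local Notation pt := (point F n).
Local Notation ML := (@ML F n).
Variable A : pt -> F -> 'M[K]_d.
Hypothesis projA : forall x, projmeas (A x).
Local Notation point_defect := (point_defect Psi A).
Local Notation eta := (#|F|%:R^-1 : R).
Let p1 : psdmx (1%:M : 'M[K]_d). Proof. exact: psd1. Qed.
Let X0 : (0 < #|{: pt}|)%N. Proof. exact: card_pt_gt0. Qed.
Let F0 : (0 < #|F|)%N. Proof. exact: card_F_gt0. Qed.
Let eta0 : 0 <= eta. Proof. by rewrite invr_ge0 ler0n. Qed.
Let eta1 : eta <= 1. Proof. by rewrite invf_le1 ?ltr0n // ler1n. Qed.

Variables (k : 'I_n) (T : pt -> ML k -> 'M[K]_d) (T' : pt -> ML k.+1 -> 'M[K]_d).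
Hypotheses (gT : good A T) (gT' : good A T').
Local Notation H := (lv_improved A T).
Local Notation Z' := (lv_bound A T').
Local Notation Hs s := (\sum_g H s g).

(** For [u = w] there is nothing to interpolate, and the constant 0 is a junk value; [line_err] is 1
    there. *)
Definition interpML (u w : F) (g h : ML k) : ML k.+1 :=
  insubd (constML n k.+1 (0 : F)) (if u != w then interp k u w (val g) (val h) else [ffun=> 0]).

Lemma interpMLE u w g h : val (interpML u w g h) =
  if u != w then interp k u w (val g) (val h) else [ffun=> 0].
Proof.
rewrite /interpML val_insubd ifT //; case: ifP => uw; last exact: mlk_cst.
by apply: mlk_interp => //; apply: valP.
Qed.

Definition score_err s y : R := \sum_g tau (H s g) (1%:M - lv_meas A k s y (lv_value s y g)) 1%:M.
(** On degenerate triples, where the linearity test says nothing, the trivial bound 1 is charged. *)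
Definition line_err s w u (y : pt) : R :=
  if dist3 u w (y k) then lin_defect Psi (fun t => A (upd (mix k.+1 y s) k t)) u w (y k) else 1.

Lemma avg_pt_err s : avg (score_err s) = \sum_g tau (H s g) (1%:M - @lv_score _ _ _ _ A k s g) 1%:M.
Proof.
rewrite /score_err avg_sum; apply: eq_bigr => g _.
by rewrite /lv_score (one_sub_expectation_mx (lv_meas A k s)) // tau_avgY.
Qed.

Let C s := 1%:M - Z' s.
Let pC s : psdmx (C s). Proof. exact: (lv_bound_le1 projA gT' s). Qed.
Let pZh s : psdmx (Z' s + rval eta *: 1%:M). Proof. exact: (lv_bound_shift_psd projA gT' s). Qed.

(** [Z'] itself is not known to be positive, only [Z' + eta] is; so [C] is bounded by [1 + eta]
    instead of 1. *)
Let C_eta s : psdmx (rval (1 + eta) *: 1%:M - C s).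
Proof.
suff -> : rval (1 + eta) *: 1%:M - C s = Z' s + rval eta *: 1%:M by [].
rewrite -[rval (1 + eta)]/(1 + rval eta) scalerDl scale1r /C opprB addrC.
by rewrite addrA subrK.
Qed.

Let C2 s : psdmx (rval (2%:R : R) *: 1%:M - C s).
Proof.
have -> : rval (2%:R : R) *: 1%:M - C s =
   (rval (1 + eta) *: 1%:M - C s) + rval (1 - eta) *: 1%:M.
  rewrite addrAC -scalerDl; congr (_ *: _ - _).
  by rewrite -[RHS]/(rval (1 + eta + (1 - eta))); congr rval; ring.
apply: psdD (C_eta s) (psdZ _ p1).
by rewrite -[0]/(rval 0) rval_le subr_ge0.
Qed.

(** The restrictions at [u] and [w] form the sandwich, and interpolation along axis [k] supplies
    functions of level [k.+1]. Its failure at [y] reduces by [err_line] to the linearity test at the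
    values [u], [w] and [y k] on that axis. *)
Lemma pair_bound s w u :
  tau (C s) (Hs (upd s k w)) (Hs (upd s k u)) <=
  2 * tau (C s) 1%:M (Z' s + rval eta *: 1%:M) + 26 * selfcons_defect Psi (H (upd s k u)) +
  8 * avg (fun y => 4 * line_err s w u y + 16 * point_defect (mix k y (upd s k w)) +
    8 * score_err (upd s k w) y + 8 * point_defect (mix k y (upd s k u)) + 4 * score_err (upd s k u) y).
Proof.
have sH s' := lv_improved_subpovm projA gT s'.
have cE g : contr (@lv_score _ _ _ _ A k.+1 s g) by apply: expectation_mx_contr => // x; apply: projA.
have := sandwich_completeness hsym (interpML u w) (sH (upd s k u)) (sH (upd s k w)) cE
  (pC s) (C2 s) (pZh s) (gT' s).2.
move/le_trans; apply; rewrite lerD2l ler_pM2l ?ltr0n //.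
pose l (y : pt) a b := if u != w then aff (through u w a b) (y k) else 0.
have -> : \sum_g \sum_h tau (H (upd s k u) g) (H (upd s k w) h) (1%:M - @lv_score _ _ _ _ A k.+1 s (interpML u w g h)) =
  avg (fun y => \sum_g \sum_h tau (H (upd s k u) g) (H (upd s k w) h)
    (1%:M - A (mix k.+1 y s) (l y (lv_value (upd s k u) y g) (lv_value (upd s k w) y h)))).
  rewrite avg_sum; apply: eq_bigr => g _; rewrite avg_sum; apply: eq_bigr => h _.
  rewrite /lv_score (one_sub_expectation_mx (lv_meas A k.+1 s)) // tau_avgC; apply: eq_avg => y.
  rewrite /lv_meas /lv_value interpMLE !mixS_upd (mlk_const _ _ (valP g)) // (mlk_const _ _ (valP h)) //.
  rewrite /l; case: ifP => _; last by rewrite ffunE.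
  by rewrite ffunE mixS updE.
apply: avg_le => y.
have := err_line hnorm hsym (@lv_value _ _ k (upd s k u) y) (@lv_value _ _ k (upd s k w) y) (l y)
  (sH (upd s k u)) (sH (upd s k w)) (projA (mix k y (upd s k u))) (projA (mix k y (upd s k w)))
  (projA (mix k.+1 y s)).
move/le_trans; apply; rewrite 4!lerD2r ler_pM2l ?ltr0n //.
have pA := Apsd projA; have pA1 := A1psd projA.
have tot : \sum_a \sum_b tau (A (mix k y (upd s k u)) a) (A (mix k y (upd s k w)) b) 1%:M = 1.
  under eq_bigr do rewrite -tau_sumY (Asum projA).
  by rewrite -tau_sumT (Asum projA) (tau111 hnorm).
rewrite /line_err; case: ifP => [/and3P[uw uy wy]|_]; last first.
  rewrite -tot; apply: ler_sum => a _; apply: ler_sum => b _.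
  by apply: tau_monoC => //; rewrite subKr.
have -> : \sum_a \sum_b tau (A (mix k y (upd s k u)) a) (A (mix k y (upd s k w)) b)
      (1%:M - A (mix k.+1 y s) (l y a b)) =
    1 - \sum_a \sum_b tau (A (mix k y (upd s k u)) a) (A (mix k y (upd s k w)) b)
      (A (mix k.+1 y s) (l y a b)).
  rewrite -tot -sumrB; apply: eq_bigr => a _; rewrite -sumrB; apply: eq_bigr => b _.
  exact: tauBC.
rewrite /lin_defect lerD2l lerN2 -(sum_aff_pair (fun a b => tau (A (mix k y (upd s k u)) a)
  (A (mix k y (upd s k w)) b) (A (mix k.+1 y s) (l y a b))) uw).
apply: ler_sum => q _.
have -> : l y (aff q u) (aff q w) = aff q (y k).
  rewrite /l uw; congr (aff _ _).
  by have [? ?] := throughE (aff q u) (aff q w) uw; apply: (aff_inj2 uw).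
have e : upd (mix k.+1 y s) k (y k) = mix k.+1 y s by rewrite mixS upd_upd.
by rewrite !mixS_upd e.
Qed.

Definition avg4 (f : pt -> F -> F -> pt -> R) : R :=
  avg (fun s => avg (fun w => avg (fun u => avg (fun y => f s w u y)))).
Lemma avg4D f g : avg4 (fun s w u y => f s w u y + g s w u y) = avg4 f + avg4 g.
Proof.
rewrite /avg4 -avgD; apply: eq_avg => s; rewrite -avgD; apply: eq_avg => w.
by rewrite -avgD; apply: eq_avg => u; rewrite -avgD.
Qed.
Lemma avg4Z b f : avg4 (fun s w u y => b * f s w u y) = b * avg4 f.
Proof.
rewrite /avg4 -avgZ; apply: eq_avg => s; rewrite -avgZ; apply: eq_avg => w.
by rewrite -avgZ; apply: eq_avg => u; rewrite -avgZ.
Qed.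
Lemma avg4_s f : avg4 (fun s _ _ _ => f s) = avg f.
Proof. by apply: eq_avg => s; rewrite !avg_const. Qed.
Lemma avg4_su f : avg4 (fun s _ u y => f (upd s k u) y) = avg (fun s => avg (f s)).
Proof.
rewrite -[RHS](avg_upd k); apply: eq_avg => s.
by rewrite avg_const.
Qed.
Lemma avg4_sw f : avg4 (fun s w _ y => f (upd s k w) y) = avg (fun s => avg (f s)).
Proof.
rewrite -[RHS](avg_upd k); apply: eq_avg => s; apply: eq_avg => w.
by rewrite avg_const.
Qed.

Variables (ce se be ie L c : R).
Hypotheses (hcons : avg (fun s => \sum_g tau (H s g) (1%:M - @lv_score _ _ _ _ A k s g) 1%:M) <= ce)
  (hsc : avg (fun s => selfcons_defect Psi (H s)) <= se)
  (hZb : avg (fun s => tau (1%:M - Z' s) (Z' s + rval eta *: 1%:M) 1%:M) <= be)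
  (hinc : avg (fun s => 1 - tau (Hs s) 1%:M 1%:M) <= ie)
  (hL : avg (axis_defect Psi A k) <= L) (hc : avg point_defect <= c).

Lemma avg_line_err : avg4 line_err <= L + 3 * eta.
Proof.
pose phi z u w t : R := if dist3 u w t then lin_defect Psi (fun t => A (upd z k t)) u w t else 1.
(* The value [y k] is resampled as an independent [t]. The rest of [mix k.+1 y s] only locates the
   axis, since its [k]-th coordinate gets overwritten. *)
have -> : avg4 line_err = avg (fun s => avg (fun y => avg (fun w => avg (fun u => avg (fun t =>
    phi (mix k.+1 y s) u w t))))).
  apply: eq_avg => s.
  rewrite [RHS]avg_exchange; apply: eq_avg => w.
  rewrite [RHS]avg_exchange; apply: eq_avg => u.
  rewrite -(avg_upd k); apply: eq_avg => y; apply: eq_avg => t.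
  rewrite /line_err /phi updE mix_updl' //; case: ifP => // _.
  by congr (1 - _); apply: eq_bigr => l _; rewrite !upd_upd.
rewrite avg_exchange (avg_mix k.+1 (fun z => avg (fun w => avg (fun u => avg (fun t => phi z u w t))))).
apply: le_trans (_ : avg (fun z => axis_defect Psi A k z + 3 * eta) <= _); last first.
  by rewrite avgD avg_const // lerD2r.
apply: avg_le => z; rewrite avg_exchange avg_pair.
rewrite (avg_pair (fun (q : F * F) t => phi z q.1 q.2 t)).
apply: le_trans (lerD (lexx _) (avg_not_dist3 K F)).
rewrite /axis_defect /line_defect -avgD; apply: avg_le => q; rewrite /phi.
by case: ifP => _ /=; rewrite ?mulr0n ?mulr1n ?addr0 ?add0r.
Qed.

Definition pair_err : R := 2 * be + 26 * se + 8 * (4 * (L + 3 * eta) + 16 * c + 8 * ce + 8 * c + 4 * ce).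

Lemma avg_pair_bound :
  avg (fun s => avg (fun w => avg (fun u => tau (C s) (Hs (upd s k w)) (Hs (upd s k u))))) <= pair_err.
Proof.
pose f1 (s : pt) (w u : F) (y : pt) := tau (C s) 1%:M (Z' s + rval eta *: 1%:M).
pose f2 (s : pt) (w u : F) (y : pt) := selfcons_defect Psi (H (upd s k u)).
pose f3 (s : pt) (w u : F) (y : pt) := point_defect (mix k y (upd s k w)).
pose f4 (s : pt) (w u : F) (y : pt) := score_err (upd s k w) y.
pose f5 (s : pt) (w u : F) (y : pt) := point_defect (mix k y (upd s k u)).
pose f6 (s : pt) (w u : F) (y : pt) := score_err (upd s k u) y.
apply: le_trans (_ : avg4 (fun s w u y => 2 * f1 s w u y + 26 * f2 s w u y +
  8 * (4 * line_err s w u y + 16 * f3 s w u y + 8 * f4 s w u y + 8 * f5 s w u y +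
       4 * f6 s w u y)) <= _).
  do 3![apply: avg_le => ?]; rewrite avgD avgZ /f1 /f2 avg_const //; exact: pair_bound.
have lin7 (g1 g2 g3 g4 g5 g6 g7 : pt -> F -> F -> pt -> R) :
  avg4 (fun s w u y => 2 * g1 s w u y + 26 * g2 s w u y +
  8 * (4 * g7 s w u y + 16 * g3 s w u y + 8 * g4 s w u y + 8 * g5 s w u y + 4 * g6 s w u y)) =
  2 * avg4 g1 + 26 * avg4 g2 + 8 * (4 * avg4 g7 + 16 * avg4 g3 + 8 * avg4 g4 + 8 * avg4 g5 +
    4 * avg4 g6) by rewrite 2!avg4D !avg4Z 4!avg4D !avg4Z.
rewrite (lin7 f1 f2 f3 f4 f5 f6 line_err) {lin7}.
have e1 : avg4 f1 = avg (fun s => tau (1%:M - Z' s) (Z' s + rval eta *: 1%:M) 1%:M).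
  by rewrite /f1 avg4_s; apply: eq_avg => s; rewrite (tau12 hsym).
have ec : avg (fun s => avg (fun y => point_defect (mix k y s))) = avg point_defect.
  by rewrite avg_exchange avg_mix.
have e2 : avg4 f2 = avg (fun s => selfcons_defect Psi (H s)).
  apply: etrans (avg4_su (fun s _ => selfcons_defect Psi (H s))) _.
  by apply: eq_avg => s; rewrite avg_const.
have e3 : avg4 f3 = avg point_defect := etrans (avg4_sw (fun s y => point_defect (mix k y s))) ec.
have e4 : avg4 f4 = _ := etrans (avg4_sw score_err) (eq_avg avg_pt_err).
have e5 : avg4 f5 = avg point_defect := etrans (avg4_su (fun s y => point_defect (mix k y s))) ec.
have e6 : avg4 f6 = _ := etrans (avg4_su score_err) (eq_avg avg_pt_err).
rewrite e1 e2 e3 e4 e5 e6.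
exact: (pair_arith avg_line_err hcons hsc hZb hc).
Qed.

Lemma kappa_step : (0 < n)%N ->
  4 * n%:R * kappa Psi A T' <= (2 * n%:R + 1) *
    (2 * (ie + eta) + 2^-1 * (2 * n%:R + 1) * (pair_err + 2 * se)).
Proof.
move=> n0.
have cHs s : contr (Hs s) by exact: (lv_improved_contr projA gT s).
have cG s : contr (mxavg (fun u => Hs (upd s k u))) by apply: mxavg_contr.
have scs s u := selfcons_defect_sum Psi (lv_improved_subpovm projA gT (upd s k u)).
have pt s : 4 * n%:R * (1 - tau (Z' s) 1%:M 1%:M) <= (2 * n%:R + 1) *
    (2 * (avg (fun u => 1 - tau (Hs (upd s k u)) 1%:M 1%:M) + eta) + 2^-1 * (2 * n%:R + 1) *
     (avg (fun w => avg (fun u => tau (C s) (Hs (upd s k w)) (Hs (upd s k u)))) +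
      2 * avg (fun u => selfcons_defect Psi (H (upd s k u))))).
  have N0 : (0 : R) < 2 * n%:R + 1 by rewrite ltr_wpDl // mulr_ge0.
  have -> : 1 - tau (Z' s) 1%:M 1%:M = tau (C s) 1%:M 1%:M by rewrite tauBT (tau111 hnorm).
  have h := completeness_step Psi F0 (fun u => cHs (upd s k u)) (pC s) n0; apply: le_trans h _.
  rewrite ler_pM2l //; apply: lerD.
    rewrite ler_pM2l ?ltr0n //.
    (* [C s] is at most [1 + eta], and the excess [eta] multiplies an expectation that is at most
       1. *)
    have pG := (contrC (cG s)).1.
    have := tau_ge0 Psi (C_eta s) pG p1; rewrite tauBT {1}/tau bfZT -/(tau _ _ _) => h.
    have h2 : tau 1%:M (1%:M - mxavg (fun u => Hs (upd s k u))) 1%:M <= 1.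
      by apply: (tau_le1 hnorm); [split; rewrite ?subrr //; apply: psd0|exact: contrC|split; rewrite ?subrr //; apply: psd0].
    have h3 := ler_wpM2l eta0 h2.
    have -> : avg (fun u => 1 - tau (Hs (upd s k u)) 1%:M 1%:M) =
        tau 1%:M (1%:M - mxavg (fun u => Hs (upd s k u))) 1%:M.
      rewrite tauBY (tau111 hnorm) tau_avgY avgB avg_const //; congr (_ - _).
      by apply: eq_avg => u; rewrite (tau01 hsym).
    move: h h3; move: (tau _ _ _) (tau _ _ _) => a b; lra.
  rewrite ler_pM2l ?mulr_gt0 ?invr_gt0 ?ltr0n //.
  have := avg_square hsym F0 (fun u => cHs (upd s k u)) (pC s) (C2 s) (scs s).
  rewrite tau_avgY; under [X in _ <= X + _]eq_avg => w do rewrite tau_avgC.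
  by [].
rewrite /kappa -avgZ; apply: le_trans (avg_le pt) _.
have N0 : (0 : R) < 2 * n%:R + 1 by rewrite ltr_wpDl // mulr_ge0.
rewrite avgZ ler_pM2l // avgD; apply: lerD.
  rewrite avgZ ler_pM2l ?ltr0n // avgD avg_const // lerD2r.
  by rewrite (avg_upd k (fun s => 1 - tau (Hs s) 1%:M 1%:M)).
rewrite avgZ ler_pM2l ?mulr_gt0 ?invr_gt0 ?ltr0n // avgD avgZ.
rewrite (avg_upd k (fun s => selfcons_defect Psi (H s))).
by apply: lerD; [exact: avg_pair_bound|rewrite ler_pM2l ?ltr0n].
Qed.
End Step.

(** * The two tests as averages *)

Section Extract.
Variables (K : numClosedFieldType) (d : nat) (Psi : state3 K d).
Local Notation R := (realpart K).
Local Notation tau := (tau Psi).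
Hypotheses (hnorm : normalized Psi) (hsym : perm_symmetric Psi).
Variables (F : finFieldType) (n : nat).
Local Notation pt := (point F n).
Variable A : pt -> F -> 'M[K]_d.
Hypothesis projA : forall x, projmeas (A x).
Local Notation point_defect := (point_defect Psi A).
Local Notation axis_defect := (axis_defect Psi A).
Variable e : R.

Lemma re_le (x y : K) : x <= y -> re x <= re y.
Proof. by rewrite -subr_ge0 => /re_ge0; rewrite raddfB subr_ge0. Qed.

Lemma rval_natV m : (m%:R^-1 : K) = rval (m%:R^-1 : R).
Proof. by rewrite rval_inv rval_nat. Qed.

(** Agreement of all three players implies that of the first two. *)
Lemma consistency_bound : 1 - rval e <= cons_prob Psi A -> avg point_defect <= e.
Proof.
move/re_le; rewrite raddfB /= re_rval (re_nat K 1) /cons_prob rval_natV re_scale raddf_sum.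
move=> h.
have : 1 - e <= avg (fun x => \sum_a tau (A x a) (A x a) 1%:M).
  apply: le_trans h _; rewrite -/(avg _); apply: avg_le => x.
  rewrite raddf_sum; apply: ler_sum => a _; rewrite /= expect3E.
  by apply: tau_monoC; [exact: A1psd|exact: Apsd|exact: Apsd].
by rewrite /point_defect avgB avg_const ?card_pt_gt0 //; lra.
Qed.

Let lin_at i (x : pt) t1 t2 t3 : R := lin_defect Psi (fun t => A (upd x i t)) t1 t2 t3.
Let cond i (x : pt) (u w : F) := [&& u != x i, w != x i & u != w].
Let S i : R := \sum_(x : pt) \sum_u \sum_(w | cond i x u w) lin_at i x (x i) u w.

Lemma re_lin_prob : re (lin_prob Psi A) =
  (n%:R * #|{: pt}|%:R * ((#|F| - 1)%:R * (#|F| - 2)%:R))^-1 *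
  \sum_i \sum_(x : pt) \sum_u \sum_(w | cond i x u w) (1 - lin_at i x (x i) u w).
Proof.
rewrite /lin_prob -!natrM rval_natV re_scale; congr (_ * _).
rewrite raddf_sum; apply: eq_bigr => i _; rewrite raddf_sum; apply: eq_bigr => x _.
rewrite raddf_sum; apply: eq_bigr => u _; rewrite raddf_sum.
apply: eq_bigr => w /and3P[ux wx uw].
rewrite /lin_at /lin_defect subKr.
rewrite -(@sum_accept _ R (x i) u w (fun a b c => tau (A (upd x i (x i)) a)
   (A (upd x i u) b) (A (upd x i w) c))) 1?[x i == u]eq_sym //.
rewrite raddf_sum; apply: eq_bigr => a _; rewrite raddf_sum; apply: eq_bigr => b _.
rewrite raddf_sum; apply: eq_bigr => c _ /=.
rewrite upd_same rval_natV re_scale raddf_sum.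
rewrite (eq_bigr (fun _ => tau (A x a) (A (upd x i u) b) (A (upd x i w) c))) => [|s _] /=.
  rewrite sumr_const -[X in _ * X = _]mulr_natl mulrA mulVf ?mul1r // pnatr_eq0 -lt0n.
  by apply/card_gt0P; exists 1%g.
pose O (q : 'I_3) := if q == ord0 then A x a else if q == 1%R then A (upd x i u) b
   else A (upd x i w) c.
by rewrite -[X in re X]/(expect3 Psi (fun k => O (s k))) (expect3_perm hsym) expect3E.
Qed.

Lemma card_cond i x : \sum_u \sum_(w | cond i x u w) (1 : R) = (#|F| - 1)%:R * (#|F| - 2)%:R.
Proof.
have e1 u : \sum_(w | cond i x u w) (1 : R) = if u != x i then (#|F| - 2)%:R else 0.
  rewrite /cond; case: eqP => /= [_|/eqP ux]; first by rewrite big_pred0.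
  rewrite sumr_const; congr _%:R.
  rewrite -[in RHS](cardsC [set x i; u]) cards2 eq_sym ux addKn.
  by apply: eq_card => w; rewrite !inE negb_or (eq_sym w u).
under eq_bigr do rewrite e1.
rewrite -big_mkcond sumr_const -[LHS]mulr_natl; congr (_%:R * _).
by rewrite subn1 -(cardC1 (x i)); apply: eq_card.
Qed.

Lemma lin_at_ge0 i x u w : cond i x u w -> 0 <= lin_at i x (x i) u w.
Proof.
case/and3P => ux _ _.
by apply: (lin_defect_ge0 hnorm (fun t => projA (upd x i t))); rewrite eq_sym.
Qed.

Lemma S_ge0 i : 0 <= S i.
Proof. by do 2![apply: sumr_ge0 => ? _]; apply: sumr_ge0 => w; apply: lin_at_ge0. Qed.

Lemma linz_avg j : avg (axis_defect j) = (#|{: pt}|%:R * (#|F|%:R * #|F|%:R))^-1 * S j.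
Proof.
pose phi x t1 t2 t3 : R := if dist3 t1 t2 t3 then lin_at j x t1 t2 t3 else 0.
have phi_upd x t t1 t2 t3 : phi (upd x j t) t1 t2 t3 = phi x t1 t2 t3.
  rewrite /phi; case: ifP => // _; congr (1 - _); apply: eq_bigr => l _.
  by rewrite !upd_upd.
transitivity (avg (fun x : pt => avg (fun u => avg (fun w => phi x (x j) u w)))).
  rewrite -[RHS](avg_upd j); apply: eq_avg => x.
  rewrite /axis_defect /line_defect -(avg_pair (fun (q : F * F) t => phi x q.1 q.2 t)).
  rewrite -(avg_pair (fun t1 t2 => avg (phi x t1 t2))); apply: eq_avg => t1.
  by do 2![apply: eq_avg => ?]; rewrite phi_upd updE.
rewrite /avg !invfM -!mulrA; congr (_ * _); rewrite /S mulrA mulr_sumr; apply: eq_bigr => x _.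
rewrite -mulrA; congr (_ * _); rewrite mulr_sumr; apply: eq_bigr => u _; congr (_ * _).
rewrite [RHS]big_mkcond; apply: eq_bigr => w _; rewrite /phi /cond /dist3.
by rewrite [x j == u]eq_sym [x j == w]eq_sym.
Qed.

(** The test picks its axis at random, so a single axis may carry [n] times the average failure. The
    test normalises by [(p - 1)(p - 2)] and [axis_defect] by [p^2], which only helps. *)
Lemma linearity_bound j : e < 1 -> 1 - rval e <= lin_prob Psi A -> avg (axis_defect j) <= n%:R * e.
Proof.
move=> e1 /re_le; rewrite raddfB /= re_rval (re_nat K 1) re_lin_prob.
set N : R := n%:R * _ * _.
have -> : \sum_i \sum_(x : pt) \sum_u \sum_(w | cond i x u w) (1 - lin_at i x (x i) u w) =
   N - \sum_i S i.
  have -> : N = \sum_(i < n) \sum_(x : pt) \sum_u \sum_(w | cond i x u w) (1 : R).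
    under eq_bigr => i _ do under eq_bigr => x _ do rewrite card_cond.
    under eq_bigr do rewrite sumr_const.
    by rewrite sumr_const card_ord -[RHS]mulr_natl -[X in _ = _ * X]mulr_natl mulrA.
  rewrite -sumrB; apply: eq_bigr => i _; rewrite /S -sumrB; apply: eq_bigr => x _.
  by rewrite -sumrB; apply: eq_bigr => u _; rewrite -sumrB.
have N0 : 0 <= N by rewrite !mulr_ge0.
(* This is the field with two elements, which has no admissible pair of values: the probability is
   then 0 because the inverse of 0 is 0, contradicting [e < 1]. *)
have [->|Nn] := eqVneq N 0; first by rewrite invr0 mul0r subr_le0 => /le_lt_trans/(_ e1); rewrite ltxx.
have Np : 0 < N by rewrite lt_def Nn.
rewrite mulrBr mulVf // lerD2l lerN2 ler_pdivrMl // => h.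
have Sj : S j <= N * e.
  apply: le_trans h; rewrite (bigD1 j) //= lerDl; apply: sumr_ge0 => i _; exact: S_ge0.
have e0 : 0 <= e by have := le_trans (S_ge0 j) Sj; rewrite pmulr_rge0.
rewrite linz_avg ler_pdivrMl ?mulr_gt0 ?ltr0n ?card_pt_gt0 ?card_F_gt0 //.
apply: le_trans Sj _; rewrite [leRHS]mulrA; apply: ler_wpM2r => //.
rewrite [leRHS]mulrC [leRHS]mulrA; apply: ler_wpM2l; first by rewrite mulr_ge0.
by rewrite -!natrM ler_nat; apply: leq_mul; apply: leq_subr.
Qed.
End Extract.

(** * Numerical bounds *)

Section Arithmetic.
Variables (R : realFieldType) (N del eta e u : R).
Hypotheses (N1 : 1 <= N) (del0 : 0 < del) (del1 : del <= 1) (eta0 : 0 <= eta) (etad : eta <= del).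
Hypotheses (eE : e = del ^+ 2) (uE : u = N ^+ 3 * del).
Local Ltac lra_hyps := move: N1 del0 del1 eta0 etad; lra.
Local Notation edge := (12 * (N * e) + 16 * e + 5 * eta).
Local Notation gp := (2 * N * (N * (4 * edge + 4 * e)) + 4 * e).
Local Notation m := (e / del + 2 * del).

Lemma sq_le_self : e <= del.
Proof. by rewrite eE expr2 ler_piMl // ltW. Qed.

Lemma powers_le : [/\ del <= N * del, N * del <= u & 0 <= del].
Proof.
have d0 := ltW del0; split=> //; first exact: ler_peMl.
by rewrite uE ler_pM2r // ler_eXnr.
Qed.

Lemma edge_le : edge <= 33 * (N * del).
Proof.
have h := sq_le_self; have [h1 _ _] := powers_le.
have h2 : N * e <= N * del by rewrite ler_wpM2l ?(le_trans ler01).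
lra_hyps.
Qed.

(** The edge error is [O(N del)] and the walk costs a further [N^2]; this is the origin of the unit
    [u = N^3 del]. *)
Lemma gap_arith : gp <= 276 * u.
Proof.
have h := sq_le_self; have [h1 h2 _] := powers_le; have h3 := edge_le.
have N0 : 0 <= N by apply: le_trans N1.
have h4 : N * (4 * edge + 4 * e) <= N * (136 * (N * del)) by apply: ler_wpM2l => //; lra_hyps.
have h5 : 2 * N * (N * (4 * edge + 4 * e)) <= 2 * N * (N * (136 * (N * del))).
  by apply: ler_wpM2l h4; rewrite mulr_ge0.
have h6 : 2 * N * (N * (136 * (N * del))) = 272 * u by rewrite uE; ring.
lra_hyps.
Qed.

Lemma move_arith : m = 3 * del.
Proof. by rewrite eE; field; rewrite gt_eqF. Qed.

Lemma cons_arith : gp + m <= 279 * u.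
Proof. by have := gap_arith; have [h1 h2 _] := powers_le; rewrite move_arith; lra_hyps. Qed.

Lemma self_arith : eta + 6 * m + 3 * gp + N * eta <= 848 * u.
Proof.
have := gap_arith; have [h1 h2 _] := powers_le; rewrite move_arith.
have : N * eta <= N * del by rewrite ler_wpM2l ?(le_trans ler01).
lra_hyps.
Qed.

Lemma bound_arith : eta + 3 * m + gp <= 286 * u.
Proof. by have := gap_arith; have [h1 h2 _] := powers_le; rewrite move_arith; lra_hyps. Qed.

Lemma pair_err_arith (be se ce : R) : be <= 286 * u -> se <= 848 * u -> ce <= 279 * u ->
  2 * be + 26 * se + 8 * (4 * (N * e + 3 * eta) + 16 * e + 8 * ce + 8 * e + 4 * ce) + 2 * se
  <= 600 * (100 * u).
Proof.
have h := sq_le_self; have [h1 h2 _] := powers_le.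
have h4 : N * e <= N * del by rewrite ler_wpM2l ?(le_trans ler01).
lra_hyps.
Qed.

Local Notation v := (100 * (1000 * (N * u))).

Lemma increment_arith X : X <= 600 * (100 * u) ->
  (2 * N + 1) * (2 * (7 * del) + 2^-1 * (2 * N + 1) * X) <= 4 * N * v.
Proof.
move=> hX; have N0 : 0 <= N by apply: le_trans N1.
have [h1 h2 d0] := powers_le; have u0 : 0 <= u by lra_hyps.
have c0 : 0 <= 2^-1 * (2 * N + 1) by lra_hyps.
have h3 := ler_wpM2l c0 hX.
have h4 : 2^-1 * (2 * N + 1) * (600 * (100 * u)) <= 3 / 2 * N * (600 * (100 * u)).
  by apply: ler_wpM2r; lra_hyps.
have h5 : u <= N * u by apply: ler_peMl.
have h6 : 2 * (7 * del) + 2^-1 * (2 * N + 1) * X <= 1000 * (100 * (N * u)) by lra_hyps.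
have h7 : (2 * N + 1) * (2 * (7 * del) + 2^-1 * (2 * N + 1) * X) <=
   (2 * N + 1) * (1000 * (100 * (N * u))) by apply: ler_wpM2l h6; lra_hyps.
apply: le_trans h7 _; rewrite -[leLHS]/(_ * _).
have -> : 4 * N * v = (4 * N) * (1000 * (100 * (N * u))) by ring.
by apply: ler_wpM2r; lra_hyps.
Qed.

(** The majorant [(1 + k / N) (k + 1) w0] is a polynomial substitute for the exact solution, in
    powers of [1 + 1 / (2 N)], of the recursion. It is inductive because [k <= N] keeps its first
    factor at most 2. *)
Lemma level_arith (k ka ka' w X w0 : R) : 0 <= k -> k <= N -> 0 <= w0 ->
  4 * N * ka' <= (2 * N + 1) * (2 * (ka + w) + 2^-1 * (2 * N + 1) * X) ->
  (2 * N + 1) * (2 * w + 2^-1 * (2 * N + 1) * X) <= 4 * N * w0 ->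
  N * ka <= (N + k) * (k + 1) * w0 -> N * ka' <= (N + (k + 1)) * (k + 1 + 1) * w0.
Proof.
move=> k0 kN w00 h1 h2 h3; have N0 : 0 < N by apply: lt_le_trans N1.
have h4 : 4 * N * ka' <= 2 * (2 * N + 1) * ka + 4 * N * w0 by lra_hyps.
have h5 := ler_wpM2l (ltW N0) h4.
have h6 : 2 * (2 * N + 1) * (N * ka) <= 2 * (2 * N + 1) * ((N + k) * (k + 1) * w0).
  by apply: ler_wpM2l h3; lra_hyps.
rewrite -(ler_pM2l (_ : 0 < 4 * N)); last by lra_hyps.
have h7 : (N + k) * ((k + 1) * w0) <= 2 * N * ((k + 1) * w0).
  by apply: ler_wpM2r; [rewrite mulr_ge0 //; lra|lra].
have h8 : 0 <= N * ((k + 1) * w0) by rewrite !mulr_ge0 ?(ltW N0) //; lra.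
have -> : 4 * N * ((N + (k + 1)) * (k + 1 + 1) * w0) = 2 * (2 * N + 1) * ((N + k) * (k + 1) * w0)
   + N * (4 * N * w0) + 8 * (N * ((k + 1) * w0)) - 2 * ((N + k) * ((k + 1) * w0)) by ring.
have e1 : 4 * N * (N * ka') = N * (4 * N * ka') by ring.
have e2 : N * (2 * (2 * N + 1) * ka + 4 * N * w0) = 2 * (2 * N + 1) * (N * ka) + N * (4 * N * w0).
  by ring.
rewrite e1; apply: le_trans h5 _; rewrite e2.
move: h6 h7 h8; rewrite -!(mulrA 2 N).
move: (2 * (2 * N + 1) * (N * ka)) (2 * (2 * N + 1) * _) (N * (4 * N * w0)) (N * ((k + 1) * w0))
  ((N + k) * ((k + 1) * w0)) => x1 x2 x3 x4 x5; lra.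
Qed.

(** After [N] levels the loss is of order [N v], that is [N^5 del = g * (N^5 g)], which is at most
    [g]. *)
Lemma final_arith (ka a b g : R) : N * ka <= (N + N) * (N + 1) * v ->
  a + b <= ka + 2 * (3 * del) + 279 * u -> 0 <= a -> 0 <= b ->
  del = g ^+ 2 -> 0 <= g -> N ^+ 5 * g <= 1 ->
  4 * e + 2 * a + 4 * b <= 2000 * (1000 * g).
Proof.
move=> h1 h2 a0 b0 dg g0 Ng; have N0 : 0 < N by apply: lt_le_trans N1.
have h3 : ka <= 2 * (N + 1) * v.
  rewrite -(ler_pM2l N0); apply: le_trans h1 _.
  by rewrite le_eqVlt; apply/orP; left; apply/eqP; ring.
have [d1 d2 d0] := powers_le; have h := sq_le_self; have u0 : 0 <= u by lra_hyps.
have h5 : u <= N * u by apply: ler_peMl.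
have Nu0 : 0 <= N * u by lra_hyps.
have h4 : N * u <= N * (N * u) by apply: ler_peMl.
have h6 : N * (N * u) = g * (N ^+ 5 * g) by rewrite uE dg; ring.
have h7 : g * (N ^+ 5 * g) <= g by apply: ler_piMr.
have h8 : 2 * (N + 1) * v <= 400 * (1000 * (N * (N * u))) by lra_hyps.
lra_hyps.
Qed.
End Arithmetic.

(** * The resulting sub-measurement *)

Lemma contr_sqrt (K : numClosedFieldType) d (M : 'M[K]_d) : contr M ->
  exists2 S, contr S & S *m S = M.
Proof.
move=> [pM p1M]; have [S pS eS] := psd_sqrt pM; exists S => //; split=> //.
have hadj : adjmx (1%:M - S) = 1%:M - S by rewrite raddfB /= adjmx1 (psd_adj pS).
(* [1 - S = ((1 - S)^2 + (1 - S^2)) / 2] *)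
have -> : 1%:M - S = rval (2%:R^-1 : realpart K) *:
    (adjmx (1%:M - S) *m (1%:M - S) + (1%:M - M)).
  rewrite hadj mulmxBl !mulmxBr !mul1mx mulmx1 eS.
  rewrite opprB addrAC -addrA subrKA -mulr2n -scaler_nat scalerA rval_inv rval_nat.
  by rewrite mulVf ?pnatr_eq0 // scale1r.
apply: psdZ; first by rewrite -[0]/(rval 0) rval_le invr_ge0 ler0n.
exact: psdD (psd_gram _) _.
Qed.

Section Final.
Variables (K : numClosedFieldType) (d : nat) (Psi : state3 K d).
Local Notation R := (realpart K).
Local Notation tau := (tau Psi).
Local Notation psi := (psi Psi).
Hypotheses (hnorm : normalized Psi) (hsym : perm_symmetric Psi).
Let p1 : psdmx (1%:M : 'M[K]_d). Proof. exact: psd1. Qed.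

(** Pass through the vector where player 1 measures [B a]. The cross term <S (x) B> is at least <S^2
    (x) B>, because a contraction dominates its square; this is how the square root of V is traded
    for V itself. *)
Lemma sqrt_distance (I : finType) (B S : I -> 'M[K]_d) :
  projmeas B -> (forall a, contr (S a)) ->
  \sum_a tau ((B a - S a) *m (B a - S a)) 1%:M 1%:M <=
  4 * (1 - \sum_a tau (B a) (B a) 1%:M) +
  2 * (1 - \sum_a tau (S a *m S a) 1%:M 1%:M) +
  4 * \sum_a tau (S a *m S a) (1%:M - B a) 1%:M.
Proof.
move=> [hB sB] cS.
have BM a : B a *m B a = B a by case: (hB a).
have Badj a : adjmx (B a) = B a by case: (hB a).
have cB a : contr (B a) by apply: proj_contr.
have Sadj a : adjmx (S a) = S a := psd_adj (cS a).1.
pose b0 a := app3 (B a) 1%:M 1%:M psi; pose b1 a := app3 1%:M (B a) 1%:M psi.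
pose s0 a := app3 (S a) 1%:M 1%:M psi.
have dE a : tau ((B a - S a) *m (B a - S a)) 1%:M 1%:M =
    bf 1%:M 1%:M 1%:M (b0 a - s0 a) (b0 a - s0 a).
  have -> : b0 a - s0 a = app3 (B a - S a) 1%:M 1%:M psi by rewrite /app3 appBl.
  have hadj : adjmx (B a - S a) = B a - S a by rewrite raddfB /= Badj Sadj.
  by rewrite tau_vv hadj !(adjmx1, mul1mx, mulmx1).
have e1 a : bf 1%:M 1%:M 1%:M (b0 a - b1 a) (b0 a - b1 a) =
    tau (B a) 1%:M 1%:M - 2 * tau (B a) (B a) 1%:M + tau 1%:M (B a) 1%:M.
  by rewrite bf_quadB // !tau_vv !(adjmx1, Badj, mul1mx, mulmx1, BM).
have e2 a : bf 1%:M 1%:M 1%:M (b1 a - s0 a) (b1 a - s0 a) <=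
    tau 1%:M (B a) 1%:M - 2 * tau (S a *m S a) (B a) 1%:M + tau (S a *m S a) 1%:M 1%:M.
  rewrite bf_quadB // !tau_vv !(adjmx1, Badj, Sadj, mul1mx, mulmx1, BM).
  rewrite lerD2r lerD2l lerN2 ler_pM2l ?ltr0n //.
  by apply: tau_monoT => //; [exact: contr_sq|exact: (cB a).1].
apply: le_trans (_ : \sum_a (2 * (tau (B a) 1%:M 1%:M - 2 * tau (B a) (B a) 1%:M + tau 1%:M (B a) 1%:M)
  + 2 * (tau 1%:M (B a) 1%:M - 2 * tau (S a *m S a) (B a) 1%:M + tau (S a *m S a) 1%:M 1%:M)) <= _).
  apply: ler_sum => a _; rewrite dE -e1.
  have := bf_add_le p1 p1 p1 (b0 a - b1 a) (b1 a - s0 a); rewrite subrKA => h.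
  by apply: le_trans h _; rewrite lerD2l ler_pM2l ?ltr0n.
have -> : \sum_a tau (S a *m S a) (1%:M - B a) 1%:M =
   \sum_a tau (S a *m S a) 1%:M 1%:M - \sum_a tau (S a *m S a) (B a) 1%:M.
  by rewrite -sumrB; apply: eq_bigr => a _; rewrite tauBY.
rewrite big_split /= -!mulr_sumr !big_split /= !sumrN -!mulr_sumr -tau_sumT -tau_sumY sB (tau111 hnorm).
move: (\sum_a _) (\sum_a _) (\sum_a _) => x y z.
suff arith (x' y' z' : R) : 2 * (1 - 2 * x' + 1) + 2 * (1 - 2 * y' + z') <=
  4 * (1 - x') + 2 * (1 - z') + 4 * (z' - y') by apply: arith.
lra.
Qed.

Lemma avg_exists (I : finType) (f : I -> R) (b : R) : (0 < #|I|)%N -> avg f <= b ->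
  exists i, f i <= b.
Proof.
move=> I0 h; have [/existsP[i hi]|/existsPn no] := boolP [exists i, f i <= b]; first by exists i.
exfalso; move: h; rewrite leNgt => /negP; apply.
rewrite -[ltLHS](avg_const _ I0) /avg ltr_pM2l ?invr_gt0 ?ltr0n //.
have [i0 _] : exists i : I, true by have /card_gt0P[i _] := I0; exists i.
rewrite (bigD1 i0) //= [ltRHS](bigD1 i0) //=; apply: ltr_leD; first by rewrite ltNge no.
by apply: ler_sum => i _; rewrite ltW // ltNge no.
Qed.
End Final.

Section Assembly.
Variables (K : numClosedFieldType) (d : nat) (Psi : state3 K d).
Local Notation R := (realpart K).
Local Notation tau := (tau Psi).
Hypotheses (hnorm : normalized Psi) (hsym : perm_symmetric Psi).
Variables (F : finFieldType) (n : nat).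
Local Notation pt := (point F n).
Variable A : pt -> F -> 'M[K]_d.
Hypothesis projA : forall x, projmeas (A x).
Hypothesis n0 : (0 < n)%N.
Local Notation N := (n%:R : R).
Local Notation eta := (#|F|%:R^-1 : R).
Variables (e del : R).
Hypotheses (del0 : 0 < del) (del1 : del <= 1) (etad : eta <= del) (eE : e = del ^+ 2).
Hypotheses (hc : avg (point_defect Psi A) <= e) (hL : forall j, avg (axis_defect Psi A j) <= N * e).
Local Notation u := (N ^+ 3 * del).
Local Notation v := (100 * (1000 * (N * u))).
Let N1 : 1 <= N. Proof. by rewrite ler1n. Qed.
Let eta0 : 0 <= eta. Proof. by rewrite invr_ge0 ler0n. Qed.

Lemma level_bound k : (k <= n)%N ->
  exists2 T : pt -> ML F n k -> 'M[K]_d, good A T &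
    N * kappa Psi A T <= (N + k%:R) * (k%:R + 1) * v.
Proof.
have [d1 d2 d0] := powers_le N1 del0 (erefl u).
have u0 : 0 <= u by apply: le_trans d2; apply: le_trans d1.
have Nu : u <= N * u by apply: ler_peMl.
have v0 : 0 <= v by rewrite !mulr_ge0 // (le_trans ler01 N1).
elim: k => [_|k IHk lt].
  have [T gT] := good_exists projA 0; exists T => //.
  have h := kappa0 hnorm hsym projA hc gT.
  rewrite addr0 add0r mulr1; apply: ler_wpM2l; first by rewrite (le_trans ler01 N1).
  apply: le_trans h _; have h2 := sq_le_self del0 del1 eE.
  move: h2 d1 d2 Nu v0 etad u0; move: u => U.
  suff arith (x y z w t : R) : x <= t -> t <= w -> w <= z -> z <= y -> 0 <= z ->
     forall b, b <= t -> x + b <= 100 * (1000 * y).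
    by move=> h2 h3 h4 h5 _ h6 h7; apply: (arith _ _ _ _ _ h2 h3 h4 h5 h7).
  move=> h2 h3 h4 h5 h6 b h7; lra.
have [T gT hT] := IHk (ltnW lt); have [T' gT'] := good_exists projA k.+1.
exists T' => //; pose j := Ordinal lt.
have kn := ltnW lt.
have s1 := avg_consistent hnorm hsym projA del0 hL hc n0 kn gT.
have s2 := avg_scdef hnorm hsym projA del0 hL hc n0 kn gT.
have s3 := avg_Zbound hnorm hsym projA del0 hL hc n0 lt gT'.
have s4 := avg_incomplete hnorm hsym projA del0 hc gT.
have := kappa_step (k := j) hnorm hsym projA gT gT' s1 s2 s3 s4 (hL j) hc n0.
set X := pair_err _ _ _ _ _ _ + _ => st.
have hX : X <= 600 * (100 * u).
  apply: pair_err_arith N1 del0 del1 eta0 etad eE (erefl u) _ _ _ _ _ _.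
  - exact: bound_arith.
  - exact: self_arith.
  - exact: cons_arith.
have inc := increment_arith N1 del0 del1 eta0 etad (erefl u) hX.
(* [7 * del] collects [2 * move_err = 6 * del] and [eta <= del]. *)
rewrite -natr1; apply: (level_arith N1 del0 del1 eta0 etad (w := 7 * del) (X := X) _ _ v0 _ inc hT) => //.
  by rewrite ler_nat.
apply: le_trans st _; have N0 : (0 : R) <= 2 * N + 1 by rewrite addr_ge0 // mulr_ge0.
apply: ler_wpM2l => //; rewrite lerD2r ler_pM2l ?ltr0n //.
rewrite -addrA lerD2l /move_err (move_arith del0 eE); move: etad; lra.
Qed.

Lemma final_strategy (g : R) : del = g ^+ 2 -> 0 <= g -> N ^+ 5 * g <= 1 ->
  exists2 H : ML F n n -> 'M[K]_d, subpovm H &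
    forall S : pt -> F -> 'M[K]_d,
      (forall x a, contr (S x a) /\ S x a *m S x a = \sum_(h : ML F n n | val h x == a) H h) ->
      avg (fun x => \sum_a tau ((A x a - S x a) *m (A x a - S x a)) 1%:M 1%:M)
        <= 2000 * (1000 * g).
Proof.
move=> dg g0 Ng; have [T gT hT] := level_bound (leqnn n).
have X0 := card_pt_gt0 F n.
have s1 := avg_consistent hnorm hsym projA del0 hL hc n0 (leqnn n) gT.
have s4 := avg_incomplete hnorm hsym projA del0 hc gT.
(* At level [n] the tail no longer affects [A], but [T] was chosen for each [s] separately. One [s]
   is fixed at which incompleteness and inconsistency are small together. *)
have := lerD s4 s1; rewrite -avgD => /(avg_exists X0)[s hs].
exists (lv_improved A T s); first exact: lv_improved_subpovm.
move=> S hS; set H := lv_improved A T s in hs hS *.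
have sH : subpovm H by exact: lv_improved_subpovm.
pose b := \sum_h tau (H h) (1%:M - @lv_score _ _ _ _ A n s h) 1%:M.
pose a := 1 - tau (\sum_h H h) 1%:M 1%:M.
have a0 : 0 <= a.
  rewrite subr_ge0; apply: (tau_le1 hnorm); [exact: subpovm_contr|..];
    by split; rewrite ?subrr; [apply: psd1|apply: psd0].
have b0 : 0 <= b.
  apply: sumr_ge0 => h _; apply: tau_ge0; [exact: sH.1| |exact: psd1].
  by apply: (contrC (expectation_mx_contr _ X0 _ _)).1 => x; apply: projA.
have tot x : \sum_a' S x a' *m S x a' = \sum_h H h.
  rewrite [RHS](partition_big (fun h : ML F n n => val h x) predT) //=.
  by apply: eq_bigr => a' _; rewrite (hS x a').2.
have pt x : \sum_a' tau ((A x a' - S x a') *m (A x a' - S x a')) 1%:M 1%:M <=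
    4 * point_defect Psi A x + 2 * a + 4 * \sum_h tau (H h) (1%:M - lv_meas A n s x (lv_value s x h)) 1%:M.
  apply: le_trans (sqrt_distance hnorm (projA x) (fun a' => (hS x a').1)) _.
  rewrite -tau_sumT tot lerD2l ler_pM2l ?ltr0n // le_eqVlt; apply/orP; left; apply/eqP.
  rewrite [RHS](partition_big (fun h : ML F n n => val h x) predT) //=.
  apply: eq_bigr => a' _; rewrite (hS x a').2 tau_sumT; apply: eq_bigr => h /eqP <-.
  by rewrite /lv_meas /lv_value mixn.
apply: le_trans (avg_le pt) _; rewrite 2!avgD 3!avgZ avg_const //.
have -> : avg (fun x => \sum_h tau (H h) (1%:M - lv_meas A n s x (lv_value s x h)) 1%:M) = b.
  rewrite avg_sum; apply: eq_bigr => h _.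
  by rewrite /lv_score (one_sub_expectation_mx (lv_meas A n s)) // tau_avgY.
have fin h2 := final_arith N1 del0 del1 eta0 etad eE (erefl u) hT h2 a0 b0 dg g0 Ng.
apply: le_trans (fin _).
  by rewrite 2!lerD2r ler_pM2l ?ltr0n.
apply: le_trans hs _; rewrite /move_err (move_arith del0 eE) lerD2l.
exact: (cons_arith N1 del0 del1 eta0 etad eE (erefl u)).
Qed.
End Assembly.

(** * Rational powers of the statement and the main result *)

Lemma rpowE (K : numClosedFieldType) (x : K) (q : rat) a b :
  numq q = a -> denq q = b -> rpow x q = (absz b).-root (x ^ a).
Proof. by rewrite /rpow => -> ->. Qed.

Lemma rpow_quarter (K : numClosedFieldType) (x : K) : rpow x (1 / 4) = 4.-root x.
Proof. exact: (@rpowE K x (1 / 4) 1 4). Qed.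

Lemma rpow_neg_half (K : numClosedFieldType) (x : K) : rpow x (- (1 / 2)) = 2.-root x^-1.
Proof. exact: (@rpowE K x (- (1 / 2)) (-1) 2). Qed.

Lemma rpow_neg_twenty (K : numClosedFieldType) (x : K) :
  rpow x (- (2 / (1 / 10))) = (x ^+ 20)^-1.
Proof.
by rewrite (@rpowE K x (- (2 / (1 / 10))) (-20) 1) // root1C.
Qed.

Lemma inv_nat_between (R : numFieldType) m : (1 < m)%N -> 0 < 1 / (m%:R : R) < 1.
Proof.
move=> m1; have m0 : (0 : R) < m%:R by rewrite ltr0n (ltn_trans _ m1).
by rewrite divr_gt0 //= ltr_pdivrMr // mul1r ltr1n.
Qed.

Lemma rval_natM (K : numClosedFieldType) (m k : nat) (x : realpart K) :
  rval (m%:R * (k%:R * x)) = ratr (m%:R * k%:R) * rval x.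
Proof. by rewrite -natrM ratr_nat natrM -!(rval_nat K) -mulrA. Qed.

Lemma one_lt_constant (R : numDomainType) : (1 : R) < 2000 * 1000.
Proof. by apply: mulr_egt1; rewrite ltr1n. Qed.

Theorem theorem2 :
  exists c0 c C : rat, [/\ 0 < c0 < 1, 0 < c < 1 & 1 < C] /\
  forall (K : numClosedFieldType) (F : finFieldType) (n d : nat)
         (Psi : state3 K d) (A : point F n -> F -> 'M[K]_d) (eps : K),
    (1 <= n)%N ->
    normalized Psi -> perm_symmetric Psi ->
    (forall x, projmeas (A x)) ->
    0 < eps ->
    1 - eps <= cons_prob Psi A ->
    1 - eps <= lin_prob Psi A ->
    (n%:R ^+ 4 * rpow eps (- (1 / 2)) <= #|F|%:R) ->
    eps <= rpow (n%:R) (- (2 / c0)) ->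
    exists (V : {ffun point F n -> F} -> 'M[K]_d)
           (S : point F n -> F -> 'M[K]_d),
      [/\ forall g, multilinear g -> psdmx (V g),
          psdmx (1%:M - \sum_(g | multilinear g) V g),
          (* S x a is the (unique) PSD square root of V_x^a *)
          forall x a, psdmx (S x a) /\
            S x a *m S x a = \sum_(g | multilinear g && (g x == a)) V g &
          (#|{: point F n}|%:R)^-1 *
            \sum_(x : point F n) \sum_(a : F)
              \tr ((A x a - S x a) *m (A x a - S x a) *m rho1 Psi)
          <= ratr C * rpow eps c].
Proof.
(* The loss is about [n^5 sqrt eps]. With [g = eps^(1/4)] it is [(n^5 g) g], so the bound [O(g)]
   asks for [n^20 eps <= 1], that is [2 / c0 = 20], and gives [c = 1 / 4]. *)
exists (1 / 10), (1 / 4), (2000 * 1000); split.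
  by split; [exact: inv_nat_between|exact: inv_nat_between|exact: one_lt_constant].
move=> K F n d Psi A eps n0 hnorm hsym projA eps0 hcons hlin hp hn.
pose R := realpart K.
rewrite rpow_quarter; rewrite rpow_neg_half in hp; rewrite rpow_neg_twenty in hn.
pose g : R := re (4.-root eps).
have root0 : 0 <= 4.-root eps by rewrite rootC_ge0 // ltW.
have gE : rval g = 4.-root eps by rewrite rval_re ?ger0_real.
have g0 : 0 < g by rewrite -rval_lt gE rootC_gt0.
have epsE : eps = rval (g ^+ 4).
  by rewrite -[RHS]/(rval g ^+ 4) gE rootCK.
have K_of_R (z : K) : 0 <= z -> re z <= 2000 * (1000 * g) ->
    z <= ratr (2000 * 1000) * 4.-root eps.
  move=> z0; rewrite -rval_le rval_re ?ger0_real // => h; apply: le_trans h _.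
  by rewrite -gE rval_natM.
have trace_ge0 S : (forall x a, psdmx (S x a)) -> 0 <= (#|{: point F n}|%:R)^-1 *
     \sum_(x : point F n) \sum_(a : F) \tr ((A x a - S x a) *m (A x a - S x a) *m rho1 Psi).
  move=> pS; rewrite mulr_ge0 ?invr_ge0 ?ler0n //.
  apply: sumr_ge0 => x _; apply: sumr_ge0 => a _; apply: tr_sq_ge0.
  rewrite raddfB /=; congr (_ - _); last exact: psd_adj.
  by have [hA _] := projA x; case: (hA a).
have trace_re S : re ((#|{: point F n}|%:R)^-1 *
     \sum_(x : point F n) \sum_(a : F) \tr ((A x a - S x a) *m (A x a - S x a) *m rho1 Psi)) =
   avg (fun x => \sum_a tau Psi ((A x a - S x a) *m (A x a - S x a)) 1%:M 1%:M).
  rewrite rval_natV re_scale raddf_sum; congr (_ * _); apply: eq_bigr => x _.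
  by rewrite raddf_sum; apply: eq_bigr => a _; rewrite /= re_tr_rho1.
have [eps1|epsN1] := boolP (g ^+ 4 < 1); last first.
  (* For [eps >= 1] the zero sub-measurement will do: its error is exactly 1. *)
  exists (fun _ => 0), (fun _ _ => 0); split=> [h _| |x a|].
  - exact: psd0.
  - by rewrite big1 // subr0; apply: psd1.
  - by rewrite mulmx0 big1 //; split=> //; apply: psd0.
  apply: K_of_R; first by apply: trace_ge0 => *; apply: psd0.
  rewrite trace_re (eq_avg (g := fun _ => 1)) => [|x]; last first.
    have [hA sA] := projA x; rewrite -[RHS](tau111 hnorm) -[X in _ = tau _ X _ _]sA tau_sumT.
    by apply: eq_bigr => a _; rewrite subr0; case: (hA a) => ->.
  rewrite avg_const ?card_pt_gt0 // mulrA.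
  have g1 : 1 <= g.
    rewrite leNgt; apply: contra epsN1 => lt; apply: exprn_ilt1 => //; exact: ltW.
  apply: le_trans g1 _; apply: ler_peMl; first exact: ltW.
  by rewrite mulr_ege1 // ler1n.
have [N1 N0] : (1 : R) <= n%:R /\ (0 : R) < n%:R by rewrite ler1n ltr0n.
have del0 : 0 < g ^+ 2 by rewrite exprn_gt0.
have g1 : g <= 1.
  by rewrite leNgt; apply/negP => lt; move: eps1; rewrite ltNge exprn_ege1 // ltW.
have del1 : g ^+ 2 <= 1 by rewrite exprn_ile1 // ltW.
have eE : g ^+ 4 = (g ^+ 2) ^+ 2 by rewrite -exprM.
have hc : avg (point_defect Psi A) <= g ^+ 4.
  by apply: (consistency_bound projA); rewrite -epsE.
have hL j : avg (axis_defect Psi A j) <= n%:R * g ^+ 4.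
  by apply: (linearity_bound hnorm hsym projA) => //; rewrite -epsE.
have F0 : (0 : R) < #|F|%:R by rewrite ltr0n card_F_gt0.
(* From the hypothesis on the field size, using only that [n^4 >= 1]. *)
have etad : (#|F|%:R^-1 : R) <= g ^+ 2.
  have w0 : 0 <= rval (g ^+ 2)^-1 by rewrite -[0]/(rval 0) rval_le invr_ge0 ltW.
  have hr : 2.-root eps^-1 = rval (g ^+ 2)^-1.
    rewrite epsE -rval_inv -[RHS](@exprCK K 2) //; congr (2.-root _).
    by rewrite -[RHS]/(rval ((g ^+ 2)^-1 ^+ 2)) exprVn -exprM.
  rewrite -[leRHS]invrK lef_pV2 ?posrE ?invr_gt0 // -rval_le rval_nat.
  apply: le_trans hp; rewrite hr; apply: ler_peMl => //.
  by rewrite exprn_ege1 // ler1n.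
have Ng : n%:R ^+ 5 * g <= 1.
  have h : n%:R ^+ 20 * g ^+ 4 <= 1 :> R.
    rewrite -ler_pdivlMl ?exprn_gt0 // mulr1 -rval_le -epsE rval_inv.
    by apply: le_trans hn _; rewrite -(rval_nat K).
  rewrite leNgt; apply/negP => lt; move: h; rewrite leNgt => /negP; apply.
  have -> : n%:R ^+ 20 * g ^+ 4 = (n%:R ^+ 5 * g) ^+ 4 by rewrite exprMn -exprM.
  by rewrite exprn_egt1.
have [H sH hH] := final_strategy hnorm hsym projA n0 del0 del1 etad eE hc hL (erefl _) (ltW g0) Ng.
(* Extended by 0 to functions that are not multilinear, since the statement indexes V by all
   functions. *)
pose V (h : {ffun point F n -> F}) : 'M[K]_d := if insub h is Some q then H q else 0.
have sumV (P : pred {ffun point F n -> F}) :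
    \sum_(h | multilinear h && P h) V h = \sum_(q : ML F n n | P (val q)) H q.
  rewrite (reindex_omap (val : ML F n n -> _) insub) => [|h /andP[mh _]]; last first.
    by rewrite insubT ?mlk_n.
  apply: eq_big => q; first by rewrite valK eqxx andbT -(mlk_n (val q)) (valP q).
  by move=> _; rewrite /V valK.
have cH x a : contr (\sum_(q : ML F n n | val q x == a) H q).
  apply: contr_le (subpovm_contr sH); first by apply: psd_sum => q _; apply: sH.1.
  rewrite [X in X - _](bigID (fun q : ML F n n => val q x == a)) /= addrAC subrr add0r.
  by apply: psd_sum => q _; apply: sH.1.
have /fin_all_exists[S0 hS0] (q : point F n * F) : exists S : 'M[K]_d,
    contr S /\ S *m S = \sum_(h : ML F n n | val h q.1 == q.2) H h.
  by have [S cS eS] := contr_sqrt (cH q.1 q.2); exists S.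
pose S x a := S0 (x, a).
have hS x a : contr (S x a) /\ S x a *m S x a = \sum_(h : ML F n n | val h x == a) H h.
  exact: (hS0 (x, a)).
exists V, S; split=> [h mh| |x a|].
- by rewrite /V; case: insubP => [q _ _|_]; [apply: sH.1|apply: psd0].
- have -> : \sum_(h | multilinear h) V h = \sum_q H q.
    by rewrite -(sumV predT); apply: eq_bigl => h; rewrite andbT.
  exact: sH.2.
- by rewrite sumV; split; [case: (hS x a).1|case: (hS x a)].
- apply: K_of_R; first by apply: trace_ge0 => x a; case: (hS x a).1.
  by rewrite trace_re; apply: hH.
Qed.
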